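(* Let $\mu$ be a nonnegative locally integrable function on $\mathbb{R}^N$ and $T>0$. Suppose $f\colon[0,\infty)\to[0,\infty)$ satisfies (M), (S) and (C). Then there exist $C_*=C_*(f)\in(0,1)$ and $T_*\in(0,T)$ such that if problem (SHE) possesses a solution in $Q_T$, then $F([S(t)\mu](x))\ge C_*t$ for almost all $(x,t)\in Q_{T_*}$.
   Context: $N\ge1$, $0<\theta\le2$. Problem (SHE): $\partial_t u+(-\Delta)^{\theta/2}u=f(u)$ in $\mathbb{R}^N\times(0,\infty)$, $u(\cdot,0)=\mu$. $\Gamma_\theta$ is the fundamental solution of $\partial_t u+(-\Delta)^{\theta/2}u=0$, $[S(t)\mu](x)=\int\Gamma_\theta(x-y,t)\mu(y)\,dy$, $Q_T=\mathbb{R}^N\times(0,T)$. A solution in $Q_T$ is a nonnegative measurable a.e.-finite $u$ with $u(x,t)=[S(t)\mu](x)+\int_0^t\int\Gamma_\theta(x-y,t-s)f(u(y,s))\,dy\,ds$ for a.a. $(x,t)\in Q_T$. (M) $f$ continuous, nondecreasing, $f(u)>0$ for $u>0$. (S) there is $\tau_0>0$ with $f\in C^1([\tau_0,\infty))$ and $\int_{\tau_0}^\infty ds/f(s)<\infty$. (C) $f$ is convex on $[\tau_1,\infty)$ for some $\tau_1\ge0$. $F(u)=\int_u^\infty ds/f(s)$ for $u>0$. *)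

(* Defs.v *)
From mathcomp Require Import all_boot all_order all_algebra.
From mathcomp Require Import all_classical all_reals all_analysis measurable_realfun.
Set Implicit Arguments.
Unset Strict Implicit.
Unset Printing Implicit Defensive.
Import Order.TTheory GRing.Theory Num.Theory.
Import numFieldNormedType.Exports.
Local Open Scope classical_set_scope.
Local Open Scope ring_scope.

(* Points of R^N are represented as N.-tuple R, which MathComp-Analysis
   equips with the product (Borel) sigma-algebra generated by the
   coordinate projections. *)

Section Defs.
Variable R : realType.

Local Notation leb := (@lebesgue_measure R).

(* N-dimensional Lebesgue integral, as the iterated integral
   \int dx_1 ... \int dx_N  (by Tonelli/Fubini it coincides with the
   integral w.r.t. N-dimensional Lebesgue measure for nonnegative or
   absolutely integrable integrands, which is all we use it for). *)
Fixpoint integralN (n : nat) : (n.-tuple R -> \bar R) -> \bar R :=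
  match n return (n.-tuple R -> \bar R) -> \bar R with
  | 0 => fun g => g [tuple]
  | n'.+1 => fun g =>
      (\int[leb]_x integralN (fun y : n'.-tuple R => g (cons_tuple x y)))%E
  end.

Definition tsub (n : nat) (x y : n.-tuple R) : n.-tuple R :=
  [tuple tnth x i - tnth y i | i < n].

Definition tdot (n : nat) (x y : n.-tuple R) : R :=
  \sum_(i < n) tnth x i * tnth y i.

Definition tnorm (n : nat) (x : n.-tuple R) : R := Num.sqrt (tdot x x).

Definition nullN (n : nat) (A : set (n.-tuple R)) : Prop :=
  exists B : set (n.-tuple R), measurable B /\ A `<=` B /\
    integralN (fun x => (\1_B x)%:E) = 0%E.

Definition nullNT (n : nat) (A : set (n.-tuple R * R)) : Prop :=
  exists B : set (n.-tuple R * R), measurable B /\ A `<=` B /\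
    (\int[leb]_t integralN (fun x => (\1_B (x, t))%:E))%E = 0%E.

(* Lebesgue measurability = agreeing outside a null set with a Borel
   measurable function (measurability for the completed sigma-algebra). *)
Definition lmeasurableN (n : nat) (g : n.-tuple R -> R) : Prop :=
  exists h : n.-tuple R -> R, measurable_fun setT h /\
    nullN [set x | g x <> h x].

Definition nonneg_loc_integrable (n : nat) (mu : n.-tuple R -> R) : Prop :=
  (forall x, 0 <= mu x) /\ lmeasurableN mu /\
  forall r : R, 0 < r ->
    (integralN (fun x => (mu x * \1_[set y | tnorm y <= r] x)%:E) < +oo)%E.

(* Fundamental solution of  d_t u + (-Delta)^(theta/2) u = 0  on R^N:
   Gamma_theta(x,t) = (2 pi)^(-N) \int_{R^N} e^{i x.xi - t |xi|^theta} dxi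
                    = (2 pi)^(-N) \int_{R^N} cos(x.xi) e^{- t |xi|^theta} dxi
   (the imaginary part vanishes by symmetry), for t > 0. *)
Definition Gamma_theta (n : nat) (theta : R) (x : n.-tuple R) (t : R) : R :=
  ((2 * pi) ^+ n)^-1 *
  fine (integralN (fun xi : n.-tuple R =>
          (cos (tdot x xi) * expR (- (t * powR (tnorm xi) theta)))%:E)).

Definition heat_sg (n : nat) (theta : R) (mu : n.-tuple R -> R)
    (t : R) (x : n.-tuple R) : \bar R :=
  integralN (fun y => (Gamma_theta theta (tsub x y) t * mu y)%:E).

(* u is a solution of (SHE) in Q_T = R^N x (0,T).  u takes values in
   [0, +oo]; f is applied to [fine (u y s)] (irrelevant on the null set
   where u = +oo). *)
Definition is_solution (n : nat) (theta : R) (f : R -> R)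
    (mu : n.-tuple R -> R) (T : R) (u : n.-tuple R -> R -> \bar R) : Prop :=
  (forall x t, 0 < t < T -> (0 <= u x t)%E) /\
  (exists v : n.-tuple R * R -> \bar R, measurable_fun setT v /\
     nullNT [set p | 0 < p.2 < T /\ u p.1 p.2 <> v p]) /\
  nullNT [set p | 0 < p.2 < T /\ u p.1 p.2 = +oo%E] /\
  nullNT [set p | 0 < p.2 < T /\
     u p.1 p.2 <>
       (heat_sg theta mu p.2 p.1 +
        \int[leb]_(s in [set s : R | (0 < s < p.2)%R])
           integralN (fun y => (Gamma_theta theta (tsub p.1 y) (p.2 - s)
                                 * f (fine (u y s)))%:E))%E].

Definition bigF (f : R -> R) (v : \bar R) : \bar R :=
  match v with
  | r%:E => (\int[leb]_(s in `]r, +oo[) ((f s)^-1)%:E)%E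
  | +oo%E => 0%E
  | -oo%E => +oo%E
  end.

Definition condM (f : R -> R) : Prop :=
  (forall u, 0 <= u -> 0 <= f u) /\
  {within `[0, +oo[, continuous f} /\
  (forall u v, 0 <= u -> u <= v -> f u <= f v) /\
  (forall u, 0 < u -> 0 < f u).

(* (S): f in C^1([tau0, oo)) and \int_{tau0}^oo ds/f(s) < oo *)
Definition condS (f : R -> R) : Prop :=
  exists tau0 : R, 0 < tau0 /\
    (forall x, tau0 < x -> derivable f x 1) /\
    {in `]tau0, +oo[, continuous (derive1 f)} /\
    cvg ((derive1 f) @ at_right tau0) /\
    (\int[leb]_(s in `[tau0, +oo[) ((f s)^-1)%:E < +oo)%E.

Definition condC (f : R -> R) : Prop :=
  exists tau1 : R, 0 <= tau1 /\
    forall x y (l : R), tau1 <= x -> tau1 <= y -> 0 <= l <= 1 ->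
      f (l * x + (1 - l) * y) <= l * f x + (1 - l) * f y.

End Defs.

(* Main.v *)
(** Fix [(x, t)] outside the exceptional null set and put
    [V s = S(t - s) u(s) (x)] and [A s = S(t - s) f(u(s)) (x)].  The semigroup
    property gives [V s >= H s := S(t) mu (x) + \int_0^s A], and Jensen's
    inequality for a convex minorant of [f], which is at least [f / 2] above
    some level [b], gives [A s >= f (H s) / 2] as soon as [S(t) mu (x) >= b].
    So [H] is a supersolution of [h' = f h / 2] which does not blow up before
    time [t], whence [F (S(t) mu (x)) >= t / 4].  If [S(t) mu (x) < b] then
    [F (S(t) mu (x)) >= 1 / f (b + 1)], which is at least [t] for small [t].

    The argument uses of the kernel only that it is nonnegative, that its mass
    is at most one and that it satisfies the Chapman-Kolmogorov inequality.
    Positivity: a function [m] is a multiplier when multiplication by [m]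
    preserves "the regularised inverse Fourier transform is nonnegative".
    Cosines are multipliers, hence so is
    [exp (- c (1 - z) `^ (theta / 2))], [z] being the mean of the
    [cos (d * xi_i)], because [1 - (1 - z) `^ (theta / 2)] is a power series in
    [z] with nonnegative coefficients; as [d] goes to [0] and [c] is rescaled
    this becomes [exp (- t |xi|^theta)].  The other two facts come from
    regularising integrals over [y] by [exp (- e (|y_1| + ... + |y_N|))], whose
    Fourier transform is a product of Cauchy kernels. *)

From HB Require Import structures.
Require Import Defs.
From mathcomp Require Import all_boot all_order all_algebra.
From mathcomp Require Import all_classical all_reals all_analysis measurable_realfun.
From mathcomp Require Import ring lra.
Set Implicit Arguments.
Unset Strict Implicit.
Unset Printing Implicit Defensive.
Import Order.TTheory GRing.Theory Num.Theory.
Import numFieldNormedType.Exports.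
Local Open Scope classical_set_scope.
Local Open Scope ring_scope.

(** * Lebesgue measure on tuples *)

(** [Gamma_theta] is an oscillating Fourier integral, so its sign and its integrability have to be
    proved. One-sided facts about it suffice because only lower bounds for the solution are needed:
    Chapman-Kolmogorov is used in one direction, and mass at most one is enough for Jensen's
    inequality because the affine minorant has a nonpositive constant term.

    The constant 1/4 is a product of two halves. One is lost in lowering a tangent of [f], which is
    convex only far out. The other is lost in replacing the differential inequality by finitely many
    Euler steps, where monotonicity alone is used and a logarithmic error has to be absorbed.

    A second obstacle is measurability: the datum and the solution are only almost everywhere equal
    to Borel functions. A space-time null set has null spatial slices at almost every time, and this
    is enough, since the solution is evaluated pointwise only at the fixed [(x, t)] and through
    spatial integrals at earlier times. *)

Section lebN.
Variable R : realType.
Local Notation leb := (@lebesgue_measure R).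
Local Open Scope ereal_scope.

Section step.
Variables (n : nat) (m : {sigma_finite_measure set (n.-tuple R) -> \bar R}).

Definition consp (p : measurableTypeR R * n.-tuple R) : n.+1.-tuple R :=
  cons_tuple p.1 p.2.

Lemma measurable_consp : measurable_fun setT consp.
Proof.
have := @measurable_cons _ _ (measurableTypeR R * n.-tuple R)%type R fst n snd
  measurable_fst measurable_snd.
move=> H; apply: (eq_measurable_fun _ _ H) => p _.
exact: val_inj.
Qed.

(** The product measure is transported along [consp], so that integrals against [lebN] unfold by
    Tonelli into the recursion that defines [integralN]. *)
Definition lebS : set (n.+1.-tuple R) -> \bar R := pushforward (leb \x m) consp.

Let lebS0 : lebS set0 = 0.
Proof. by rewrite /lebS /pushforward preimage_set0 measure0. Qed.

Let lebS_ge0 A : 0 <= lebS A.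
Proof. by rewrite /lebS /pushforward measure_ge0. Qed.

Let lebS_sigma_additive : semi_sigma_additive lebS.
Proof.
exact: (measure_semi_sigma_additive (s := measure_function_pushforward__canonical__measure_function_Measure (leb \x m) measurable_consp)).
Qed.

HB.instance Definition _ := isMeasure.Build _ _ _ lebS lebS0 lebS_ge0
  lebS_sigma_additive.

(** A pushforward need not inherit sigma-finiteness; here the exhausting products of [F k] and [G k]
    are themselves preimages of measurable sets of tuples. *)
Lemma lebS_sigma_finite : sigma_finite setT lebS.
Proof.
have /sigma_finiteP[F [TF ndF Foo]] := sigma_finiteT leb.
have /sigma_finiteP[G [TG ndG Goo]] := sigma_finiteT m.
exists (fun k => [set x : n.+1.-tuple R | F k (thead x) /\ G k (behead_tuple x)]).
  apply/esym; rewrite -subTset => x _.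
  have [i _ Fi] : (\bigcup_k F k) (thead x) by rewrite -TF.
  have [j _ Gj] : (\bigcup_k G k) (behead_tuple x) by rewrite -TG.
  exists (maxn i j) => //; split.
    have := ndF _ _ (leq_maxl i j).
    by move=> /subsetPset; apply.
    have := ndG _ _ (leq_maxr i j).
    by move=> /subsetPset; apply.
move=> k.
have [mF Fk] := Foo k; have [mG Gk] := Goo k.
have E : consp @^-1` [set x : n.+1.-tuple R | F k (thead x) /\ G k (behead_tuple x)] = F k `*` G k.
  apply/seteqP; split => -[a b] /= [].
    move=> Fa Gb; split; first by [].
    by rewrite (_ : b = behead_tuple (consp (a, b)))//; exact: val_inj.
  move=> Fa Gb; split; first by [].
  by rewrite (_ : behead_tuple (consp (a, b)) = b)//; exact: val_inj.
split.
  apply: measurableI.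
    rewrite -[X in measurable X]setTI.
    exact: (@measurable_tnth _ R n.+1 ord0).
  rewrite -[X in measurable X]setTI.
  rewrite [X in measurable X](_ : _ = [set: n.+1.-tuple R] `&`
      (fun x : n.+1.-tuple R => [tuple of behead x]) @^-1` G k).
    exact: (@measurable_behead _ R n).
  by apply/seteqP; split => x /= => [?|[]].
rewrite /lebS /pushforward E product_measure1E//.
rewrite lte_mul_pinfty//.
by rewrite ge0_fin_numE.
Qed.

HB.instance Definition _ := @Measure_isSigmaFinite.Build _ _ _ lebS lebS_sigma_finite.

Lemma ge0_integral_lebS (g : n.+1.-tuple R -> \bar R) :
  measurable_fun setT g -> (forall x, 0 <= g x) ->
  \int[lebS]_x g x = \int[leb]_x \int[m]_y g (cons_tuple x y).
Proof.
move=> mg g0.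
rewrite (@ge0_integral_pushforward _ _ _ _ _ _ measurable_consp (leb \x m))//.
rewrite fubini_tonelli1//=.
by apply: (@measurableT_comp _ _ _ _ _ _ g) => //; exact: measurable_consp.
Qed.

End step.

Fixpoint lebN (n : nat) : {sigma_finite_measure set (n.-tuple R) -> \bar R} :=
  match n return {sigma_finite_measure set (n.-tuple R) -> \bar R} with
  | 0 => dirac [tuple]
  | n'.+1 => lebS (lebN n')
  end.

Lemma measurable_cons_tuple n (x : R) :
  measurable_fun setT (fun y : n.-tuple R => cons_tuple x y).
Proof.
exact: (measurableT_comp (@measurable_consp n) (@measurable_pair1 _ _ (measurableTypeR R) _ x)).
Qed.

Lemma ge0_integralNE n (g : n.-tuple R -> \bar R) :
  measurable_fun setT g -> (forall x, 0 <= g x) ->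
  Defs.integralN g = \int[lebN n]_x g x.
Proof.
elim: n g => [|n IH] g mg g0 /=.
  by rewrite integral_dirac// diracT mul1e.
rewrite ge0_integral_lebS//; apply: eq_integral => x _; apply: IH => //.
exact: (measurableT_comp mg (@measurable_cons_tuple n x)).
Qed.

Implicit Types (p : R -> R) (n : nat).

Definition tprod (p : R -> R) n (x : n.-tuple R) : R := (\prod_(i < n) p (tnth x i))%R.

Lemma tprodS p n (x : R) (y : n.-tuple R) :
  tprod p (cons_tuple x y) = (p x * tprod p y)%R.
Proof.
rewrite /tprod big_ord_recl; congr (_ * _)%R.
by apply: eq_bigr => i _; rewrite tnthS.
Qed.

Lemma measurable_tprod p n : measurable_fun setT p ->
  measurable_fun setT (@tprod p n).
Proof.
move=> mp; apply: measurable_prod => i _.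
by apply: (measurableT_comp mp); exact: measurable_tnth.
Qed.

Lemma tprod_ge0 p n x : (forall x, 0 <= p x)%R -> (0 <= @tprod p n x)%R.
Proof. by move=> p0; apply: prodr_ge0. Qed.

Lemma integral_tprod p n : (forall x, 0 <= p x)%R -> measurable_fun setT p ->
  (\int[leb]_x (p x)%:E < +oo) ->
  \int[lebN n]_x (tprod p x)%:E = ((\int[leb]_x p x)%R ^+ n)%:E.
Proof.
move=> p0 mp pfin; elim: n => [|n IH].
  rewrite /= integral_dirac//=; last by apply/measurable_EFinP; exact: measurable_tprod.
  by rewrite diracT mul1e /tprod big_ord0 expr0.
rewrite /= ge0_integral_lebS//; last 2 first.
- by apply/measurable_EFinP; exact: measurable_tprod.
- by move=> x; rewrite lee_fin tprod_ge0.
under eq_integral => x _.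
  under eq_integral => y _ do rewrite tprodS EFinM.
  rewrite ge0_integralZl//; last 3 first.
  - by apply/measurable_EFinP; exact: measurable_tprod.
  - by move=> y _; rewrite lee_fin tprod_ge0.
  - by rewrite lee_fin.
  rewrite IH muleC.
  over.
rewrite ge0_integralZl//; last 3 first.
- exact/measurable_EFinP.
- by move=> x _; rewrite lee_fin.
- by rewrite lee_fin exprn_ge0// Rintegral_ge0.
rewrite exprSr EFinM; congr (_ * _); rewrite /Rintegral fineK//.
by rewrite ge0_fin_numE// integral_ge0// => x _; rewrite lee_fin.
Qed.

Lemma integrable_tprod p n : (forall x, 0 <= p x)%R -> measurable_fun setT p ->
  (\int[leb]_x (p x)%:E < +oo) ->
  (lebN n).-integrable setT (EFin \o @tprod p n).
Proof.
move=> p0 mp pfin; apply/integrableP; split.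
  by apply/measurable_EFinP; exact: measurable_tprod.
under eq_integral => x _ do rewrite /= ger0_norm ?tprod_ge0//.
by rewrite integral_tprod// ltry.
Qed.

Lemma le_tprod_integrable p n (C : R) (g : n.-tuple R -> R) :
  (forall x, 0 <= p x)%R -> measurable_fun setT p ->
  (\int[leb]_x (p x)%:E < +oo) ->
  measurable_fun setT g -> (forall x, `|g x| <= C * tprod p x)%R ->
  (lebN n).-integrable setT (EFin \o g).
Proof.
move=> p0 mp pfin mg gp.
have : (lebN n).-integrable setT (fun x => C%:E * (EFin \o @tprod p n) x).
  by apply: integrableZl => //; exact: integrable_tprod.
apply: le_integrable => //; first exact/measurable_EFinP.
by move=> x _ /=; rewrite lee_fin (le_trans (gp x))// ler_norm.
Qed.

(** A tensor-product bound passes to every slice, with constant [C * p x], so the induction on the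
    dimension closes. Mere integrability of [g] would give integrable slices only almost
    everywhere. *)
Lemma le_tprod_integralNE p n (C : R) (g : n.-tuple R -> R) :
  (forall x, 0 <= p x)%R -> measurable_fun setT p ->
  (\int[leb]_x (p x)%:E < +oo) ->
  measurable_fun setT g -> (forall x, `|g x| <= C * tprod p x)%R ->
  Defs.integralN (EFin \o g) = \int[lebN n]_x (g x)%:E.
Proof.
move=> p0 mp pfin.
elim: n C g => [|n IH] C g mg gp.
  by rewrite /= integral_dirac ?diracT ?mul1e//; exact/measurable_EFinP.
have ig := le_tprod_integrable p0 mp pfin mg gp.
rewrite /=.
transitivity (\int[leb]_x \int[lebN n]_y (g (cons_tuple x y))%:E).
  apply: eq_integral => x _.
  apply: (IH (C * p x)%R) => [|y].
    exact: (measurableT_comp mg (@measurable_cons_tuple n x)).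
  by rewrite -mulrA -tprodS.
have mg2 : measurable_fun setT ((EFin \o g) \o @consp n).
  by apply: measurableT_comp; [exact/measurable_EFinP|exact: measurable_consp].
have ig2 : (leb \x lebN n).-integrable setT ((EFin \o g) \o @consp n).
  move: ig => /= /integrableP[mg' gfin]; apply/integrableP; split => //.
  move: gfin; rewrite (@ge0_integral_pushforward _ _ _ _ _ _ (measurable_consp (n := n)))//=.
  by apply/measurable_EFinP; exact: measurableT_comp.
rewrite /= [RHS](integral_pushforward (measurable_consp (n := n)) _ _ measurableT) //=.
  by rewrite -integral12_prod_meas1.
exact: (measurable_int _ ig).
Qed.

End lebN.

(** * Integrands that are measurable only up to a null set *)

Section ae.
Local Open Scope ereal_scope.
Context d (T : measurableType d) (R : realType) (mu : {measure set T -> \bar R}).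
Import HBNNSimple.

Lemma ge0_integral_le_sup (f g : T -> \bar R) :
  (forall x, 0 <= f x) -> (forall x, f x <= g x) ->
  \int[mu]_x f x <= \int[mu]_x g x.
Proof.
move=> f0 fg; rewrite !ge0_integralTE//; last by move=> x; exact: le_trans (fg x).
apply: le_ereal_sup => _ [h hf <-]; exists h => // x.
exact: le_trans (hf x) (fg x).
Qed.

(** In one direction every simple function below [f] is almost everywhere below [h]; in the other,
    [N] is removed from the integral of the measurable [h] before comparing pointwise. *)
Lemma ge0_integral_ae_nonmeasurable (N : set T) (f h : T -> \bar R) :
  measurable N -> mu N = 0 ->
  (forall x, 0 <= f x) -> (forall x, 0 <= h x) -> measurable_fun setT h ->
  (forall x, ~ N x -> f x = h x) -> \int[mu]_x f x = \int[mu]_x h x.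
Proof.
move=> mN N0 f0 h0 mh fh; apply/eqP; rewrite eq_le; apply/andP; split.
  rewrite ge0_integralTE//; apply: ge_ereal_sup => _ [g gf <-].
  rewrite -integralT_nnsfun; apply: ae_ge0_le_integral => //.
  - by move=> x _; rewrite lee_fin.
  - exact/measurable_EFinP.
  - exists N; split => // x /= /not_implyP[_].
    by apply: contra_notP => /fh <-; exact: gf.
rewrite [leLHS](@ge0_negligible_integral _ _ _ mu setT N)//.
rewrite integral_mkcond; apply: ge0_integral_le_sup => x.
  by apply: erestrict_ge0.
by rewrite patchE; case: ifPn => // /set_mem[_ /fh ->].
Qed.

End ae.

Section lebN_ae.
Variable R : realType.
Local Notation leb := (@lebesgue_measure R).
Local Open Scope ereal_scope.

Lemma integralN_ge0 n (g : n.-tuple R -> \bar R) :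
  (forall x, 0 <= g x) -> 0 <= Defs.integralN g.
Proof.
elim: n g => [|n IH] g g0 /=; first exact: g0.
by apply: integral_ge0 => x _; exact: IH.
Qed.

(** For almost every first coordinate the slice of [B] is null, so the inner integrals agree by
    induction. The outer integrand may still be nonmeasurable, whence the previous lemma. *)
Lemma ge0_integralN_ae n (B : set (n.-tuple R)) (f h : n.-tuple R -> \bar R) :
  measurable B -> lebN R n B = 0 ->
  (forall x, 0 <= f x) -> (forall x, 0 <= h x) -> measurable_fun setT h ->
  (forall x, ~ B x -> f x = h x) -> Defs.integralN f = \int[lebN R n]_x h x.
Proof.
elim: n B f h => [|n IH] B f h mB B0 f0 h0 mh fh.
  rewrite /= integral_dirac// diracT mul1e fh//.
  move=> Bt; move: B0; rewrite /= diracE mem_set// => /eqP.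
  by rewrite onee_eq0.
rewrite ge0_integral_lebS//=.
have mcB : measurable (@consp R n @^-1` B).
  by rewrite -[X in measurable X]setTI; exact: measurable_consp.
have mB' := measurable_fun_xsection (lebN R n) mcB.
have : {ae leb, forall x, lebN R n (xsection (@consp R n @^-1` B) x) = 0}.
  have : \int[leb]_x (lebN R n \o xsection (@consp R n @^-1` B)) x = 0 by [].
  have E : forall x, `|(lebN R n \o xsection (@consp R n @^-1` B)) x| =
     (lebN R n \o xsection (@consp R n @^-1` B)) x.
    by move=> x; rewrite gee0_abs//= measure_ge0.
  under eq_integral do rewrite -E.
  move/(ae_eq_integral_abs leb measurableT mB') => [N [mN N0 sN]].
  by exists N; split => // x /= Hx; apply: sN => /=; contradict Hx; exact: Hx.
move=> [N [mN N0 sN]].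
apply: (@ge0_integral_ae_nonmeasurable _ _ _ leb N) => //.
- by move=> x; exact: integralN_ge0.
- by move=> x; exact: integral_ge0.
- have := @measurable_fun_fubini_tonelli_F _ _ (measurableTypeR R) _ R (lebN R n) (h \o @consp R n).
  apply=> [|x]; last exact: h0.
  exact: (measurableT_comp mh (@measurable_consp R n)).
- move=> x Nx; apply: (IH (xsection (@consp R n @^-1` B) x)) => //.
  + exact: measurable_xsection.
  + by apply: contra_notP Nx => Nx; exact: sN.
  + exact: (measurableT_comp mh (@measurable_cons_tuple R n x)).
  + by move=> y /= yB; apply: fh => By; apply: yB; rewrite /xsection /= inE.
Qed.

End lebN_ae.

(** * Affine changes of variables *)

Section affine.
Variable R : realType.
Local Notation leb := (@lebesgue_measure R).
Local Open Scope ereal_scope.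

Lemma measurable_affine1 (c e : R) :
  measurable_fun setT ((fun x => c + e * x)%R : measurableTypeR R -> measurableTypeR R).
Proof.
apply: continuous_measurable_fun => x.
by apply: cvgD; [exact: cvg_cst|apply: cvgMr; exact: cvg_id].
Qed.

(** By uniqueness of Lebesgue measure it suffices to compare both sides on half-open intervals. *)
Lemma lebesgue_measure_affine (c e : R) (A : set (measurableTypeR R)) : (0 < e)%R ->
  measurable A ->
  leb A = e%:E * leb ((fun x => c + e * x)%R @^-1` A).
Proof.
move=> e0 mA; pose k := NngNum (ltW e0).
pose nu : {measure set (measurableTypeR R) -> \bar R} :=
  measure_function_pushforward__canonical__measure_function_Measure leb (measurable_affine1 c e).
transitivity (mscale k nu A); last by [].
apply: lebesgue_measure_unique => // _ [[a b]] _ <-.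
rewrite /= /mscale /=.
have -> : nu (`]a, b]%classic : set R) = leb (`]((a - c) / e)%R, ((b - c) / e)%R]%classic : set R).
  rewrite /nu /= /pushforward; congr (leb _).
  apply/seteqP; split => x /=; rewrite !in_itv/= ltr_pdivrMr// ler_pdivlMr// ltrBlDl lerBrDl; rewrite (mulrC x).
  exact: id. exact: id.
rewrite [LHS](lebesgue_measure_itv `]a, b]) [in RHS](lebesgue_measure_itv `]_, _]) /= !lte_fin.
rewrite ltr_pM2r ?invr_gt0// ltrD2r; case: ifP => _; last by rewrite mule0.
by rewrite -!EFinB -EFinM; congr EFin; field; rewrite gt_eqF.
Qed.

Lemma ge0_integral_affine1 (c e : R) (g : R -> \bar R) : (0 < e)%R ->
  measurable_fun setT g -> (forall x, 0 <= g x) ->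
  \int[leb]_x g (c + e * x)%R = (e^-1)%:E * \int[leb]_x g x.
Proof.
move=> e0 mg g0; pose k := NngNum (ltW e0).
pose nu : {measure set (measurableTypeR R) -> \bar R} :=
  measure_function_pushforward__canonical__measure_function_Measure leb (measurable_affine1 c e).
have -> : \int[leb]_x g x = \int[mscale k nu]_x g x.
  by apply: eq_measure_integral => A mA _ /=; exact: lebesgue_measure_affine.
rewrite ge0_integral_mscale//= muleA -EFinM mulVf ?gt_eqF// mul1e.
by rewrite (ge0_integral_pushforward (measurable_affine1 c e)).
Qed.

Definition affN n (c : n.-tuple R) (e : R) (x : n.-tuple R) : n.-tuple R :=
  [tuple (tnth c i + e * tnth x i)%R | i < n].

Lemma measurable_affN n (c : n.-tuple R) e : measurable_fun setT (affN c e).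
Proof.
apply/measurable_fun_tnthP => i.
rewrite (_ : _ \o _ = (fun x => tnth c i + e * x)%R \o (fun x => tnth x i)).
  apply: measurableT_comp; last exact: measurable_tnth.
  exact: measurable_affine1.
by apply/funext => x /=; rewrite tnth_mktuple.
Qed.

Lemma affN_cons n (c : n.+1.-tuple R) e x y :
  affN c e (cons_tuple x y) = cons_tuple (thead c + e * x)%R (affN (behead_tuple c) e y).
Proof.
apply: eq_from_tnth => i; rewrite tnth_mktuple.
have [->|i0] := eqVneq i ord0; first by [].
have [j ->] : exists j, i = lift ord0 j.
  by case: (unliftP ord0 i) i0 => [j ->|->]; [exists j|rewrite eqxx].
rewrite !tnthS tnth_mktuple; congr (_ + _)%R.
by rewrite [in LHS](tuple_eta c) tnthS.
Qed.

Lemma ge0_integral_affN n (c : n.-tuple R) (e : R) (g : n.-tuple R -> \bar R) :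
  (0 < e)%R -> measurable_fun setT g -> (forall x, 0 <= g x) ->
  \int[lebN R n]_x g (affN c e x) = ((e ^+ n)^-1)%:E * \int[lebN R n]_x g x.
Proof.
move=> e0; elim: n c g => [|n IH] c g mg g0.
  rewrite /= !integral_dirac//.
    by rewrite diracT expr0 invr1 !mul1e; congr g; exact: tuple0.
  exact: (measurableT_comp mg (measurable_affN c e)).
rewrite /= !ge0_integral_lebS//; last first.
  exact: (measurableT_comp mg (measurable_affN c e)).
under eq_integral => x _.
  under eq_integral do rewrite affN_cons.
  rewrite (IH (behead_tuple c) (fun y => g (cons_tuple (thead c + e * x)%R y)))//; last first.
    exact: (measurableT_comp mg (@measurable_cons_tuple R n _)).
  over.
have mG : measurable_fun setT (fun x => \int[lebN R n]_y g (cons_tuple x y)).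
  have := @measurable_fun_fubini_tonelli_F _ _ (measurableTypeR R) _ R (lebN R n) (g \o @consp R n).
  apply=> [|x]; last exact: g0.
  exact: (measurableT_comp mg (@measurable_consp R n)).
rewrite ge0_integralZl//; last 3 first.
- exact: (measurableT_comp mG (measurable_affine1 (thead c) e)).
- by move=> x _; apply: integral_ge0.
- by rewrite lee_fin invr_ge0 exprn_ge0// ltW.
rewrite (@ge0_integral_affine1 (thead c) e (fun x => \int[lebN R n]_y g (cons_tuple x y)))//.
  by rewrite muleA -EFinM -invfM exprS mulrC.
by move=> x; apply: integral_ge0.
Qed.

Lemma integral_affN n (c : n.-tuple R) (e : R) (g : n.-tuple R -> R) :
  (0 < e)%R -> (lebN R n).-integrable setT (EFin \o g) ->
  (\int[lebN R n]_x g x = e ^+ n * \int[lebN R n]_x g (affN c e x))%R.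
Proof.
move=> e0 ig; have mg := measurable_int _ ig.
rewrite /Rintegral integralE [in RHS]integralE.
have pfin := integrable_pos_fin_num measurableT ig.
have nfin := integrable_neg_fin_num measurableT ig.
transitivity (e ^+ n * fine (\int[lebN R n]_x (EFin \o g)^\+ (affN c e x) -
   \int[lebN R n]_x (EFin \o g)^\- (affN c e x))%E)%R; last first.
  by congr (_ * fine (_ - _))%R; apply: eq_integral => x _; rewrite ?funeposE ?funenegE.
rewrite (@ge0_integral_affN n c e (EFin \o g)^\+)//; last exact: measurable_funepos.
rewrite (@ge0_integral_affN n c e (EFin \o g)^\-)//; last exact: measurable_funeneg.
rewrite -(fineK pfin) -(fineK nfin) -!EFinM -!EFinB /=.
by field; rewrite expf_neq0// gt_eqF.
Qed.

End affine.

(** * The Laplace kernel and its Fourier transform *)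

Section laplace.
Variable R : realType.
Local Notation leb := (@lebesgue_measure R).
Implicit Types (a e psi x : R).

Definition laplace e x : R := expR (- (e * `|x|)).
Definition cauchyk e x : R := 2 * e / (e ^+ 2 + x ^+ 2).

Lemma ge0_integralT_fold (f : R -> \bar R) :
  measurable_fun setT f -> (forall x, 0 <= f x)%E ->
  (\int[leb]_x f x =
   \int[leb]_(x in `[0%R, +oo[) f x + \int[leb]_(x in `[0%R, +oo[) f (- x)%R)%E.
Proof.
move=> mf f0.
have mf' : measurable_fun setT (f \o -%R) by exact: measurableT_comp.
rewrite (ge0_integration_by_substitution0 mf')//=.
under [X in (_ = _ + X)%E]eq_integral do rewrite opprK.
have -> : [set: R] = `[0, +oo[ `|` `]-oo, 0[.
  apply/seteqP; split => x //= _; rewrite !in_itv/= andbT.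
  by case: (leP 0 x) => _; [left|right].
rewrite ge0_integral_setU//=.
- by congr (_ + _)%E; apply: integral_itv_bndo_bndc; exact: measurable_funTS.
- exact: measurable_funTS.
- apply/disj_setPS => x /=; rewrite !in_itv/= andbT => -[h1 h2].
  by move: (le_lt_trans h1 h2); rewrite ltxx.
Qed.

Lemma is_derive_affine a psi x : is_derive x 1 (fun y : R => a * y + psi) a.
Proof.
have -> : (fun y : R => a * y + psi) = a *: id + cst psi by apply/funext.
by apply: is_derive_eq; rewrite addr0 /GRing.scale/= mulr1.
Qed.

(** The added 1 makes the integrand nonnegative, as the fundamental theorem of calculus on a
    half-line requires; it is subtracted again in [Rintegral_laplace_cos]. *)
Lemma integral_half_laplace_cos e a psi : 0 < e ->
  (\int[leb]_(x in `[0%R, +oo[) ((1 + cos (a * x + psi)) * expR (- (e * x)))%:E =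
  (e^-1 - (a * sin psi - e * cos psi) / (e ^+ 2 + a ^+ 2))%:E)%E.
Proof.
move=> e0.
have D1 : 0 < e ^+ 2 + a ^+ 2 by rewrite ltr_wpDr ?sqr_ge0// exprn_gt0.
have D0 := lt0r_neq0 D1.
pose f x := (1 + cos (a * x + psi)) * expR (- (e * x)).
(* The antiderivative that vanishes at infinity. *)
pose F x : R := (- e^-1 + (a * sin (a * x + psi) - e * cos (a * x + psi)) / (e ^+ 2 + a ^+ 2))
            * expR (- (e * x)).
have dF x : is_derive x 1 F (f x).
  have d1 := is_derive1_comp (g := fun y => a * y + psi) (is_derive_sin (a * x + psi)) (is_derive_affine a psi x).
  have d2 := is_derive1_comp (g := fun y => a * y + psi) (is_derive_cos (a * x + psi)) (is_derive_affine a psi x).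
  have d3 := is_derive1_comp (g := fun y => - e * y + 0) (is_derive_expR (- e * x + 0)) (is_derive_affine (- e) 0 x).
  have d4 := is_deriveD (is_derive_cst (- e^-1) x 1)
    (is_deriveZ ((e ^+ 2 + a ^+ 2)^-1) (is_deriveB (is_deriveZ a d1) (is_deriveZ e d2))).
  have := is_deriveM d4 d3.
  set G := (X in is_derive _ _ X _); set dG := (X in is_derive _ _ _ X).
  have -> : G = F.
    apply/funext => y; rewrite /F -[LHS]/((- e^-1 + (e ^+ 2 + a ^+ 2)^-1 *
      (a * sin (a * y + psi) - e * cos (a * y + psi))) * expR (- e * y + 0)) addr0 mulNr.
    by congr (_ * _); congr (_ + _); rewrite mulrC.
  suff -> : dG = f x by [].
  rewrite /f /dG /= addr0 mulNr /GRing.scale/=.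
  rewrite -[(cst _ + _) x]/(- e^-1 + (e ^+ 2 + a ^+ 2)^-1 *
    (a * sin (a * x + psi) - e * cos (a * x + psi))).
  by field; rewrite D0 gt_eqF.
have cf : continuous f.
  move=> x; rewrite /f; apply: cvgM.
    apply: cvgD; first exact: cvg_cst.
    apply: (@continuous_comp _ _ _ (fun x => a * x + psi) cos); last exact: continuous_cos.
    by apply: cvgD; [apply: cvgMr; exact: cvg_id|exact: cvg_cst].
  apply: (@continuous_comp _ _ _ (fun x => - (e * x)) expR); last exact: continuous_expR.
  by apply: cvgN; apply: cvgMr; exact: cvg_id.
rewrite (@ge0_continuous_FTC2y _ f F 0 0).
- by rewrite -EFinB; congr EFin; rewrite /F !mulr0 oppr0 expR0 mulr1 sub0r opprD opprK add0r.
- move=> x _; rewrite /f mulr_ge0 ?expR_ge0//.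
- exact: continuous_subspaceT.
- have eV : 0 <= e^-1 by rewrite invr_ge0 ltW.
  pose M := e^-1 + (`|a| + e) / (e ^+ 2 + a ^+ 2).
  have FM x : `|F x| <= M * expR (- (e * x)).
    rewrite /F normrM (ger0_norm (expR_ge0 _)) ler_wpM2r ?expR_ge0//.
    rewrite (le_trans (ler_normD _ _))// normrN (ger0_norm eV) lerD2l.
    rewrite normrM normfV (ger0_norm (ltW D1)) ler_wpM2r ?invr_ge0 ?(ltW D1)//.
    rewrite (le_trans (ler_normB _ _))// !normrM (ger0_norm (ltW e0)) lerD//.
      by rewrite ler_piMr// ler_norml sin_geN1 sin_le1.
    by rewrite ler_piMr ?(ltW e0)// ler_norml cos_geN1 cos_le1.
  have h : expR (- (e * x)) @[x --> +oo] --> (0 : R).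
    apply: (@cvg_comp _ _ _ (fun x => e * x) (fun x => expR (- x))); last exact: cvgr_expR.
    exact: gt0_cvgMry.
  apply: (@squeeze_cvgr _ _ _ _ (fun x => - (M * expR (- (e * x))))
      (fun x => M * expR (- (e * x)))).
  + by apply: nearW => x; rewrite -ler_norml.
  + by rewrite -oppr0; apply: cvgN; rewrite -(mulr0 M); apply: cvgMr.
  + by rewrite -(mulr0 M); apply: cvgMr.
- by move=> x _; exact: ex_derive.
- by apply: cvg_at_right_filter; apply: differentiable_continuous; apply/derivable1_diffP; exact: ex_derive.
- by move=> x _; rewrite derive1E; exact: derive_val.
Qed.


Lemma continuous_affine a psi : continuous (fun x : R => a * x + psi).
Proof. by move=> x; apply: cvgD; [apply: cvgMr; exact: cvg_id|exact: cvg_cst]. Qed.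

Lemma measurable_laplace e : measurable_fun setT (laplace e).
Proof.
apply: measurableT_comp => //; apply: measurableT_comp => //.
by apply: measurable_funM => //; exact: measurableT_comp.
Qed.

Lemma laplace_ge0 e x : 0 <= laplace e x. Proof. exact: expR_ge0. Qed.

Lemma cauchyk_ge0 e x : 0 < e -> 0 <= cauchyk e x.
Proof. by move=> e0; rewrite /cauchyk divr_ge0 ?addr_ge0 ?sqr_ge0 ?mulr_ge0 ?ltW. Qed.

Lemma integral_laplace_1cos e a psi : 0 < e ->
  (\int[leb]_x ((1 + cos (a * x + psi)) * laplace e x)%:E =
  (2 / e + cos psi * cauchyk e a)%:E)%E.
Proof.
move=> e0.
have D1 : 0 < e ^+ 2 + a ^+ 2 by rewrite ltr_wpDr ?sqr_ge0// exprn_gt0.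
have D0 := lt0r_neq0 D1.
rewrite ge0_integralT_fold; last 2 first.
- apply/measurable_EFinP; apply: measurable_funM; last exact: measurable_laplace.
  apply: measurable_funD => //; apply: continuous_measurable_fun => x.
  by apply: continuous_comp; [exact: continuous_affine|exact: continuous_cos].
- move=> x; rewrite lee_fin mulr_ge0 ?laplace_ge0//.
have E b p : (\int[leb]_(x in `[0%R, +oo[) ((1 + cos (b * x + p)) * laplace e x)%:E =
   \int[leb]_(x in `[0%R, +oo[) ((1 + cos (b * x + p)) * expR (- (e * x)))%:E)%E.
  apply: eq_integral => x; rewrite inE/= in_itv/= andbT => x0.
  by rewrite /laplace ger0_norm.
rewrite E integral_half_laplace_cos//.
under [X in (_ + X)%E]eq_integral do rewrite mulrN -mulNr /laplace normrN -/(laplace e _).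
rewrite E integral_half_laplace_cos// -EFinD; congr EFin.
by rewrite /cauchyk sqrrN; field; rewrite D0 gt_eqF.
Qed.

Lemma integral_laplace e : 0 < e -> (\int[leb]_x (laplace e x)%:E = (2 / e)%:E)%E.
Proof.
move=> e0; have := @integral_laplace_1cos e 0 (pi / 2) e0.
rewrite cos_pihalf mul0r addr0 => <-; apply: eq_integral => x _.
by rewrite mul0r add0r cos_pihalf addr0 mul1r.
Qed.

Lemma integrable_laplace e : 0 < e -> leb.-integrable setT (EFin \o laplace e).
Proof.
move=> e0; apply/integrableP; split; first by apply/measurable_EFinP; exact: measurable_laplace.
under eq_integral => x _ do rewrite /= ger0_norm ?laplace_ge0//.
by rewrite integral_laplace// ltry.
Qed.

Lemma integrable_bounded_mul d (T : measurableType d) (mu : {measure set T -> \bar R})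
    (g h : T -> R) (C : R) :
  mu.-integrable setT (EFin \o g) -> measurable_fun setT h ->
  (forall z, `|h z| <= C) -> mu.-integrable setT (EFin \o (fun z => h z * g z)).
Proof.
move=> ig mh hC.
have := integrableZl measurableT C ig; apply: le_integrable => //.
  apply/measurable_EFinP; apply: measurable_funM => //.
  by apply/measurable_EFinP; exact: measurable_int ig.
move=> z _ /=; rewrite lee_fin !normrM ler_wpM2r// (le_trans (hC z))//.
exact: ler_norm.
Qed.

Lemma measurable_cos_affine a psi : measurable_fun setT (fun x : R => cos (a * x + psi)).
Proof.
apply: continuous_measurable_fun => x.
by apply: continuous_comp; [exact: continuous_affine|exact: continuous_cos].
Qed.

Lemma cos_abs_le1 x : `|cos x| <= 1 :> R.
Proof. by rewrite ler_norml cos_geN1 cos_le1. Qed.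

Lemma Rintegral_laplace_cos e a psi : 0 < e ->
  \int[leb]_x (cos (a * x + psi) * laplace e x) = cos psi * cauchyk e a.
Proof.
move=> e0.
have iL := integrable_laplace e0.
have iC : leb.-integrable setT (EFin \o (fun x => cos (a * x + psi) * laplace e x)).
  apply: (integrable_bounded_mul (C := 1)) => //; first exact: measurable_cos_affine.
  by move=> x; exact: cos_abs_le1.
have := RintegralD measurableT iL iC.
have -> : \int[leb]_x laplace e x = 2 / e by rewrite /Rintegral integral_laplace.
have -> : \int[leb]_x (laplace e x + cos (a * x + psi) * laplace e x) =
  2 / e + cos psi * cauchyk e a.
  rewrite /Rintegral -[RHS]/(fine (2 / e + cos psi * cauchyk e a)%:E) -integral_laplace_1cos//.
  by congr fine; apply: eq_integral => x _; rewrite mulrDl mul1r.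
by move/addrI.
Qed.

Lemma measurable_cauchyk e : 0 < e -> measurable_fun setT (cauchyk e).
Proof.
move=> e0; apply: continuous_measurable_fun => x; apply: cvgMr.
apply: cvgV; first by rewrite gt_eqF// ltr_wpDr ?sqr_ge0// exprn_gt0.
by apply: cvgD; [exact: cvg_cst|exact: exprn_continuous].
Qed.

Lemma integral_cauchyk1 : (\int[leb]_x (cauchyk 1 x)%:E = (2 * pi)%:E)%E.
Proof.
have E x : cauchyk 1 x = 2 * (oneDsqr x)^-1.
  by rewrite /cauchyk expr1n mulr1.
have mi : measurable_fun setT (fun x : R => (oneDsqr x)^-1).
  by apply: continuous_measurable_fun; exact: continuous_oneDsqrV.
under eq_integral do rewrite E EFinM.
rewrite ge0_integralZl//; last exact/measurable_EFinP.
rewrite ge0_symfun_integralT//; last 2 first.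
- exact: continuous_oneDsqrV.
- by move=> x /=; rewrite /oneDsqr sqrrN.
rewrite (_ : [set x | _] = `[0, +oo[%classic); last first.
  by apply/seteqP; split => x/=; rewrite in_itv/= andbT.
by rewrite integral0y_oneDsqr -!EFinM; congr EFin; field.
Qed.

Lemma integral_cauchyk e : 0 < e -> (\int[leb]_x (cauchyk e x)%:E = (2 * pi)%:E)%E.
Proof.
move=> e0; rewrite -integral_cauchyk1.
have H := @ge0_integral_affine1 R 0 e (EFin \o cauchyk e) e0.

have -> : (\int[leb]_x (cauchyk e x)%:E = e%:E * \int[leb]_x (cauchyk e (0 + e * x))%:E)%E.
  rewrite H; last 2 first.
  - by apply/measurable_EFinP; exact: measurable_cauchyk.
  - by move=> x; rewrite lee_fin cauchyk_ge0.
  by rewrite muleA -EFinM divff ?mul1e// gt_eqF.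
rewrite -ge0_integralZl//; last 3 first.
- apply/measurable_EFinP; apply: (measurableT_comp (measurable_cauchyk e0)).
  exact: measurable_affine1.
- by move=> x _; rewrite lee_fin cauchyk_ge0.
- by rewrite lee_fin ltW.
apply: eq_integral => x _; rewrite -EFinM; congr EFin.
rewrite /cauchyk add0r expr1n; field.
rewrite gt_eqF ?ltr_wpDr ?sqr_ge0//= gt_eqF//.
by rewrite ltr_wpDr ?sqr_ge0 ?exprn_gt0.
Qed.

End laplace.

(** * Parametrised integrals and Fubini under a product majorant *)

Lemma measurable_Rintegral_param d1 d2 (X : measurableType d1) (Y : measurableType d2)
    (R : realType) (mu : {sigma_finite_measure set Y -> \bar R}) (g : X -> Y -> R) :
  measurable_fun setT (fun z => g z.1 z.2) ->
  measurable_fun setT (fun x => \int[mu]_y g x y).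
Proof.
move=> mg; apply: measurableT_comp => //.
pose F (p : X * Y) : \bar R := (g p.1 p.2)%:E.
have mF : measurable_fun setT F by exact/measurable_EFinP.
rewrite (_ : (fun _ => _) = fun x =>
    (\int[mu]_y F^\+ (x, y) - \int[mu]_y F^\- (x, y))%E); last first.
  apply/funext => x; rewrite integralE.
  by congr (_ - _)%E; apply: eq_integral => y _; rewrite ?funeposE ?funenegE.
apply: emeasurable_funB.
- have := @measurable_fun_fubini_tonelli_F _ _ X Y R mu (F^\+)%E.
  by apply=> //; exact: measurable_funepos.
- have := @measurable_fun_fubini_tonelli_F _ _ X Y R mu (F^\-)%E.
  by apply=> //; exact: measurable_funeneg.
Qed.

Section fubini_bound.
Context d1 d2 (X : measurableType d1) (Y : measurableType d2) (R : realType).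
Variables (m1 : {sigma_finite_measure set X -> \bar R})
  (m2 : {sigma_finite_measure set Y -> \bar R}).
Variables (p : X -> R) (q : Y -> R) (g : X -> Y -> R).
Hypothesis ip : m1.-integrable setT (EFin \o p).
Hypothesis iq : m2.-integrable setT (EFin \o q).
Hypothesis mg : measurable_fun setT (fun z => g z.1 z.2).
Hypothesis gpq : forall x y, `|g x y| <= p x * q y.

Let p0 x y : 0 <= p x * q y. Proof. exact: le_trans (gpq x y). Qed.

Let ig : (m1 \x m2)%E.-integrable setT (fun z => (g z.1 z.2)%:E).
Proof.
have mp : measurable_fun setT p by apply/measurable_EFinP; exact: measurable_int ip.
have mq : measurable_fun setT q by apply/measurable_EFinP; exact: measurable_int iq.
apply/integrable12ltyP; first exact/measurable_EFinP.

apply: (@le_lt_trans _ _ (\int[m1]_x (`|p x|%:E * \int[m2]_y `|q y|%:E))%E).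
  apply: ge0_le_integral => //.
  - by move=> x _; exact: integral_ge0.
  - have := @measurable_fun_fubini_tonelli_F _ _ X Y R m2 (fun z => `|(g z.1 z.2)%:E|%E).
    by apply=> //; apply: measurableT_comp => //; exact/measurable_EFinP.
  - apply: emeasurable_funM => //.
    by apply/measurable_EFinP; exact: measurableT_comp.
  move=> x _; rewrite -ge0_integralZl//; last first.
    by apply/measurable_EFinP; exact: measurableT_comp.
  apply: ge0_le_integral => //.
  - apply: measurableT_comp => //; apply/measurable_EFinP.
    exact: (measurableT_comp mg (@measurable_pair1 _ _ X Y x)).

  - by apply: measurable_funeM; apply/measurable_EFinP; exact: measurableT_comp.
  by move=> y _; rewrite -EFinM lee_fin -normrM (le_trans (gpq x y))// ler_norm.
have Q0 : (\int[m2]_y `|q y|%:E)%E \is a fin_num.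
  apply: integrable_fin_num => //.
  exact: integrable_norm.
rewrite -(fineK Q0) ge0_integralZr//.
- apply: lte_mul_pinfty => //.
  + exact: integral_ge0.
  + apply: (@integrable_fin_num _ _ _ m1 _ measurableT (EFin \o (Num.norm \o p))).
    exact: integrable_norm.
  + by rewrite ltry.
- by apply/measurable_EFinP; exact: measurableT_comp.
- by rewrite lee_fin fine_ge0// integral_ge0.
Qed.

Lemma slice_integrable1 x : m2.-integrable setT (EFin \o g x).
Proof.
have := integrableZl measurableT (p x) iq; apply: le_integrable => //.
  apply/measurable_EFinP; exact: (measurableT_comp mg (@measurable_pair1 _ _ X Y x)).
by move=> y _ /=; rewrite lee_fin (le_trans (gpq x y))// ler_norm.
Qed.

Lemma slice_integrable2 y : m1.-integrable setT (EFin \o g ^~ y).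
Proof.
have := integrableZl measurableT (q y) ip; apply: le_integrable => //.
  apply/measurable_EFinP; exact: (measurableT_comp mg (@measurable_pair2 _ _ X Y y)).
by move=> x _ /=; rewrite lee_fin mulrC (le_trans (gpq x y))// ler_norm.
Qed.

(** The majorant makes every slice integrable, not just almost every one, so the real-valued inner
    integrals coincide everywhere with the extended ones to which Fubini applies. *)
Lemma Rfubini_bound : \int[m1]_x \int[m2]_y g x y = \int[m2]_y \int[m1]_x g x y.
Proof.
rewrite {1 3}/Rintegral; congr fine.
under eq_integral => x _.
  rewrite fineK; last exact: (integrable_fin_num measurableT (slice_integrable1 x)).
  over.
under [RHS]eq_integral => y _.
  rewrite fineK; last exact: (integrable_fin_num measurableT (slice_integrable2 y)).
  over.
exact: (Fubini ig).
Qed.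

End fubini_bound.

(** * Fourier transform of the Laplace weight in several variables *)

Section fourier_laplace.
Variable R : realType.
Local Notation leb := (@lebesgue_measure R).
Local Notation lam n := (lebN R n).

Lemma Rintegral_lebS (p : R -> R) n (C : R) (g : n.+1.-tuple R -> R) :
  (forall x, 0 <= p x)%R -> measurable_fun setT p ->
  (\int[leb]_x (p x)%:E < +oo)%E ->
  measurable_fun setT g -> (forall x, `|g x| <= C * tprod p x)%R ->
  \int[lam n.+1]_z g z = \int[leb]_x \int[lam n]_y g (cons_tuple x y).
Proof.
move=> p0 mp pfin mg gp; rewrite /Rintegral -(le_tprod_integralNE p0 mp pfin mg gp).
congr fine; apply: eq_integral => x _.
have mgx := measurableT_comp mg (@measurable_cons_tuple R n x).
have gpx y : `|g (cons_tuple x y)| <= C * p x * tprod p y by rewrite -mulrA -tprodS.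
rewrite [LHS](le_tprod_integralNE p0 mp pfin mgx gpx) fineK//.
exact: (integrable_fin_num measurableT (le_tprod_integrable p0 mp pfin mgx gpx)).
Qed.

Lemma tdot_cons n (x : n.+1.-tuple R) a b :
  tdot x (cons_tuple a b) = thead x * a + tdot (behead_tuple x) b.
Proof.
rewrite /tdot big_ord_recl; congr (_ + _).
by apply: eq_bigr => i _; rewrite tnthS [in LHS](tuple_eta x) tnthS.
Qed.

Lemma measurable_tdot d (T : measurableType d) n (f g : T -> n.-tuple R) :
  measurable_fun setT f -> measurable_fun setT g ->
  measurable_fun setT (fun x => tdot (f x) (g x)).
Proof.
move=> mf mg; apply: measurable_sum => i; apply: measurable_funM.
  apply: (@measurableT_comp _ _ _ _ _ _ (fun x => tnth x i)) => //.
  exact: measurable_tnth.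
apply: (@measurableT_comp _ _ _ _ _ _ (fun x => tnth x i)) => //.
exact: measurable_tnth.
Qed.

Lemma measurable_cos : measurable_fun setT (@cos R).
Proof. by apply: continuous_measurable_fun; exact: continuous_cos. Qed.

Lemma tprod_thead (p : R -> R) n (x : n.+1.-tuple R) :
  tprod p x = p (thead x) * tprod p (behead_tuple x).
Proof. by rewrite [in LHS](tuple_eta x) -tprodS. Qed.

Lemma fin_integral_laplace (e : R) : 0 < e -> (\int[leb]_x (laplace e x)%:E < +oo)%E.
Proof. by move=> e0; rewrite integral_laplace// ltry. Qed.

Lemma fin_integral_cauchyk (e : R) : 0 < e -> (\int[leb]_x (cauchyk e x)%:E < +oo)%E.
Proof. by move=> e0; rewrite integral_cauchyk// ltry. Qed.

Lemma tprod_laplace_ge0 n (e : R) (y : n.-tuple R) : 0 <= tprod (laplace e) y.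
Proof. by apply: tprod_ge0 => x; exact: laplace_ge0. Qed.

Lemma tprod_cauchyk_ge0 n (e : R) (y : n.-tuple R) : 0 < e -> 0 <= tprod (cauchyk e) y.
Proof. by move=> e0; apply: tprod_ge0 => x; exact: cauchyk_ge0. Qed.

Lemma integrable_tprod_laplace n (e : R) : 0 < e ->
  (lam n).-integrable setT (EFin \o @tprod R (laplace e) n).
Proof.
move=> e0.
exact: integrable_tprod n (@laplace_ge0 R e) (measurable_laplace e) (fin_integral_laplace e0).
Qed.

Lemma integrable_tprod_cauchyk n (e : R) : 0 < e ->
  (lam n).-integrable setT (EFin \o @tprod R (cauchyk e) n).
Proof.
move=> e0.
exact: integrable_tprod n (fun x => cauchyk_ge0 x e0) (measurable_cauchyk e0) (fin_integral_cauchyk e0).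
Qed.

(** The free phase [psi] absorbs the first coordinate, which keeps the induction within real
    cosines. *)
Lemma Rintegral_tprod_laplace_cos n (e : R) (a : n.-tuple R) psi : 0 < e ->
  \int[lam n]_y (cos (psi + tdot a y) * tprod (laplace e) y) =
  cos psi * tprod (cauchyk e) a.
Proof.
move=> e0; elim: n a psi => [|n IH] a psi.
  rewrite /Rintegral [lam 0]/= integral_dirac//.
    by rewrite diracT mul1e /= /tdot /tprod !big_ord0 addr0.
  apply/measurable_EFinP; apply: measurable_funM; last first.
    by apply: measurable_tprod; exact: measurable_laplace.
  apply: (measurableT_comp measurable_cos); apply: measurable_funD => //.
  by apply: measurable_tdot.
rewrite (@Rintegral_lebS (laplace e) n 1); last 5 first.
- exact: laplace_ge0.
- exact: measurable_laplace.
- exact: fin_integral_laplace.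
- apply: measurable_funM; last by apply: measurable_tprod; exact: measurable_laplace.
  apply: (measurableT_comp measurable_cos); apply: measurable_funD => //.
  exact: measurable_tdot.
- move=> x; rewrite normrM ler_pM//; first exact: cos_abs_le1.
  by rewrite ger0_norm ?tprod_ge0// => ?; exact: laplace_ge0.
under eq_Rintegral => x _.
  under eq_Rintegral => y _.
    rewrite tdot_cons tprodS addrA [laplace e x * _]mulrC mulrA.
    over.
  rewrite RintegralZr//; last first.
    apply: (@le_tprod_integrable _ (laplace e) n 1).
    - exact: laplace_ge0.
    - exact: measurable_laplace.
    - exact: fin_integral_laplace.
    - apply: measurable_funM; last by apply: measurable_tprod; exact: measurable_laplace.
      apply: (measurableT_comp measurable_cos); apply: measurable_funD => //.
      exact: measurable_tdot.
    - move=> y; rewrite normrM ler_pM//; first exact: cos_abs_le1.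
      by rewrite ger0_norm ?tprod_ge0// => ?; exact: laplace_ge0.
  rewrite IH mulrAC.
  over.
rewrite RintegralZr//=.
  under eq_Rintegral => x _ do rewrite addrC.
  by rewrite Rintegral_laplace_cos// tprod_thead mulrA.
apply: (integrable_bounded_mul (C := 1)).
- exact: integrable_laplace.
- by apply: (measurableT_comp measurable_cos); apply: measurable_funD => //; exact: measurable_funM.
- by move=> x; exact: cos_abs_le1.
Qed.

End fourier_laplace.

(** * Integrability of the symbol *)

Section symbol.
Variable R : realType.
Local Notation leb := (@lebesgue_measure R).
Local Notation lam n := (lebN R n).
Implicit Types (theta t : R).

Definition symb theta t n (xi : n.-tuple R) : R :=
  expR (- (t * powR (tnorm xi) theta)).

Lemma symb_ge0 theta t n (xi : n.-tuple R) : 0 <= symb theta t xi.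
Proof. exact: expR_ge0. Qed.

Lemma symb_le1 theta t n (xi : n.-tuple R) : 0 <= t -> symb theta t xi <= 1.
Proof. by move=> t0; rewrite /symb -expR0 ler_expR oppr_le0 mulr_ge0 ?powR_ge0. Qed.

Lemma measurable_tnorm n : measurable_fun setT (@tnorm R n).
Proof.
apply: measurableT_comp; last by apply: measurable_tdot.
by apply: continuous_measurable_fun; exact: sqrt_continuous.
Qed.

Lemma measurable_symb d (T : measurableType d) theta n (t : T -> R) (xi : T -> n.-tuple R) :
  measurable_fun setT t -> measurable_fun setT xi ->
  measurable_fun setT (fun z => symb theta (t z) (xi z)).
Proof.
move=> mt mxi; apply: measurableT_comp => //; apply: measurableT_comp => //.
apply: measurable_funM => //.
apply: (@measurableT_comp _ _ _ _ _ _ (fun x => powR x theta)).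
  exact: measurable_powR.
exact: (measurableT_comp (@measurable_tnorm n) mxi).
Qed.

Lemma norm_tnth_le_tnorm n (x : n.-tuple R) i : `|tnth x i| <= tnorm x.
Proof.
rewrite -sqrtr_sqr /tnorm ler_wsqrtr// /tdot (bigD1 i)//= -expr2 lerDl sumr_ge0// => j _.
by rewrite -expr2 sqr_ge0.
Qed.

(** This is the power [m.+1] of [1 + z <= expR z] at [z = s * y / m.+1]. *)
Lemma pow_le_expR (y s : R) m : 0 <= y -> 0 < s -> y ^+ m.+1 <= (m.+1%:R / s) ^+ m.+1 * expR (s * y).
Proof.
move=> y0 s0.
have m0 : 0 < m.+1%:R :> R by rewrite ltr0n.
have -> : s * y = m.+1%:R * (s * y / m.+1%:R) by field; rewrite gt_eqF.
rewrite expRM_natl -exprMn; apply: lerXn2r.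
- by rewrite nnegrE.
- by rewrite nnegrE mulr_ge0 ?expR_ge0 ?divr_ge0 ?ltW.
have h := expR_ge1Dx (s * y / m.+1%:R).
rewrite {1}(_ : y = m.+1%:R / s * (s * y / m.+1%:R)); last by field; rewrite !gt_eqF.
by rewrite ler_wpM2l ?divr_ge0 ?(ltW s0)// (le_trans _ h)// lerDr.
Qed.

Lemma expR_powR_le_cauchyk theta (s : R) : 0 < theta -> 0 < s ->
  exists2 c, 0 <= c & forall x : R, expR (- (s * powR `|x| theta)) <= c * cauchyk 1 x.
Proof.
move=> th0 s0.
(* With this [m], the power [m.+1] of [|x|^theta] dominates [x ^+ 2] when [|x|] exceeds 1. *)
have [m hm] : exists m : nat, 2 <= theta * m.+1%:R.
  exists (Num.truncn (2 / theta)).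
  by rewrite mulrC -ler_pdivrMr// ltW// truncnS_gt.
pose c := 1 + (m.+1%:R / s) ^+ m.+1.
have cp : 0 <= (m.+1%:R / s) ^+ m.+1 by rewrite exprn_ge0// divr_ge0// ltW.
exists c => [|x]; first by rewrite addr_ge0.
rewrite /cauchyk expr1n mulr1.
have x2 : 0 < 1 + x ^+ 2 by rewrite ltr_pwDl// sqr_ge0.
rewrite mulrA ler_pdivlMr// -ler_pdivlMl ?expR_gt0// -expRN opprK.
set y := powR _ _; have y0 : 0 <= y by exact: powR_ge0.
have e1 : 1 <= expR (s * y) by rewrite -expR0 ler_expR mulr_ge0// ltW.
have [x1|x1] := leP `|x| 1.
  have : x ^+ 2 <= 1 by rewrite -real_normK ?num_real// exprn_ile1.
  move=> hx; rewrite (@le_trans _ _ 2)//; first lra.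
  rewrite -[leLHS]mul1r ler_pM//; rewrite /c; lra.
have : x ^+ 2 <= y ^+ m.+1.
  rewrite -real_normK ?num_real// -!powR_mulrn// -powRrM.
  by apply: ler_powR => //; exact: ltW.
move=> hx; have := pow_le_expR m y0 s0 => hy.
have : x ^+ 2 <= (m.+1%:R / s) ^+ m.+1 * expR (s * y) by exact: le_trans hy.
move: cp; rewrite /c; set K := (_ / s) ^+ _ => cp h.
have := mulr_ge0 cp (expR_ge0 (s * y)); nra.
Qed.

(** Each [|xi_i|] is at most [|xi|], so [|xi|^theta] dominates the mean of the [|xi_i|^theta], and
    the symbol is at most a product of one-dimensional symbols at the time [t] divided by the
    dimension. *)
Lemma symb_le_cauchyk theta t n : 0 < theta -> 0 < t ->
  exists2 C, 0 <= C & forall xi : n.-tuple R, symb theta t xi <= C * tprod (cauchyk 1) xi.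
Proof.
move=> th0 t0; case: n => [|n].
  by exists 1 => // xi; rewrite mul1r /tprod big_ord0 symb_le1// ltW.
have s0 : 0 < t / n.+1%:R by rewrite divr_gt0.
have [c c0 hc] := expR_powR_le_cauchyk th0 s0.
exists (c ^+ n.+1) => [|xi]; first exact: exprn_ge0.
rewrite (@le_trans _ _ (\prod_(i < n.+1) (c * cauchyk 1 (tnth xi i))))//; last first.
  by rewrite big_split/= prodr_const card_ord.
apply: (@le_trans _ _ (\prod_(i < n.+1) expR (- (t / n.+1%:R * powR `|tnth xi i| theta)))); last first.
  by apply: ler_prod => i _; rewrite expR_ge0 hc.
rewrite -expR_sum ler_expR sumrN lerN2 -mulr_sumr -mulrA ler_wpM2l ?(ltW t0)//.
rewrite ler_pdivrMl ?ltr0n// mulr_natl -[X in _ <= _ *+ X]card_ord -sumr_const.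
apply: ler_sum => i _; apply: ge0_ler_powR; rewrite ?nnegrE ?sqrtr_ge0 ?(ltW th0)//.
exact: norm_tnth_le_tnorm.
Qed.

Lemma integrable_symb theta t n : 0 < theta -> 0 < t ->
  (lam n).-integrable setT (EFin \o @symb theta t n).
Proof.
move=> th0 t0; have [C C0 hC] := symb_le_cauchyk n th0 t0.
apply: (@le_tprod_integrable _ (cauchyk 1) n C).
- by move=> x; exact: cauchyk_ge0.
- exact: measurable_cauchyk.
- exact: fin_integral_cauchyk.
- exact: measurable_symb.
- by move=> xi; rewrite ger0_norm ?symb_ge0.
Qed.

Lemma Gamma_thetaE theta t n (x : n.-tuple R) : 0 < theta -> 0 < t ->
  Gamma_theta theta x t =
  ((2 * pi) ^+ n)^-1 * \int[lam n]_xi (cos (tdot x xi) * symb theta t xi).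
Proof.
move=> th0 t0; have [C C0 hC] := symb_le_cauchyk n th0 t0.
rewrite /Gamma_theta /Rintegral; congr (_ * fine _).
apply: (@le_tprod_integralNE _ (cauchyk 1) n C).
- by move=> ?; exact: cauchyk_ge0.
- exact: measurable_cauchyk.
- exact: fin_integral_cauchyk.
- apply: measurable_funM; last exact: measurable_symb.
  by apply: (measurableT_comp (@measurable_cos R)); exact: measurable_tdot.
- move=> xi; rewrite normrM (ger0_norm (symb_ge0 _ _ _)) (le_trans _ (hC xi))//.
  by rewrite ler_piMl ?symb_ge0// cos_abs_le1.
Qed.

End symbol.

(** * Positivity of the fundamental solution *)

Section binomial_series.
Variable R : realType.
Variable al : R.
Hypotheses (al0 : 0 < al) (al1 : al <= 1).

(** Taylor coefficients at 0 of [(1 - w)^al], that is, binomial coefficients of [al] with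
    alternating signs. *)
Fixpoint bcoef (k : nat) : R :=
  if k is k'.+1 then bcoef k' * (k'%:R - al) / k'.+1%:R else 1.

Definition bsum n (w : R) : R := \sum_(k < n.+1) bcoef k * w ^+ k.
Definition bsum' n (w : R) : R := \sum_(k < n.+1) bcoef k * (k%:R * w ^+ k.-1).

(** Among the factors [j - al] of the numerator only the one with [j = 0] is negative, because
    [al <= 1]. For [al = theta / 2] this is the role of [theta <= 2]. *)
Lemma bcoefS_le0 k : bcoef k.+1 <= 0.
Proof.
elim: k => [|k IH]; first by rewrite /= mul1r divr1 sub0r oppr_le0 ltW.
rewrite [bcoef _]/(bcoef k.+1 * (k.+1%:R - al) / k.+2%:R).
have : 1 <= k.+1%:R :> R by rewrite ler1n.
by move=> k1; rewrite mulr_le0_ge0// ?invr_ge0// mulr_le0_ge0// subr_ge0 (le_trans al1).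
Qed.

(* The partial sums solve the equation of [(1 - w) `^ al] up to a remainder
   that vanishes geometrically. *)
Lemma bsum_ode n w : (1 - w) * bsum' n w + al * bsum n w = (al - n%:R) * bcoef n * w ^+ n.
Proof.
elim: n => [|n IH].
  by rewrite /bsum /bsum' !big_ord_recl !big_ord0 /= !mul0r !mulr0 !addr0 mulr0 add0r subr0 expr0 !mulr1.
have -> : bsum' n.+1 w = bsum' n w + bcoef n.+1 * (n.+1%:R * w ^+ n) by rewrite /bsum' big_ord_recr.
have -> : bsum n.+1 w = bsum n w + bcoef n.+1 * w ^+ n.+1 by rewrite /bsum big_ord_recr.
have e : n.+1%:R * bcoef n.+1 = (n%:R - al) * bcoef n.
  by rewrite /= mulrC divfK ?pnatr_eq0// mulrC.
have -> : (1 - w) * (bsum' n w + bcoef n.+1 * (n.+1%:R * w ^+ n)) + al * (bsum n w + bcoef n.+1 * w ^+ n.+1)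
  = ((1 - w) * bsum' n w + al * bsum n w) + (1 - w) * (n.+1%:R * bcoef n.+1) * w ^+ n + al * bcoef n.+1 * w ^+ n.+1 by ring.
rewrite IH [(_ - n.+1%:R) * _]mulrBl e exprS.
by move: (bcoef n.+1) (bcoef n) (w ^+ n) (n%:R) => c c' W N; ring.
Qed.

(** Consecutive values have the ratio [(n.+1 - al) / n.+1], which lies between 0 and 1. *)
Lemma bcoef_bound n : `|(al - n%:R) * bcoef n| <= 1.
Proof.
elim: n => [|n IH]; first by rewrite subr0 mulr1 ger0_norm// ltW.
have n0 : 0 < n.+1%:R :> R by rewrite ltr0n.
have -> : (al - n.+1%:R) * bcoef n.+1 = ((al - n%:R) * bcoef n) * ((n.+1%:R - al) / n.+1%:R).
  by rewrite /=; move: (n%:R) (n.+1%:R) n0 (bcoef n) => N K K0 c; field; rewrite gt_eqF.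
rewrite normrM mulr_ile1//.
have : 1 <= n.+1%:R :> R by rewrite ler1n.
move=> n1; have h : 0 <= n.+1%:R - al by rewrite subr_ge0 (le_trans al1).
rewrite ger0_norm ?divr_ge0//.
by rewrite ler_pdivrMr// mul1r gerBl ltW.
Qed.

Lemma is_derive_bsum n (w : R) : is_derive w 1 (bsum n) (bsum' n w).
Proof.
have -> : bsum n = \sum_(k < n.+1) (bcoef k *: (id ^+ k : R -> R)).
  apply/funext => x; rewrite /bsum fct_sumE; apply: eq_bigr => k _.
  by rewrite -[RHS]/(bcoef k * ((id ^+ k : R -> R) x)) exprfctE.
apply: is_derive_eq; apply: eq_bigr => k _.
rewrite -[LHS]/(bcoef k * ((k%:R * w ^+ k.-1) * 1)) mulr1 //.
Qed.

(** The function [(1 - w)^(- al)], an integrating factor for the equation of [bsum_ode]. *)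
Let D (w : R) : R := expR (- al * ln (1 - w)).

Let dD (w : R) : w < 1 -> is_derive w 1 D (al * D w / (1 - w)).
Proof.
move=> w1; have w0 : 0 < 1 - w by lra.
have d1 := is_derive_affine (-1) 1 w.
have w0' : 0 < -1 * w + 1 by lra.
have d2 := is_derive1_comp (g := fun y => -1 * y + 1) (is_derive1_ln w0') d1.
have d3 := is_deriveZ (- al) d2.
have d4 := is_derive1_comp (is_derive_expR _) d3.
move: d4; set G := (X in is_derive _ _ X _); set dG := (X in is_derive _ _ _ X).
have E y : -1 * y + 1 = 1 - y by rewrite mulN1r addrC.
have -> : G = D by apply/funext => y; rewrite /G /D /= /GRing.scale/= E.
suff -> : dG = al * D w / (1 - w) by [].
by rewrite /dG /= /GRing.scale/= E /D; field; rewrite gt_eqF.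
Qed.

Let G n w := D w * bsum n w.

Let dG n (w : R) : w < 1 ->
  is_derive w 1 (G n) (D w / (1 - w) * ((al - n%:R) * bcoef n * w ^+ n)).
Proof.
move=> w1; have w0 : 0 < 1 - w by lra.
have := is_deriveM (dD w1) (is_derive_bsum n w).
set dG := (X in is_derive _ _ _ X) => h.
suff <- : dG = D w / (1 - w) * ((al - n%:R) * bcoef n * w ^+ n) by [].
by rewrite /dG -bsum_ode /GRing.scale/=; field; rewrite gt_eqF.
Qed.

(** Mean value theorem for [G n] between 0 and [z]: [G n 0 = 1], and by [bsum_ode] the derivative at
    the intermediate point [w] carries the factor [w ^+ n], with [|w| <= |z|]. *)
Lemma bsum_error n (z : R) : `|z| < 1 ->
  `|D z * bsum n z - 1| <= expR (- al * ln (1 - `|z|)) / (1 - `|z|) * `|z| ^+ n.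
Proof.
move=> z1.
have G0 : G n 0 = 1.
  rewrite /G /D subr0 ln1 mulr0 expR0 mul1r /bsum big_ord_recl big1 ?addr0 ?mulr1//.
  by move=> i _; rewrite expr0n/= mulr0.
rewrite -[D z * _]/(G n z) -{1}G0.
have [w [wz]] : exists w, `|w| <= `|z| /\ G n z - G n 0 = D w / (1 - w) * ((al - n%:R) * bcoef n * w ^+ n) * z.
  have cG (w : R) : w < 1 -> {for w, continuous (G n)}.
    by move=> w1; apply: differentiable_continuous; apply/derivable1_diffP; have h := dG n w1; exact: (@ex_derive _ _ _ _ _ _ _ h).
  have [z0|z0] := leP 0 z.
    have [||w] := @MVT_segment R (G n) (fun w => D w / (1 - w) * ((al - n%:R) * bcoef n * w ^+ n)) 0 z z0.
    - by move=> x; rewrite in_itv/= => /andP[_ xz]; apply: dG; apply: lt_trans xz _; move: z1; rewrite ger0_norm.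
    - apply: continuous_in_subspaceT => x; rewrite inE/= in_itv/= => /andP[_ xz]; apply: cG.
      by apply: le_lt_trans xz _; move: z1; rewrite ger0_norm.
    rewrite in_itv/= => /andP[w0 wz] ->; exists w; split; last by rewrite subr0.
    by rewrite !ger0_norm.
  have [||w] := @MVT_segment R (G n) (fun w => D w / (1 - w) * ((al - n%:R) * bcoef n * w ^+ n)) z 0 (ltW z0).
  - by move=> x; rewrite in_itv/= => /andP[_ xz]; apply: dG; lra.
  - by apply: continuous_in_subspaceT => x; rewrite inE/= in_itv/= => /andP[_ xz]; apply: cG; lra.
  rewrite in_itv/= => /andP[w0 wz] h; exists w; split; first by rewrite !ler0_norm ?lerN2// ltW.
  by rewrite -[LHS]opprB h; ring.
move=> ->.
have w1 : `|w| < 1 by exact: le_lt_trans z1.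
have w2 : w <= `|z| by apply: le_trans wz; exact: ler_norm.
have z2 : 0 < 1 - `|z| by lra.
have w3 : 0 < 1 - w by lra.
have -> : D w / (1 - w) * ((al - n%:R) * bcoef n * w ^+ n) * z =
  (D w / (1 - w)) * (w ^+ n) * (((al - n%:R) * bcoef n) * z) by ring.
rewrite normrM -[leRHS]mulr1 ler_pM//; last first.
  by rewrite normrM mulr_ile1// ?bcoef_bound// ltW.
rewrite normrM ler_pM//; last by rewrite normrX lerXn2r ?nnegrE.
have D0 : 0 <= D w by exact: expR_ge0.
rewrite ger0_norm ?divr_ge0// ?(ltW w3)// ler_pM ?invr_ge0 ?(ltW w3)//.
  by rewrite /D ler_expR !mulNr lerN2 ler_wpM2l ?(ltW al0)// ler_ln ?posrE//; lra.
by rewrite lef_pV2 ?posrE//; lra.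
Qed.

Lemma bsum_cvg (z : R) : `|z| < 1 -> bsum n z @[n --> \oo] --> powR (1 - z) al.
Proof.
move=> z1.
have z0 : 0 < 1 - z by have := ler_norm z; lra.
set K := expR (- al * ln (1 - `|z|)) / (1 - `|z|).
have h : D z * bsum n z @[n --> \oo] --> (1 : R).
  apply/subr_cvg0.
  apply: (@squeeze_cvgr _ _ _ _ (fun n => - (K * `|z| ^+ n)) (fun n => K * `|z| ^+ n)).
  - by apply: nearW => n; rewrite -ler_norml; exact: bsum_error.
  - rewrite -oppr0; apply: cvgN; rewrite -(mulr0 K); apply: cvgMr; apply: cvg_expr; by rewrite normr_id.
  - rewrite -(mulr0 K); apply: cvgMr; apply: cvg_expr; by rewrite normr_id.
have DE : (D z)^-1 = powR (1 - z) al.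
  by rewrite /powR gt_eqF// /D -expRN mulNr opprK.
have := cvgMr (a := (D z)^-1) h; rewrite mulr1 DE.
under eq_fun do rewrite -DE mulrA mulVf ?gt_eqF ?expR_gt0// mul1r.
by apply.
Qed.

End binomial_series.

(** * Dominated convergence for real integrals *)

Section dominated.
Context d (T : measurableType d) (R : realType) (mu : {measure set T -> \bar R}).

Lemma Rintegral_dominated_cvg (f_ : nat -> T -> R) (f g : T -> R) :
  (forall n, measurable_fun setT (f_ n)) -> (forall x, f_ ^~ x @ \oo --> f x) ->
  mu.-integrable setT (EFin \o g) -> (forall n x, `|f_ n x| <= g x) ->
  \int[mu]_x f_ n x @[n --> \oo] --> \int[mu]_x f x.
Proof.
move=> mf ff ig fg.
have igf : mu.-integrable setT (EFin \o f).
  apply: le_integrable ig => //.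
    by apply/measurable_EFinP; apply: (measurable_fun_cvg mf) => x _; exact: ff.
  move=> x _ /=; rewrite lee_fin (le_trans _ (ler_norm _))//.
  apply: (@cvgr_to_le _ \oo _ _ (fun n => `|f_ n x|)); last exact: nearW.
  by apply: cvg_norm.
apply: fine_cvg.
rewrite fineK; last exact: integrable_fin_num igf.
apply: (@dominated_cvg _ _ _ mu setT measurableT (fun n x => (f_ n x)%:E) (EFin \o f) (EFin \o g)) => //.
- by move=> n; apply/measurable_EFinP.
- by move=> x _; apply: cvg_EFin; [exact: nearW|exact: ff].
- by move=> n x _ /=; rewrite lee_fin.
Qed.

End dominated.

(** * The algebra of multipliers *)

Section multipliers.
Variable R : realType.
Local Notation lam n := (lebN R n).
Variables (n : nat) (e : R).
Hypothesis e0 : 0 < e.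
Implicit Types (phi psi m h : n.-tuple R -> R).

Definition bdm phi : Prop :=
  measurable_fun setT phi /\ exists2 C, 0 <= C & forall xi, `|phi xi| <= C.

(** The Laplace weight makes all bounded [phi] admissible, constants included, so that [posdef1] can
    start the argument. For even [phi] the cosine part is the whole transform. *)
Definition posdef phi : Prop := forall x : n.-tuple R,
  0 <= \int[lam n]_xi (cos (tdot x xi) * (phi xi * tprod (laplace e) xi)).

(** Quantifying over all [phi], rather than asking for the positivity of one transform, turns
    closure under products into composition and avoids a convolution theorem. *)
Definition multp m : Prop := bdm m /\
  forall phi, bdm phi -> posdef phi -> posdef (fun xi => m xi * phi xi).

Lemma measurable_cos_tdot x : measurable_fun setT (fun xi : n.-tuple R => cos (tdot x xi)).
Proof. by apply: (measurableT_comp (@measurable_cos R)); exact: measurable_tdot. Qed.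

Lemma integrable_cos_bdm x phi : bdm phi -> (lam n).-integrable setT
  (EFin \o (fun xi => cos (tdot x xi) * (phi xi * tprod (laplace e) xi))).
Proof.
move=> [mphi [C C0 hC]].
apply: (@le_tprod_integrable _ (laplace e) n C).
- exact: laplace_ge0.
- exact: measurable_laplace.
- exact: fin_integral_laplace.
- apply: measurable_funM; first exact: measurable_cos_tdot.
  apply: measurable_funM => //.
  by apply: measurable_tprod; exact: measurable_laplace.
- move=> xi; rewrite normrM (@le_trans _ _ (`|phi xi| * tprod (laplace e) xi))//.
    rewrite normrM (@ger0_norm _ (tprod _ _)); last exact: tprod_laplace_ge0.
    by rewrite ler_piMl ?cos_abs_le1// mulr_ge0// tprod_laplace_ge0.
  by rewrite ler_wpM2r// tprod_laplace_ge0.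
Qed.

Lemma bdmM m phi : bdm m -> bdm phi -> bdm (fun xi => m xi * phi xi).
Proof.
move=> [mm [C C0 hC]] [mphi [D D0 hD]]; split; first exact: measurable_funM.
exists (C * D) => [|xi]; first exact: mulr_ge0.
by rewrite normrM ler_pM.
Qed.

Lemma bdmD m phi : bdm m -> bdm phi -> bdm (fun xi => m xi + phi xi).
Proof.
move=> [mm [C C0 hC]] [mphi [D D0 hD]]; split; first exact: measurable_funD.
exists (C + D) => [|xi]; first exact: addr_ge0.
by rewrite (le_trans (ler_normD _ _))// lerD.
Qed.

Lemma bdm_cst c : bdm (fun=> c).
Proof. by split => //; exists `|c|. Qed.

Lemma posdef1 : posdef (fun=> 1).
Proof.
move=> x; have := @Rintegral_tprod_laplace_cos R n e x 0 e0.
under eq_Rintegral do rewrite add0r.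
under [X in _ -> 0 <= X]eq_Rintegral do rewrite mul1r.
by move=> ->; rewrite cos0 mul1r tprod_cauchyk_ge0.
Qed.

Lemma multp_cst c : 0 <= c -> multp (fun=> c).
Proof.
move=> c0; split; first exact: bdm_cst.
move=> phi bphi pphi x.
under eq_Rintegral => xi _ do rewrite -mulrA mulrCA.
rewrite RintegralZl//; last exact: integrable_cos_bdm.
by rewrite mulr_ge0.
Qed.

Lemma multpM m h : multp m -> multp h -> multp (fun xi => m xi * h xi).
Proof.
move=> [bm pm] [bh ph]; split; first exact: bdmM.
move=> phi bphi pphi; rewrite (_ : (fun _ => _) = (fun xi => m xi * (h xi * phi xi))); last first.
  by apply/funext => xi; rewrite mulrA.
by apply: (pm (fun xi => h xi * phi xi)); [exact: bdmM|exact: ph].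
Qed.

Lemma multpD m h : multp m -> multp h -> multp (fun xi => m xi + h xi).
Proof.
move=> [bm pm] [bh ph]; split; first exact: bdmD.
move=> phi bphi pphi x.
under eq_Rintegral => xi _ do rewrite mulrDl mulrDl mulrDr.
rewrite RintegralD//.
- by apply: addr_ge0; [exact: pm|exact: ph].
- by apply: integrable_cos_bdm; exact: bdmM.
- by apply: integrable_cos_bdm; exact: bdmM.
Qed.

Lemma multp_sum (I : Type) (s : seq I) (F : I -> n.-tuple R -> R) :
  (forall i, multp (F i)) -> multp (fun xi => \sum_(i <- s) F i xi).
Proof.
move=> hF; elim: s => [|i s IH].
  under eq_fun do rewrite big_nil.
  exact: multp_cst.
under eq_fun do rewrite big_cons.
exact: multpD.
Qed.

Lemma multpX m k : multp m -> multp (fun xi => m xi ^+ k).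
Proof.
move=> hm; elim: k => [|k IH].
  under eq_fun do rewrite expr0.
  exact: multp_cst.
under eq_fun do rewrite exprS.
exact: multpM.
Qed.

Lemma multp_lim (m_ : nat -> n.-tuple R -> R) m C :
  (forall k, multp (m_ k)) -> (forall k xi, `|m_ k xi| <= C) ->
  (forall xi, m_ ^~ xi @ \oo --> m xi) -> multp m.
Proof.
move=> hm hC hcvg.
have C0 : 0 <= C by apply: le_trans (hC 0%N (nseq_tuple n 0)).
have mC xi : `|m xi| <= C.
  apply: (@cvgr_to_le _ \oo _ _ (fun k => `|m_ k xi|)); last exact: nearW.
  by apply: cvg_norm.
have bm : bdm m.
  split; last by exists C.
  by apply: (@measurable_fun_cvg _ _ _ _ m_) => [k|xi _]; [have [[]] := hm k|exact: hcvg].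
split => // phi bphi pphi x.
apply: (@cvgr_to_ge _ \oo _ _ (fun k => \int[lam n]_xi (cos (tdot x xi) * (m_ k xi * phi xi * tprod (laplace e) xi)))); last first.
  by apply: nearW => k; have [_] := hm k; apply.
have [D D0 hD] := bphi.2.
have iL : (lam n).-integrable setT (EFin \o (fun xi => (C * D) * tprod (laplace e) xi)).
  exact: (integrableZl measurableT (C * D) (integrable_tprod_laplace n e0)).
apply: (Rintegral_dominated_cvg _ _ iL).
- move=> k; apply: measurable_funM; first exact: measurable_cos_tdot.
  apply: measurable_funM; last by apply: measurable_tprod; exact: measurable_laplace.
  by apply: measurable_funM; [have [[]] := hm k|exact: bphi.1].
- by move=> xi; apply: cvgMr; apply: cvgMl; apply: cvgMl; exact: hcvg.
- move=> k xi; rewrite normrM -[leRHS]mul1r ler_pM ?cos_abs_le1//.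
  rewrite normrM ler_pM//; first by rewrite normrM ler_pM.
  by rewrite ger0_norm// tprod_laplace_ge0.
Qed.

(** The exponential series has nonnegative coefficients, and [expR C] bounds its partial sums
    uniformly in [xi]. *)
Lemma multp_exp h : multp h -> multp (fun xi => expR (h xi)).
Proof.
move=> hh; have [[mh [C C0 hC]] _] := hh.
apply: (@multp_lim (fun k xi => series (exp_coeff (h xi)) k) _ (expR C)).
- move=> k; rewrite /series /=.
  apply: (@multp_sum nat (index_iota 0 k) (fun i xi => exp_coeff (h xi) i)) => i.
  apply: multpM; first exact: multpX.
  by apply: multp_cst; rewrite invr_ge0.
- move=> k xi; apply: (@le_trans _ _ (series (exp_coeff C) k)).
    rewrite /series/= (le_trans (ler_norm_sum _ _ _))//.
    apply: ler_sum => i _; rewrite /exp_coeff /= normrM normfV normrX [`|_%:R|]ger0_norm//.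
    by rewrite ler_wpM2r ?invr_ge0// lerXn2r.
  apply: nondecreasing_cvgn_le; last exact: is_cvg_series_exp_coeff.
  apply/nondecreasing_seqP => j; rewrite /series/= big_nat_recr//= lerDl.
  exact: exp_coeff_ge0.
- move=> xi; exact: is_cvg_series_exp_coeff.
Qed.

(** By the product formula for cosines, multiplication by [cos (dl * xi_i)] averages the transform
    over the two translates of [x] by [dl] and [- dl] along the axis [i]. *)
Lemma multp_cos i (dl : R) : multp (fun xi => cos (dl * tnth xi i)).
Proof.
have mc : measurable_fun setT (fun xi : n.-tuple R => cos (dl * tnth xi i)).
  apply: (measurableT_comp (@measurable_cos R)); apply: measurable_funM => //.
  exact: measurable_tnth.
have bc : bdm (fun xi => cos (dl * tnth xi i)).
  by split => //; exists 1 => // xi; exact: cos_abs_le1.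
split => // phi bphi pphi x.
pose sh (s : R) : n.-tuple R := [tuple tnth x j + (if j == i then s else 0) | j < n].
have shE s xi : tdot (sh s) xi = tdot x xi + s * tnth xi i.
  rewrite /tdot; under eq_bigr => j _ do rewrite tnth_mktuple mulrDl.
  rewrite big_split/=; congr (_ + _).
  rewrite (bigD1 i)//= eqxx big1 ?addr0// => j /negbTE ->; exact: mul0r.
have E xi : cos (tdot x xi) * (cos (dl * tnth xi i) * phi xi * tprod (laplace e) xi) =
    2^-1 * (cos (tdot (sh dl) xi) * (phi xi * tprod (laplace e) xi)
         + cos (tdot (sh (- dl)) xi) * (phi xi * tprod (laplace e) xi)).
  by rewrite !shE mulNr cosB cosD; field.
under eq_Rintegral do rewrite E.
have i1 := integrable_cos_bdm (sh dl) bphi.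
have i2 := integrable_cos_bdm (sh (- dl)) bphi.
rewrite RintegralZl//; last exact: (integrableD measurableT i1 i2).
by rewrite RintegralD// mulr_ge0 ?invr_ge0// addr_ge0.
Qed.

(** The factor [r < 1] keeps the argument inside the open disc of convergence. As the coefficients
    are nonnegative, the partial sums are bounded by the value of the series at [r], hence by 1. *)
Lemma multp_powR al r z : 0 < al -> al <= 1 -> 0 <= r < 1 ->
  multp z -> (forall xi, `|z xi| <= 1) -> multp (fun xi => 1 - powR (1 - r * z xi) al).
Proof.
move=> al0 al1 /andP[r0 r1] hz z1.
have zr xi : `|r * z xi| <= r by rewrite normrM (ger0_norm r0) ler_piMr.
have zr1 xi : `|r * z xi| < 1 by exact: le_lt_trans r1.
pose p k (w : R) := \sum_(j < k) (- bcoef al j.+1) * w ^+ j.+1.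
have pE k w : p k w = 1 - bsum al k w.
  rewrite /p /bsum big_ord_recl /= mulr1 opprD addrA subrr add0r -sumrN.
  by apply: eq_bigr => j _; rewrite mulNr.
apply: (@multp_lim (fun k xi => p k (r * z xi)) _ 1).
- move=> k; rewrite /p; apply: multp_sum => j; apply: multpM.
    by apply: multp_cst; rewrite oppr_ge0 bcoefS_le0.
  apply: multpX; apply: multpM => //; exact: multp_cst.
- move=> k xi; apply: (@le_trans _ _ (p k r)).
    rewrite /p (le_trans (ler_norm_sum _ _ _))//; apply: ler_sum => j _.
    have c0 : 0 <= - bcoef al j.+1 by rewrite oppr_ge0 bcoefS_le0.
    by rewrite normrM (ger0_norm c0) ler_wpM2l// normrX lerXn2r// nnegrE.
  have r1' : `|r| < 1 by rewrite ger0_norm.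
  have pc : p ^~ r @ \oo --> 1 - powR (1 - r) al.
    under eq_fun do rewrite pE.
    by apply: cvgB; [exact: cvg_cst|exact: bsum_cvg].
  apply: (@le_trans _ _ (1 - powR (1 - r) al)); last by rewrite gerBl powR_ge0.
  rewrite -(cvg_lim _ pc)//; apply: nondecreasing_cvgn_le; last by apply/cvg_ex; eexists; exact: pc.
  apply/nondecreasing_seqP => j; rewrite /p big_ord_recr/= lerDl mulr_ge0 ?exprn_ge0//.
  by rewrite oppr_ge0 bcoefS_le0.
- by move=> xi; under eq_fun do rewrite pE; apply: cvgB; [exact: cvg_cst|exact: bsum_cvg].
Qed.

Lemma multp_exp_powR al r z t : 0 < al -> al <= 1 -> 0 <= r < 1 -> 0 <= t ->
  multp z -> (forall xi, `|z xi| <= 1) ->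
  multp (fun xi => expR (- (t * powR (1 - r * z xi) al))).
Proof.
move=> al0 al1 r01 t0 hz z1.
(* A negative constant is not a multiplier, so the exponent is first shifted by [t] to become a
   multiplier. *)
have E xi : expR (- (t * powR (1 - r * z xi) al)) = expR (- t) * expR (t * (1 - powR (1 - r * z xi) al)).
  by rewrite -expRD; congr expR; ring.
under eq_fun do rewrite E.
apply: multpM; first by apply: multp_cst; exact: expR_ge0.
apply: multp_exp; apply: multpM; first exact: multp_cst.
exact: multp_powR.
Qed.

End multipliers.

(** * The symbol as a limit of multipliers *)

Section positivity.
Variable R : realType.
Local Notation lam n := (lebN R n).

Lemma sin_quotient_cvg (x : R) : (@harmonic R k)^-1 * sin (harmonic k * x) @[k --> \oo] --> x.
Proof.
have d1 := is_derive1_comp (g := fun y : R => x * y + 0) (is_derive_sin (x * 0 + 0)) (is_derive_affine x 0 0).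
have h1 := @ex_derive _ _ _ _ _ _ _ d1.
have := @derive_val _ _ _ _ _ _ _ d1.
rewrite /derive mulr0 addr0 cos0 mul1r => dv.
move/cvg_ex: h1 => [l hl]; move: dv; rewrite (cvg_lim _ hl)// => lE.
rewrite {}lE in hl.
have : (fun k => (@harmonic R k)) @ \oo --> (0 : R)^'.
  move=> A /= [r r0 hr].
  have := @cvg_harmonic R; move/cvgrPdist_lt => /(_ r r0) [k0 _ hk]; exists k0 => // k /= kk.
  apply: hr; last by rewrite gt_eqF// harmonic_gt0.
  exact: hk.
move=> /(cvg_comp _ _)/(_ hl).
apply: cvg_trans; apply: near_eq_cvg; apply: nearW => k /=.
by rewrite /GRing.scale /= !addr0 !mulr1 mulr0 sin0 subr0 mulrC [x * _]mulrC mulrC.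
Qed.

(** The half-angle formula reduces this to the square of the sine quotient at [x / 2]. *)
Lemma cos_quotient_cvg (x : R) :
  2 * (1 - cos (harmonic k * x)) / harmonic k ^+ 2 @[k --> \oo] --> x ^+ 2.
Proof.
have h := @sin_quotient_cvg (x / 2).
have -> : x ^+ 2 = 4 * (x / 2 * (x / 2)) by field.
have h2 := cvgMr (a := 4) (cvgM h h).
rewrite (_ : (fun k => _) = (fun k => 4 * ((harmonic k)^-1 * sin (harmonic k * (x / 2)) *
  ((harmonic k)^-1 * sin (harmonic k * (x / 2)))))); first exact: h2.
apply/funext => k.
have d0 := @harmonic_gt0 R k; move: (harmonic k) d0 => d d0.
have -> : d * x = (d * (x / 2)) *+ 2 by rewrite -mulr_natr; field.
by rewrite cos_mulr2n cos2sin2 -mulr_natr; field; rewrite gt_eqF.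
Qed.

(** A positive limit is handled by differentiability of the power; the limit 0, which occurs for the
    symbol at frequency 0, by its monotonicity. *)
Lemma powR_cvg_ge0 (al : R) (u : nat -> R) (l : R) : 0 < al ->
  (forall k, 0 <= u k) -> u @ \oo --> l -> powR (u k) al @[k --> \oo] --> powR l al.
Proof.
move=> al0 u0 ul.
have l0 : 0 <= l by apply: (@cvgr_to_ge _ \oo _ _ u) => //; exact: nearW.
have [l1|l1] := ltP 0 l.
  have c : {for l, continuous ((@powR R) ^~ al)}.
    apply: differentiable_continuous; apply/derivable1_diffP; apply: derivable_powR.
    by rewrite in_itv/= andbT.
  exact: (cvg_comp u ((@powR R) ^~ al) ul c).
have {l0 l1} l0 : l = 0 by apply/eqP; rewrite eq_le l1 l0.
rewrite l0 powR0 ?gt_eqF//; rewrite l0 in ul.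
apply/cvgr0Pnorm_lt => d d0.
have p0 : 0 < powR d al^-1 by exact: powR_gt0.
move/cvgr0Pnorm_lt: ul => /(_ _ p0); apply: filterS => k.
rewrite !ger0_norm ?powR_ge0// => h.
have := gt0_ltr_powR al0 (u0 k) (ltW p0) h.
by rewrite -powRrM mulVf ?gt_eqF// powRr1// ltW.
Qed.

Lemma symb_tdotE theta t n (xi : n.-tuple R) : symb theta t xi = expR (- (t * powR (tdot xi xi) (theta / 2))).
Proof.
rewrite /symb /tnorm -powR12_sqrt; last by apply: sumr_ge0 => i _; rewrite -expr2 sqr_ge0.
by rewrite -powRrM [2^-1 * _]mulrC.
Qed.

Lemma multp_symb n e theta t : 0 < e -> 0 < theta <= 2 -> 0 < t ->
  multp e (@symb R theta t n.+1).
Proof.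
move=> e0 /andP[th0 th2] t0.
have al0 : 0 < theta / 2 by rewrite divr_gt0.
have al1 : theta / 2 <= 1 by rewrite ler_pdivrMr// mul1r.
set al := theta / 2 in al0 al1.
pose N : R := n.+1%:R.
have N0 : 0 < N by rewrite ltr0n.
pose d (k : nat) : R := harmonic k.
have d0 k : 0 < d k by exact: harmonic_gt0.
have d1 k : d k <= 1 by rewrite /d /harmonic/= invf_le1// ler1n.
pose z k (xi : n.+1.-tuple R) := N^-1 * \sum_(i < n.+1) cos (d k * tnth xi i).
have z1 k xi : `|z k xi| <= 1.
  rewrite /z normrM gtr0_norm ?invr_gt0// ler_pdivrMl// mulr1.
  rewrite (le_trans (ler_norm_sum _ _ _))// (@le_trans _ _ (\sum_(i < n.+1) (1 : R)))//.
    by apply: ler_sum => i _; exact: cos_abs_le1.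
  by rewrite sumr_const card_ord.
have hz k : multp e (z k).
  apply: multpM => //; first by apply: multp_cst => //; rewrite invr_ge0 ltW.
  by apply: multp_sum => // i; exact: multp_cos.
(* [1 - r k] must be [o(d k ^+ 2)] while [r k < 1]. *)
pose r k := 1 - d k ^+ 3.
have r01 k : 0 <= r k < 1.
  by rewrite subr_ge0 exprn_ile1 ?(ltW (d0 k))//= ltrBlDr ltrDl exprn_gt0.
(* Up to the factor [r k], this is the symbol of the discrete Laplacian with step [d k]: since
   [1 - cos (d * y)] behaves like [(d * y) ^+ 2 / 2], it tends to [|xi|^2]. The prefactor is later
   moved out of the power and into the time. *)
pose B k xi := 2 * N / d k ^+ 2 * (1 - r k * z k xi).
have rz k xi : 0 <= 1 - r k * z k xi.
  have /andP[r0 r1] := r01 k.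
  rewrite subr_ge0 (le_trans (ler_norm _))// normrM mulr_ile1//.
  by rewrite ger0_norm// ltW.
have c0 k : 0 <= 2 * N / d k ^+ 2 by rewrite divr_ge0 ?mulr_ge0 ?exprn_ge0 ?ltW.
have B0 k xi : 0 <= B k xi by exact: mulr_ge0.
apply: (@multp_lim _ _ _ e0 (fun k xi => expR (- (t * powR (B k xi) al))) _ 1).
- move=> k.
  have E xi : expR (- (t * powR (B k xi) al)) = expR (- (t * powR (2 * N / d k ^+ 2) al * powR (1 - r k * z k xi) al)).
    by rewrite /B powRM// mulrA.
  under eq_fun do rewrite E.
  by apply: multp_exp_powR => //; rewrite mulr_ge0 ?powR_ge0// ltW.
- by move=> k xi; rewrite ger0_norm ?expR_ge0// -expR0 ler_expR oppr_le0 mulr_ge0 ?powR_ge0// ltW.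
- move=> xi; rewrite symb_tdotE.
  apply: (cvg_comp (fun k => - (t * powR (B k xi) al)) expR); last exact: continuous_expR.
  apply: cvgN; apply: cvgMr; apply: powR_cvg_ge0 => //.
  (* The last term is the error due to [r k], because [(1 - r k) / d k ^+ 2 = d k]. *)
  have BE k : B k xi = \sum_(i < n.+1) (2 * (1 - cos (d k * tnth xi i)) / d k ^+ 2) + 2 * N * (d k * z k xi).
    have -> : \sum_(i < n.+1) (2 * (1 - cos (d k * tnth xi i)) / d k ^+ 2) = 2 * N / d k ^+ 2 * (1 - z k xi).
      rewrite -mulr_suml -mulr_sumr big_split/= sumr_const card_ord sumrN -/N.
      by rewrite /z; field; rewrite !gt_eqF.
    by rewrite /B /r; field; rewrite gt_eqF.
  under eq_fun do rewrite BE.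
  rewrite -[tdot xi xi]addr0; apply: cvgD.
    apply: cvg_big; first exact: add_continuous.
    by move=> i _; rewrite -expr2; exact: cos_quotient_cvg.
  rewrite -(mulr0 (2 * N)); apply: cvgMr.
  apply: (@squeeze_cvgr _ _ _ _ (fun k => - d k) d).
  + by apply: nearW => k; rewrite -ler_norml normrM gtr0_norm// ler_piMr// ltW//.
  + by rewrite -oppr0; apply: cvgN; exact: cvg_harmonic.
  + exact: cvg_harmonic.
Qed.

Lemma laplace_harmonic_cvg (x : R) : laplace (harmonic k) x @[k --> \oo] --> (1 : R).
Proof.
rewrite -expR0.
apply: (cvg_comp (fun k => - (harmonic k * `|x|)) expR); last exact: continuous_expR.
by rewrite -oppr0; apply: cvgN; rewrite -(mul0r `|x|); apply: cvgMl; exact: cvg_harmonic.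
Qed.

Lemma tprod_laplace_harmonic_cvg m (y : m.-tuple R) :
  tprod (laplace (harmonic k)) y @[k --> \oo] --> (1 : R).
Proof.
rewrite /tprod.
suff : \prod_(i < m) laplace (harmonic k) (tnth y i) @[k --> \oo] -->
  \prod_(i < m) (1 : R) by rewrite big1_eq.
apply: cvg_big; first exact: mul_continuous.
by move=> i _; exact: laplace_harmonic_cvg.
Qed.

Lemma tprod_laplace_le1 m (e : R) (y : m.-tuple R) : 0 <= e -> tprod (laplace e) y <= 1.
Proof.
move=> e0; apply: prodr_ile1 => i _; rewrite laplace_ge0/=.
by rewrite /laplace -expR0 ler_expR oppr_le0 mulr_ge0.
Qed.

Lemma nondecreasing_tprod_laplace m (y : m.-tuple R) :
  {homo (fun k => tprod (laplace (@harmonic R k)) y) : i j / (i <= j)%N >-> i <= j}.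
Proof.
move=> i j ij; apply: ler_prod => l _; rewrite laplace_ge0/= /laplace ler_expR lerN2.
by rewrite ler_wpM2r// /harmonic/= lef_pV2 ?posrE ?ltr0n// ler_nat.
Qed.

(** The multiplier [symb] acts on the constant 1, and the weight is then removed by dominated
    convergence, [symb] itself being the majorant. *)
Lemma Gamma_theta_ge0 n theta t (x : n.+1.-tuple R) : 0 < theta <= 2 -> 0 < t ->
  0 <= Gamma_theta theta x t.
Proof.
move=> th t0; have /andP[th0 _] := th.
rewrite Gamma_thetaE//; apply: mulr_ge0.
  by rewrite invr_ge0 exprn_ge0// mulr_ge0// pi_ge0.
pose f k xi : R := cos (tdot x xi) * (symb theta t xi * tprod (laplace (harmonic k)) xi).
apply: (@cvgr_to_ge _ \oo _ _ (fun k => \int[lam n.+1]_xi f k xi)); last first.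
  apply: nearW => k; have h0 := @harmonic_gt0 R k.
  have [_ /(_ (fun=> 1) (bdm_cst _ 1) (posdef1 h0) x)] := multp_symb n h0 th t0.
  by congr (_ <= _); apply: eq_Rintegral => xi _; rewrite mulr1.
apply: (Rintegral_dominated_cvg _ _ (integrable_symb n.+1 th0 t0)).
- move=> k; apply: measurable_funM; first exact: measurable_cos_tdot.
  apply: measurable_funM; first exact: measurable_symb.
  by apply: measurable_tprod; exact: measurable_laplace.
- move=> xi.
  suff : f ^~ xi @ \oo --> cos (tdot x xi) * (symb theta t xi * 1) by rewrite mulr1.
  by apply: cvgMr; apply: cvgMr; exact: tprod_laplace_harmonic_cvg.
- move=> k xi; have h0 := @harmonic_gt0 R k.
  rewrite /f normrM -[leRHS]mul1r ler_pM ?cos_abs_le1// normrM (ger0_norm (symb_ge0 _ _ _)) ler_piMr ?symb_ge0//.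
  by rewrite ger0_norm ?tprod_laplace_ge0// tprod_laplace_le1// ltW.
Qed.

End positivity.

(** * Mass and Chapman-Kolmogorov inequality *)

Section kernel.
Variable R : realType.
Local Notation lam n := (lebN R n).
Variables (theta : R).
Hypothesis th0 : 0 < theta.
Implicit Types (t e : R).

Lemma tnth_tsub n (x y : n.-tuple R) i : tnth (tsub x y) i = tnth x i - tnth y i.
Proof. by rewrite tnth_mktuple. Qed.

Lemma tdotC n (x y : n.-tuple R) : tdot x y = tdot y x.
Proof. by apply: eq_bigr => i _; rewrite mulrC. Qed.

Lemma tdot_tsubl n (x y z : n.-tuple R) : tdot (tsub x y) z = tdot x z - tdot y z.
Proof.
by rewrite /tdot -sumrB; apply: eq_bigr => i _; rewrite tnth_tsub mulrBl.
Qed.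

Definition tscale n (s : R) (x : n.-tuple R) : n.-tuple R := [tuple s * tnth x i | i < n].

Lemma tdot_tscalel n s (x z : n.-tuple R) : tdot (tscale s x) z = s * tdot x z.
Proof.
by rewrite /tdot mulr_sumr; apply: eq_bigr => i _; rewrite tnth_mktuple mulrA.
Qed.

Lemma tdot_affNr n (z c x : n.-tuple R) e : tdot z (affN c e x) = tdot z c + e * tdot z x.
Proof.
rewrite /tdot mulr_sumr -big_split/=; apply: eq_bigr => i _.
by rewrite tnth_mktuple; ring.
Qed.

Lemma measurable_tsub d (T : measurableType d) n (f g : T -> n.-tuple R) :
  measurable_fun setT f -> measurable_fun setT g ->
  measurable_fun setT (fun x => tsub (f x) (g x)).
Proof.
move=> mf mg; apply/measurable_fun_tnthP => i.
rewrite (_ : _ \o _ = (fun x => tnth (f x) i - tnth (g x) i)); last first.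
  by apply/funext => x /=; rewrite tnth_tsub.
apply: measurable_funB; apply: (@measurableT_comp _ _ _ _ _ _ (fun x => tnth x i)) => //;
  exact: measurable_tnth.
Qed.

Lemma measurable_cos_fun d (T : measurableType d) (f : T -> R) :
  measurable_fun setT f -> measurable_fun setT (fun x => cos (f x)).
Proof. by move=> mf; exact: (measurableT_comp (@measurable_cos R) mf). Qed.

Lemma Gamma_fubini n t (v : n.-tuple R -> n.-tuple R) (h q : n.-tuple R -> R) :
  0 < t -> measurable_fun setT v -> measurable_fun setT h ->
  (lam n).-integrable setT (EFin \o q) -> (forall y, `|h y| <= q y) ->
  \int[lam n]_y (Gamma_theta theta (v y) t * h y) =
  ((2 * pi) ^+ n)^-1 * \int[lam n]_xi (symb theta t xi * \int[lam n]_y (cos (tdot (v y) xi) * h y)).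
Proof.
move=> t0 mv mh iq hq.
have iS := integrable_symb n th0 t0.
pose g y xi := cos (tdot (v y) xi) * symb theta t xi * h y.
have mg : measurable_fun setT (fun z => g z.1 z.2).
  apply: measurable_funM; last exact: (measurableT_comp mh).
  apply: measurable_funM; last exact: measurable_symb.
  apply: measurable_cos_fun; apply: measurable_tdot => //.
  exact: (measurableT_comp mv).
have gq y xi : `|g y xi| <= q y * symb theta t xi.
  rewrite /g mulrC normrM ler_pM// normrM (ger0_norm (symb_ge0 _ _ _)).
  by rewrite ler_piMl ?symb_ge0// cos_abs_le1.
have ig1 := slice_integrable1 iS mg gq.
have ig2 := slice_integrable2 iq mg gq.
have E y : Gamma_theta theta (v y) t * h y = ((2 * pi) ^+ n)^-1 * \int[lam n]_xi g y xi.
  rewrite Gamma_thetaE// -mulrA -RintegralZr//.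
  apply: (integrable_bounded_mul (C := 1) iS).
    by apply: measurable_cos_fun; exact: measurable_tdot.
  by move=> xi; exact: cos_abs_le1.
under eq_Rintegral do rewrite E.
rewrite RintegralZl//; last first.
  apply: (@le_integrable _ _ _ _ _ measurableT _ (fun y => (q y * \int[lam n]_xi symb theta t xi)%:E)).
  - by apply/measurable_EFinP; exact: measurable_Rintegral_param mg.
  - move=> y _ /=; rewrite lee_fin (le_trans (le_normr_Rintegral measurableT (ig1 y)))//.
    rewrite -RintegralZl//; apply: le_trans (ler_norm _).
    apply: le_Rintegral => //.
    + exact: integrable_norm (ig1 y).
    + exact: (integrableZl measurableT (q y) iS).
  - by have := integrableZr measurableT (\int[lam n]_xi symb theta t xi) iq.
congr (_ * _); rewrite (Rfubini_bound iq iS mg gq).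
apply: eq_Rintegral => xi _; rewrite -RintegralZl//.
  by apply: eq_Rintegral => y _; rewrite /g; ring.
apply: (@le_integrable _ _ _ _ _ measurableT _ (EFin \o q)) => //.
- apply/measurable_EFinP; apply: measurable_funM => //.
  by apply: measurable_cos_fun; exact: measurable_tdot.
- move=> y _ /=; rewrite lee_fin normrM (le_trans _ (ler_norm _))//.
  by rewrite (le_trans _ (hq y))// ler_piMl// cos_abs_le1.
Qed.

Lemma Rintegral_tprod_cauchyk n (e : R) : 0 < e ->
  \int[lam n]_x tprod (cauchyk e) x = (2 * pi) ^+ n.
Proof.
move=> e0; rewrite {1}/Rintegral integral_tprod.
- by rewrite /= /Rintegral integral_cauchyk.
- by move=> x; exact: cauchyk_ge0.
- exact: measurable_cauchyk.
- exact: fin_integral_cauchyk.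
Qed.

Lemma Rintegral_tprod_laplace_cosN n (e : R) (a : n.-tuple R) psi : 0 < e ->
  \int[lam n]_y (cos (psi - tdot a y) * tprod (laplace e) y) =
  cos psi * tprod (cauchyk e) a.
Proof.
move=> e0; rewrite -cosN -Rintegral_tprod_laplace_cos//.
by apply: eq_Rintegral => y _; rewrite -cosN opprB addrC.
Qed.

(** On the Fourier side the weight becomes a Cauchy kernel of mass [(2 * pi) ^+ n], multiplied by
    factors of modulus at most one; the mass cancels the normalisation and no Fourier inversion is
    needed. *)
Lemma Gamma_laplace_le1 n t x (e : R) : 0 < e -> 0 < t ->
  \int[lam n]_y (Gamma_theta theta (tsub x y) t * tprod (laplace e) y) <= 1.
Proof.
move=> e0 t0.
have iL := integrable_tprod_laplace n e0.
have iC := integrable_tprod_cauchyk n e0.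
have p0 : 0 < (2 * pi) ^+ n :> R by rewrite exprn_gt0// mulr_gt0// pi_gt0.
rewrite (Gamma_fubini (q := @tprod R (laplace e) n))//; last 3 first.
- by apply: measurable_tsub.
- by apply: measurable_tprod; exact: measurable_laplace.
- by move=> y; rewrite ger0_norm// tprod_laplace_ge0.
rewrite ler_pdivrMl// mulr1 -(Rintegral_tprod_cauchyk n e0).
have E xi : symb theta t xi * \int[lam n]_y (cos (tdot (tsub x y) xi) * tprod (laplace e) y) =
  (symb theta t xi * cos (tdot x xi)) * tprod (cauchyk e) xi.
  rewrite -mulrA -Rintegral_tprod_laplace_cosN//; congr (_ * _).
  by apply: eq_Rintegral => y _; rewrite tdot_tsubl (tdotC y).
have b1 xi : `|symb theta t xi * cos (tdot x xi)| <= 1.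
  by rewrite normrM mulr_ile1 ?cos_abs_le1// ger0_norm ?symb_ge0// symb_le1// ltW.
under eq_Rintegral do rewrite E.
apply: le_Rintegral => //.
- apply: (integrable_bounded_mul (C := 1) iC) => //.
  apply: measurable_funM; first exact: measurable_symb.
  by apply: measurable_cos_fun; exact: measurable_tdot.
- move=> xi _; rewrite ler_piMl ?tprod_cauchyk_ge0//.
  by rewrite (le_trans (ler_norm _)).
Qed.

End kernel.

(** * The regularised Chapman-Kolmogorov integral *)

Section chapman_kolmogorov.
Variable R : realType.
Local Notation lam n := (lebN R n).
Variables (theta : R).
Hypothesis th0 : 0 < theta.
Implicit Types (t e : R).

(** The time cut-off is moved under the integral sign as a factor, which reduces joint measurability
    to that of a parametrised integral. *)
Lemma measurable_Gamma_theta d (T : measurableType d) n (v : T -> n.-tuple R) (t : T -> R) :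
  measurable_fun setT v -> measurable_fun setT t ->
  measurable_fun setT (fun z => (if 0 < t z then Gamma_theta theta (v z) (t z) else 0)).
Proof.
move=> mv mt.
have E z : (if 0 < t z then Gamma_theta theta (v z) (t z) else 0) =
  ((2 * pi) ^+ n)^-1 * \int[lam n]_xi
   (cos (tdot (v z) xi) * ((if 0 < t z then 1 else 0) * symb theta (t z) xi)).
  case: ifPn => tz.
    by rewrite Gamma_thetaE//; congr (_ * _); apply: eq_Rintegral => xi _; rewrite mul1r.
  under eq_Rintegral do rewrite mul0r mulr0.
  by rewrite Rintegral_cst// mul0r mulr0.
under eq_fun do rewrite E.
apply: measurable_funM => //; apply: measurable_Rintegral_param.
apply: measurable_funM.
  apply: measurable_cos_fun; apply: measurable_tdot => //.
  exact: (measurableT_comp mv).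
apply: measurable_funM; last by apply: measurable_symb => //; exact: (measurableT_comp mt).
apply: measurable_fun_ifT => //.
apply: measurable_fun_ltr => //.
exact: (measurableT_comp mt).
Qed.

Lemma measurable_Gamma_theta_fixed d (T : measurableType d) n (v : T -> n.-tuple R) t :
  0 < t -> measurable_fun setT v ->
  measurable_fun setT (fun z => Gamma_theta theta (v z) t).
Proof.
move=> t0 mv; have := @measurable_Gamma_theta _ _ n v (fun=> t) mv.
by rewrite t0; exact.
Qed.

Lemma Gamma_theta_bound n t : 0 < t ->
  exists2 B, 0 <= B & forall x : n.-tuple R, `|Gamma_theta theta x t| <= B.
Proof.
move=> t0; have iS := integrable_symb n th0 t0.
have p0 : 0 < (2 * pi) ^+ n :> R by rewrite exprn_gt0// mulr_gt0// pi_gt0.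
exists (((2 * pi) ^+ n)^-1 * \int[lam n]_xi symb theta t xi) => [|x].
  rewrite mulr_ge0 ?invr_ge0 ?(ltW p0)//.
  by apply: Rintegral_ge0 => xi _; exact: symb_ge0.
rewrite Gamma_thetaE// normrM ger0_norm ?invr_ge0 ?(ltW p0)// ler_wpM2l ?invr_ge0 ?(ltW p0)//.
have iC : (lam n).-integrable setT (EFin \o (fun xi => cos (tdot x xi) * symb theta t xi)).
  apply: (integrable_bounded_mul (C := 1) iS).
    by apply: measurable_cos_fun; exact: measurable_tdot.
  by move=> xi; exact: cos_abs_le1.
rewrite (le_trans (le_normr_Rintegral measurableT iC))//.
apply: le_Rintegral => //; first exact: integrable_norm iC.
move=> xi _; rewrite normrM (ger0_norm (symb_ge0 _ _ _)) ler_piMl ?symb_ge0//.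
exact: cos_abs_le1.
Qed.

(** The symbol at time [b], with a phase, integrated against a Cauchy kernel of width [e] centred at
    [s * xi], after the substitution [eta = s * xi + e * zeta]. The substitution freezes the kernel,
    so [e] can tend to 0 under a fixed majorant. The values [s = 1] and [s = -1] come from a product
    of two cosines. *)
Definition ckint n (b e : R) (x z xi : n.-tuple R) (s : R) : R :=
  \int[lam n]_zeta (symb theta b (affN (tscale s xi) e zeta) *
    cos (tdot x xi - s * tdot z (affN (tscale s xi) e zeta)) * tprod (cauchyk 1) zeta).

Lemma measurable_affN2 d (T : measurableType d) n s e (f g : T -> n.-tuple R) :
  measurable_fun setT f -> measurable_fun setT g ->
  measurable_fun setT (fun z => affN (tscale s (f z)) e (g z)).
Proof.
move=> mf mg; apply/measurable_fun_tnthP => i.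
rewrite (_ : _ \o _ = (fun x => s * tnth (f x) i + e * tnth (g x) i)); last first.
  by apply/funext => x /=; rewrite !tnth_mktuple.
by apply: measurable_funD; apply: measurable_funM => //;
  apply: (@measurableT_comp _ _ _ _ _ _ (fun x => tnth x i)) => //; exact: measurable_tnth.
Qed.

Let ckg n b e (x z : n.-tuple R) s (xi zeta : n.-tuple R) : R :=
  symb theta b (affN (tscale s xi) e zeta) *
    cos (tdot x xi - s * tdot z (affN (tscale s xi) e zeta)) * tprod (cauchyk 1) zeta.

Let measurable_ckg n b e (x z : n.-tuple R) s :
  measurable_fun setT (fun p => ckg b e x z s p.1 p.2).
Proof.
apply: measurable_funM; last first.
  by apply: (measurableT_comp (@measurable_tprod R (cauchyk 1) n (measurable_cauchyk ltr01))).
have ma := @measurable_affN2 _ (n.-tuple R * n.-tuple R)%type n s e fst snd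
  measurable_fst measurable_snd.
apply: measurable_funM; first exact: measurable_symb.
apply: measurable_cos_fun; apply: measurable_funB; first exact: measurable_tdot.
by apply: measurable_funM => //; exact: measurable_tdot.
Qed.

Let ckg_bound n b e (x z : n.-tuple R) s xi zeta : 0 < b ->
  `|ckg b e x z s xi zeta| <= 1 * tprod (cauchyk 1) zeta.
Proof.
move=> b0; rewrite /ckg normrM (ger0_norm (tprod_cauchyk_ge0 _ ltr01)) ler_wpM2r ?tprod_cauchyk_ge0//.
by rewrite normrM mulr_ile1 ?cos_abs_le1// ger0_norm ?symb_ge0// symb_le1// ltW.
Qed.

Lemma tprod_cauchyk_affN n e (c zeta : n.-tuple R) : 0 < e ->
  e ^+ n * tprod (cauchyk e) (tsub (affN c e zeta) c) = tprod (cauchyk 1) zeta.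
Proof.
move=> e0; rewrite /tprod -[X in e ^+ X]card_ord -prodr_const -big_split/=.
apply: eq_bigr => i _; rewrite !tnth_mktuple addrAC subrr add0r /cauchyk expr1n.
move: (tnth zeta i) => w.
have h1 : 1 + w ^+ 2 != 0 by rewrite gt_eqF// ltr_wpDr ?sqr_ge0.
have e1 : e != 0 by rewrite gt_eqF.
have -> : e ^+ 2 + (e * w) ^+ 2 = e ^+ 2 * (1 + w ^+ 2) by ring.
by field; rewrite h1 e1.
Qed.

(** The integrand in the original variable [eta]; [ckg] is the one in [zeta]. *)
Let ckG n b e (x z xi : n.-tuple R) s (eta : n.-tuple R) : R :=
  symb theta b eta * (cos (tdot x xi - s * tdot z eta) *
     tprod (cauchyk e) (tsub eta (tscale s xi))).

Let ckG_affN n b e (x z xi : n.-tuple R) s zeta : 0 < e ->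
  e ^+ n * ckG b e x z xi s (affN (tscale s xi) e zeta) = ckg b e x z s xi zeta.
Proof.
by move=> e0; rewrite /ckg -(tprod_cauchyk_affN (tscale s xi) _ e0) /ckG; ring.
Qed.

(** Integrability is transported back from the variable [zeta], where [tprod (cauchyk 1)] is a
    majorant. *)
Lemma integrable_ckG n b e (x z xi : n.-tuple R) s : 0 < b -> 0 < e ->
  (lam n).-integrable setT (EFin \o (fun eta => symb theta b eta *
    (cos (tdot x xi - s * tdot z eta) * tprod (cauchyk e) (tsub eta (tscale s xi))))).
Proof.
move=> b0 e0; pose G := ckG b e x z xi s.
have mG : measurable_fun setT G.
  apply: measurable_funM; first exact: measurable_symb.
  apply: measurable_funM.
    apply: measurable_cos_fun; apply: measurable_funB => //.
    by apply: measurable_funM => //; exact: measurable_tdot.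
  apply: (measurableT_comp (@measurable_tprod R (cauchyk e) n (measurable_cauchyk e0))).
  exact: measurable_tsub.
have en0 : 0 < e ^+ n by exact: exprn_gt0.
have iG' : (lam n).-integrable setT (EFin \o (fun zeta => G (affN (tscale s xi) e zeta))).
  have iK := integrable_tprod_cauchyk n (@ltr01 R).
  have := integrableZl measurableT (e ^+ n)^-1 iK; apply: le_integrable => //.
    apply/measurable_EFinP; apply: (measurableT_comp mG); exact: measurable_affN.
  move=> zeta _.
  have h : `|G (affN (tscale s xi) e zeta)| <= (e ^+ n)^-1 * tprod (cauchyk 1) zeta.
    have -> : G (affN (tscale s xi) e zeta) = (e ^+ n)^-1 * ckg b e x z s xi zeta.
      by rewrite -ckG_affN// mulKf// gt_eqF.
    rewrite normrM ger0_norm ?invr_ge0 ?(ltW en0)// ler_wpM2l ?invr_ge0 ?(ltW en0)//.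
    by rewrite (le_trans (ckg_bound _ _ _ _ _ _ b0))// mul1r.
  by rewrite lee_fin (le_trans h)// ler_norm.
apply/integrableP; split; first exact/measurable_EFinP.
have mabs : measurable_fun setT (fun eta => `|(G eta)%:E|%E).
  by apply: measurableT_comp => //; exact/measurable_EFinP.
have := @ge0_integral_affN R n (tscale s xi) e (fun eta => `|(G eta)%:E|%E) e0 mabs (fun=> abse_ge0 _).
move/integrableP : iG' => [_ fin] H; move: fin; rewrite /= in H *; rewrite H.
move=> fin; rewrite ltey; apply/negP => /eqP EE; move: fin; rewrite EE.
by rewrite gt0_muley ?ltxx// lte_fin invr_gt0.
Qed.

Lemma ckintE n b e (x z xi : n.-tuple R) s : 0 < b -> 0 < e ->
  \int[lam n]_eta (symb theta b eta * (cos (tdot x xi - s * tdot z eta) *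
     tprod (cauchyk e) (tsub eta (tscale s xi)))) = ckint b e x z xi s.
Proof.
move=> b0 e0; have iG := integrable_ckG x z xi s b0 e0.
have iG' : (lam n).-integrable setT (EFin \o ckg b e x z s xi).
  have iK := integrable_tprod_cauchyk n (@ltr01 R).
  apply: le_integrable iK => //.
    by apply/measurable_EFinP; exact: (measurableT_comp (measurable_ckg b e x z s) (@measurable_pair1 _ _ _ _ xi)).
  move=> zeta _ /=; rewrite lee_fin (le_trans (ckg_bound _ _ _ _ _ _ b0))// mul1r.
  exact: ler_norm.
have en0 : 0 < e ^+ n by exact: exprn_gt0.
rewrite (integral_affN (tscale s xi) e0 iG).
have E zeta : ckG b e x z xi s (affN (tscale s xi) e zeta) = (e ^+ n)^-1 * ckg b e x z s xi zeta.
  by rewrite -ckG_affN// mulKf// gt_eqF.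
rewrite -[X in _ * X]/(\int[lam n]_zeta ckG b e x z xi s (affN (tscale s xi) e zeta)).
under eq_Rintegral do rewrite E.
by rewrite RintegralZl// mulVKf// gt_eqF.
Qed.

Lemma tnorm_tscale n s (xi : n.-tuple R) : s ^+ 2 = 1 -> tnorm (tscale s xi) = tnorm xi.
Proof.
by move=> s1; rewrite /tnorm tdot_tscalel tdotC tdot_tscalel mulrA -expr2 s1 mul1r.
Qed.

(** The Cauchy kernel concentrates at [eta = s * xi]. As [s ^+ 2 = 1], neither the norm of [s * xi]
    nor the phase [s * tdot z (s * xi)] depends on the sign, so both signs have the same limit. *)
Lemma ckint_cvg n b (x z xi : n.-tuple R) s : 0 < b -> s ^+ 2 = 1 ->
  ckint b (harmonic k) x z xi s @[k --> \oo] -->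
  (2 * pi) ^+ n * (symb theta b xi * cos (tdot (tsub x z) xi)).
Proof.
move=> b0 s1.
have iK := integrable_tprod_cauchyk n (@ltr01 R).
have -> : (2 * pi) ^+ n * (symb theta b xi * cos (tdot (tsub x z) xi)) =
  \int[lam n]_zeta (symb theta b xi * cos (tdot (tsub x z) xi) * tprod (cauchyk 1) zeta).
  by rewrite RintegralZl// Rintegral_tprod_cauchyk// mulrC.
apply: (Rintegral_dominated_cvg _ _ iK).
- move=> k; exact: (measurableT_comp (measurable_ckg b (harmonic k) x z s) (@measurable_pair1 _ _ _ _ xi)).
- move=> zeta; apply: cvgMl; apply: cvgM.
    rewrite [X in _ --> X](_ : _ = expR (- (b * powR (tdot (tscale s xi) (tscale s xi) + 0 + 0) (theta / 2)))); last first.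
      rewrite !addr0 -symb_tdotE /symb tnorm_tscale//.
    under eq_fun do rewrite symb_tdotE.
    apply: (cvg_comp (fun k => - (b * powR (tdot (affN (tscale s xi) (harmonic k) zeta) (affN (tscale s xi) (harmonic k) zeta)) (theta / 2))) expR); last exact: continuous_expR.
    apply: cvgN; apply: cvgMr; apply: powR_cvg_ge0; first by rewrite divr_gt0.
      by move=> k; apply: sumr_ge0 => i _; rewrite -expr2 sqr_ge0.
    have E k : tdot (affN (tscale s xi) (harmonic k) zeta) (affN (tscale s xi) (harmonic k) zeta) =
      tdot (tscale s xi) (tscale s xi) + harmonic k * (2 * tdot (tscale s xi) zeta)
       + harmonic k * (harmonic k * tdot zeta zeta).
      by rewrite tdot_affNr !(tdotC (affN _ _ _)) !tdot_affNr (tdotC zeta (tscale _ _)); ring.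
    under eq_fun do rewrite E.
    apply: cvgD.
      apply: cvgD; first exact: cvg_cst.
      by rewrite -(mul0r (2 * tdot (tscale s xi) zeta)); apply: cvgMl; exact: cvg_harmonic.
    rewrite -(mul0r (0 * tdot zeta zeta)); apply: cvgM; first exact: cvg_harmonic.
    by apply: cvgMl; exact: cvg_harmonic.
  apply: (cvg_comp (fun k => tdot x xi - s * tdot z (affN (tscale s xi) (harmonic k) zeta)) cos); last exact: continuous_cos.
  have E k : tdot x xi - s * tdot z (affN (tscale s xi) (harmonic k) zeta) =
     tdot (tsub x z) xi + harmonic k * (- s * tdot z zeta).
    rewrite tdot_affNr (tdotC z (tscale _ _)) tdot_tscalel tdot_tsubl (tdotC xi).
    by rewrite mulrDr mulrA -expr2 s1; ring.
  have h : tdot (tsub x z) xi + harmonic k * (- s * tdot z zeta) @[k --> \oo] -->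
      tdot (tsub x z) xi + 0 * (- s * tdot z zeta).
    by apply: cvgD; [exact: cvg_cst|apply: cvgMl; exact: cvg_harmonic].
  by rewrite mul0r addr0 in h; under eq_fun do rewrite E.
- by move=> k zeta; rewrite -[leRHS]mul1r; exact: ckg_bound.
Qed.

Lemma norm_ckint_le n b e (x z xi : n.-tuple R) s : 0 < b ->
  `|ckint b e x z xi s| <= (2 * pi) ^+ n.
Proof.
move=> b0; have iK := integrable_tprod_cauchyk n (@ltr01 R).
have ic : (lam n).-integrable setT (EFin \o ckg b e x z s xi).
  apply: le_integrable iK => //.
    by apply/measurable_EFinP; exact: (measurableT_comp (measurable_ckg b e x z s) (@measurable_pair1 _ _ _ _ xi)).
  move=> zeta _ /=; rewrite lee_fin (le_trans (ckg_bound _ _ _ _ _ _ b0))// mul1r.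
  exact: ler_norm.
rewrite (le_trans (le_normr_Rintegral measurableT ic))// -(Rintegral_tprod_cauchyk n (@ltr01 R)).
apply: le_Rintegral => //; first exact: integrable_norm ic.
by move=> zeta _; rewrite -[leRHS]mul1r; exact: ckg_bound.
Qed.

Lemma measurable_ckint n b e (x z : n.-tuple R) s :
  measurable_fun setT (fun xi => ckint b e x z xi s).
Proof.
by have := @measurable_Rintegral_param _ _ _ _ _ (lam n) _ (measurable_ckg b e x z s).
Qed.

(** [Gamma_fubini] opens the two kernels one after the other. The product of their cosines splits
    into two cosines, and integrating each against the weight in [y] yields a Cauchy kernel centred
    at [xi] or at [- xi]. *)
Lemma Gamma_ck_laplace n a b e (x z : n.-tuple R) : 0 < a -> 0 < b -> 0 < e ->
  \int[lam n]_y (Gamma_theta theta (tsub x y) a *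
     (Gamma_theta theta (tsub y z) b * tprod (laplace e) y)) =
  ((2 * pi) ^+ n)^-1 * \int[lam n]_xi (symb theta a xi *
     (((2 * pi) ^+ n)^-1 * (2^-1 * (ckint b e x z xi 1 + ckint b e x z xi (- 1))))).
Proof.
move=> a0 b0 e0.
have iL := integrable_tprod_laplace n e0.
have mL : measurable_fun setT (@tprod R (laplace e) n).
  by apply: measurable_tprod; exact: measurable_laplace.
have [B B0 hB] := Gamma_theta_bound n b0.
rewrite (Gamma_fubini th0 (q := fun y => B * tprod (laplace e) y) a0); last 4 first.
- exact: measurable_tsub.
- apply: measurable_funM => //; apply: measurable_Gamma_theta_fixed => //.
  exact: measurable_tsub.
- exact: (integrableZl measurableT B iL).
- by move=> y; rewrite normrM ler_pM// ger0_norm// tprod_laplace_ge0.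
congr (_ * _); apply: eq_Rintegral => xi _; congr (_ * _).
have E1 y : cos (tdot (tsub x y) xi) * (Gamma_theta theta (tsub y z) b * tprod (laplace e) y) =
  Gamma_theta theta (tsub y z) b * (cos (tdot (tsub x y) xi) * tprod (laplace e) y) by ring.
under eq_Rintegral do rewrite E1.
rewrite (Gamma_fubini th0 (q := @tprod R (laplace e) n) b0)//; last 3 first.
- exact: measurable_tsub.
- apply: measurable_funM => //; apply: measurable_cos_fun; apply: measurable_tdot => //.
  exact: measurable_tsub.
- move=> y; rewrite normrM (ger0_norm (tprod_laplace_ge0 _ _)) ler_piMl ?cos_abs_le1//.
  exact: tprod_laplace_ge0.
congr (_ * _).
have i1 := integrable_ckG x z xi 1 b0 e0.
have i2 := integrable_ckG x z xi (- 1) b0 e0.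
rewrite -!ckintE// -RintegralD// -RintegralZl//; last exact: (integrableD measurableT i1 i2).
apply: eq_Rintegral => eta _.
rewrite -mulrDr mulrCA; congr (_ * _).
rewrite -[X in _ = 2^-1 * (X + _)]Rintegral_tprod_laplace_cos//.
rewrite -Rintegral_tprod_laplace_cosN//.
have iC (psi : n.-tuple R -> R) : measurable_fun setT psi -> (lam n).-integrable setT
    (EFin \o (fun y => cos (psi y) * tprod (laplace e) y)).
  move=> mpsi; apply: (integrable_bounded_mul (C := 1) iL).
    exact: measurable_cos_fun.
  by move=> y; exact: cos_abs_le1.
have i3 := iC (fun y => tdot x xi - 1 * tdot z eta + tdot (tsub eta (tscale 1 xi)) y).
have i4 := iC (fun y => tdot x xi - -1 * tdot z eta - tdot (tsub eta (tscale (-1) xi)) y).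
have {}i3 : (lam n).-integrable setT (EFin \o (fun y => cos (tdot x xi - 1 * tdot z eta + tdot (tsub eta (tscale 1 xi)) y) * tprod (laplace e) y)).
  by apply: i3; apply: measurable_funD => //; exact: measurable_tdot.
have {}i4 : (lam n).-integrable setT (EFin \o (fun y => cos (tdot x xi - -1 * tdot z eta - tdot (tsub eta (tscale (-1) xi)) y) * tprod (laplace e) y)).
  by apply: i4; apply: measurable_funB => //; exact: measurable_tdot.
rewrite -RintegralD// -RintegralZl//; last exact: (integrableD measurableT i3 i4).
apply: eq_Rintegral => y _.
rewrite !tdot_tsubl !tdot_tscalel !(tdotC y) !mul1r !mulN1r !opprK.
(* [A] and [D] are the phases of the two kernels; the identity left is [cos A * cos D = (cos (A + D)
   + cos (A - D)) / 2]. *)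
set A := tdot x xi - tdot xi y; set D := tdot eta y - tdot z eta.
have -> : tdot x xi - tdot z eta + (tdot eta y - tdot xi y) = A + D by rewrite /A /D; ring.
have -> : tdot x xi + tdot z eta - (tdot eta y + tdot xi y) = A - D by rewrite /A /D; ring.
by rewrite cosB cosD; field.
Qed.

End chapman_kolmogorov.

(** * Removal of the regularisation *)

Section submarkov.
Variable R : realType.
Local Notation lam n := (lebN R n).
Variables (n : nat) (theta : R).
Hypothesis th : 0 < theta <= 2.
Implicit Types (t e : R).

Let th0 : 0 < theta. Proof. by case/andP: th. Qed.

Local Notation X := (n.+1.-tuple R).

(** The weights increase to 1, so monotone convergence applies once the kernel is known to be
    nonnegative. *)
Lemma integral_Gamma_theta_le1 t (x : X) : 0 < t ->
  (\int[lam n.+1]_y (Gamma_theta theta (tsub x y) t)%:E <= 1)%E.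
Proof.
move=> t0.
have mG : measurable_fun setT (fun y : X => Gamma_theta theta (tsub x y) t).
  by apply: measurable_Gamma_theta_fixed => //; exact: measurable_tsub.
have mL k : measurable_fun setT (@tprod R (laplace (harmonic k)) n.+1).
  by apply: measurable_tprod; exact: measurable_laplace.
pose f k (y : X) : \bar R := (Gamma_theta theta (tsub x y) t * tprod (laplace (harmonic k)) y)%:E.
have f0 k y : (0 <= f k y)%E by rewrite lee_fin mulr_ge0 ?tprod_laplace_ge0// Gamma_theta_ge0.
have mf k : measurable_fun setT (f k) by apply/measurable_EFinP; exact: measurable_funM.
have fcvg y : f ^~ y @ \oo --> (Gamma_theta theta (tsub x y) t)%:E.
  rewrite /f -[X in X%:E]mulr1; apply: cvg_EFin; first exact: nearW.
  by apply: cvgMr; exact: tprod_laplace_harmonic_cvg.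
have -> : (\int[lam n.+1]_y (Gamma_theta theta (tsub x y) t)%:E =
   \int[lam n.+1]_y limn (f ^~ y))%E.
  by apply: eq_integral => y _; apply/esym/cvg_lim => //; exact: fcvg.
have ndf y : setT y -> {homo f ^~ y : i j / (i <= j)%N >-> (i <= j)%E}.
  move=> _ i j ij; rewrite lee_fin ler_wpM2l ?Gamma_theta_ge0//.
  exact: nondecreasing_tprod_laplace.
have cv := @cvg_monotone_convergence _ _ _ (lam n.+1) setT measurableT f mf (fun k y _ => f0 k y) ndf.
rewrite -(cvg_lim _ cv)//; apply: lime_le; first by apply/cvg_ex; eexists; exact: cv.
apply: nearW => k; have h0 := @harmonic_gt0 R k.
have [B B0 hB] := @Gamma_theta_bound R theta th0 n.+1 t t0.
have iF : (lam n.+1).-integrable setT (f k).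
  have := @integrable_bounded_mul R _ _ (lam n.+1) _ _ B (integrable_tprod_laplace n.+1 h0) mG.
  by apply=> y; exact: hB.
rewrite -(fineK (integrable_fin_num measurableT iF)) lee_fin.
exact: Gamma_laplace_le1.
Qed.

(** The weighted integrals [D k] stay below the right-hand side, since the weight is at most 1, and
    converge to the left-hand side on the Fourier side. *)
Lemma Gamma_theta_chapman_kolmogorov a b (x z : X) : 0 < a -> 0 < b ->
  ((Gamma_theta theta (tsub x z) (a + b))%:E <=
   \int[lam n.+1]_y (Gamma_theta theta (tsub x y) a * Gamma_theta theta (tsub y z) b)%:E)%E.
Proof.
move=> a0 b0.
set I := (X in (_ <= X)%E).
have I0 : (0 <= I)%E.
  by apply: integral_ge0 => y _; rewrite lee_fin mulr_ge0 ?Gamma_theta_ge0.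
have [Ifin|] := boolP (I \is a fin_num); last first.
  by rewrite ge0_fin_numE// -leNgt leye_eq => /eqP ->; rewrite leey.
rewrite -(fineK Ifin) lee_fin.
have mL e : measurable_fun setT (@tprod R (laplace e) n.+1).
  by apply: measurable_tprod; exact: measurable_laplace.
have mGa : measurable_fun setT (fun y : X => Gamma_theta theta (tsub x y) a).
  by apply: measurable_Gamma_theta_fixed => //; exact: measurable_tsub.
have mGb : measurable_fun setT (fun y : X => Gamma_theta theta (tsub y z) b).
  by apply: measurable_Gamma_theta_fixed => //; exact: measurable_tsub.
pose D k := \int[lam n.+1]_y (Gamma_theta theta (tsub x y) a *
     (Gamma_theta theta (tsub y z) b * tprod (laplace (harmonic k)) y)).
have p0 : 0 < (2 * pi) ^+ n.+1 :> R by rewrite exprn_gt0// mulr_gt0// pi_gt0.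
apply: (@cvgr_to_le _ \oo _ _ D); last first.
  apply: nearW => k; have h0 := @harmonic_gt0 R k.
  have g0 y : 0 <= Gamma_theta theta (tsub x y) a * Gamma_theta theta (tsub y z) b.
    by rewrite mulr_ge0 ?Gamma_theta_ge0.
  have DI : (\int[lam n.+1]_y (Gamma_theta theta (tsub x y) a *
     (Gamma_theta theta (tsub y z) b * tprod (laplace (harmonic k)) y))%:E <= I)%E.
    apply: ge0_le_integral => //.
    - by move=> y _; rewrite lee_fin mulrA mulr_ge0 ?tprod_laplace_ge0.
    - by apply/measurable_EFinP; apply: measurable_funM => //; exact: measurable_funM.
    - by apply/measurable_EFinP; exact: measurable_funM.
    - move=> y _; rewrite lee_fin mulrA ler_piMr//.
      by apply: tprod_laplace_le1; exact: ltW.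
  apply: fine_le => //; rewrite ge0_fin_numE; last first.
    by apply: integral_ge0 => y _; rewrite lee_fin mulrA mulr_ge0 ?tprod_laplace_ge0.
  by apply: le_lt_trans DI _; rewrite -ge0_fin_numE.
have E k : D k = ((2 * pi) ^+ n.+1)^-1 * \int[lam n.+1]_xi (symb theta a xi *
   (((2 * pi) ^+ n.+1)^-1 * (2^-1 * (ckint theta b (harmonic k) x z xi 1 + ckint theta b (harmonic k) x z xi (- 1))))).
  by rewrite /D Gamma_ck_laplace// harmonic_gt0.
rewrite (funext E) Gamma_thetaE//; last exact: addr_gt0.
apply: cvgMr.
apply: (Rintegral_dominated_cvg _ _ (integrable_symb n.+1 th0 a0)).
- move=> k; apply: measurable_funM; first exact: measurable_symb.
  by apply: measurable_funM => //; apply: measurable_funM => //; apply: measurable_funD; exact: measurable_ckint.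
- move=> xi.
  have -> : cos (tdot (tsub x z) xi) * symb theta (a + b) xi = symb theta a xi *
    (((2 * pi) ^+ n.+1)^-1 * (2^-1 * ((2 * pi) ^+ n.+1 * (symb theta b xi * cos (tdot (tsub x z) xi))
      + (2 * pi) ^+ n.+1 * (symb theta b xi * cos (tdot (tsub x z) xi))))).
    have -> : symb theta (a + b) xi = symb theta a xi * symb theta b xi.
      by rewrite /symb -expRD; congr expR; ring.
    by field; rewrite gt_eqF.
  apply: cvgMr; apply: cvgMr; apply: cvgMr; apply: cvgD; apply: ckint_cvg => //.
  by rewrite expr1n. by rewrite sqrrN expr1n.
- move=> k xi; rewrite normrM (ger0_norm (symb_ge0 _ _ _)) ler_piMr ?symb_ge0//.
  rewrite normrM ger0_norm ?invr_ge0 ?(ltW p0)// ler_pdivrMl// mulr1.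
  rewrite normrM ger0_norm// ler_pdivrMl// (le_trans (ler_normD _ _))//.
  have h1 := norm_ckint_le theta (harmonic k) x z xi 1 b0.
  have h2 := norm_ckint_le theta (harmonic k) x z xi (-1) b0.
  move: h1 h2; set P := (2 * pi) ^+ n.+1; lra.
Qed.

End submarkov.

(** * The supersolution inequality along the flow *)

Section duhamel.
Context d (X : measurableType d) (R : realType).
Variable m : {sigma_finite_measure set X -> \bar R}.
Local Notation leb := (@lebesgue_measure R).
Variable p : X -> X -> R -> R.
Hypothesis p_ge0 : forall x y t, 0 <= p x y t.
Hypothesis mp : measurable_fun setT (fun q : X * X * R => p q.1.1 q.1.2 q.2).
Hypothesis p_le1 : forall x t, (\int[m]_y (p x y t)%:E <= 1)%E.
Hypothesis p_ck : forall x z a b, 0 < a -> 0 < b ->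
  ((p x z (a + b))%:E <= \int[m]_y (p x y a * p y z b)%:E)%E.

Lemma measurable_kernel_comp d' (Z : measurableType d') (a b : Z -> X) (t : Z -> R) :
  measurable_fun setT a -> measurable_fun setT b -> measurable_fun setT t ->
  measurable_fun setT (fun z => p (a z) (b z) (t z)).
Proof.
move=> ma mb mt.
by have := measurableT_comp mp (measurable_fun_pair (measurable_fun_pair ma mb) mt).
Qed.

Lemma kernel_superaction x a b (h : X -> R) : 0 < a -> 0 < b ->
  measurable_fun setT h -> (forall z, 0 <= h z) ->
  (\int[m]_z (p x z (a + b) * h z)%:E <=
   \int[m]_y ((p x y a)%:E * \int[m]_z (p y z b * h z)%:E))%E.
Proof.
move=> a0 b0 mh h0.
have mpb y : measurable_fun setT (fun z => (p y z b * h z)%:E).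
  by apply/measurable_EFinP; apply: measurable_funM => //; exact: measurable_kernel_comp.
under [leRHS]eq_integral => y _.
  rewrite -ge0_integralZl//; last 2 first.
  - by move=> z _; rewrite lee_fin mulr_ge0.
  - by rewrite lee_fin.
  over.
have mF : measurable_fun setT (fun q : X * X => ((p x q.1 a)%:E * (p q.1 q.2 b * h q.2)%:E)%E).
  apply: emeasurable_funM; apply/measurable_EFinP; first exact: measurable_kernel_comp.
  by apply: measurable_funM; [exact: measurable_kernel_comp|exact: (measurableT_comp mh)].
have F0 (q : X * X) : (0 <= (p x q.1 a)%:E * (p q.1 q.2 b * h q.2)%:E)%E.
  by rewrite mule_ge0 ?lee_fin ?mulr_ge0.
rewrite [leRHS](@fubini_tonelli _ _ _ _ _ m m _ mF F0).
apply: ge0_le_integral => //.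
- by move=> z _; rewrite lee_fin mulr_ge0.
- by apply/measurable_EFinP; apply: measurable_funM => //; exact: measurable_kernel_comp.
- exact: (@measurable_fun_fubini_tonelli_G _ _ X X R m _ mF F0).
move=> z _ /=.
under [leRHS]eq_integral => y _ do rewrite -EFinM mulrA mulrC EFinM.
rewrite ge0_integralZl//; last 3 first.
- by apply/measurable_EFinP; apply: measurable_funM; exact: measurable_kernel_comp.
- by move=> y _; rewrite lee_fin mulr_ge0.
- by rewrite lee_fin.
by rewrite mulrC EFinM lee_wpmul2l ?lee_fin// p_ck.
Qed.

Variables (mu : X -> R) (psi v : X -> R -> R).
Hypothesis mmu : measurable_fun setT mu.
Hypothesis mu_ge0 : forall z, 0 <= mu z.
Hypothesis mpsi : measurable_fun setT (fun q : X * R => psi q.1 q.2).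
Hypothesis psi_ge0 : forall z r, 0 <= psi z r.

Definition linpart y s : \bar R := \int[m]_z (p y z s * mu z)%:E.
Definition source x t r : \bar R := \int[m]_z (p x z (t - r) * psi z r)%:E.
(** The time integral over the whole line is the usual one when [p] vanishes at nonpositive times
    and [psi] at nonpositive [r]. *)
Definition duhamel y s : \bar R := \int[leb]_r source y s r.

Lemma source_ge0 x t r : (0 <= source x t r)%E.
Proof. by apply: integral_ge0 => z _; rewrite lee_fin mulr_ge0. Qed.

Lemma linpart_ge0 y s : (0 <= linpart y s)%E.
Proof. by apply: integral_ge0 => z _; rewrite lee_fin mulr_ge0. Qed.

Lemma duhamel_ge0 y s : (0 <= duhamel y s)%E.
Proof. by apply: integral_ge0 => z _; exact: source_ge0. Qed.

Lemma measurable_psi d' (Z : measurableType d') (a : Z -> X) (r : Z -> R) :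
  measurable_fun setT a -> measurable_fun setT r ->
  measurable_fun setT (fun z => psi (a z) (r z)).
Proof.
move=> ma mr; by have := measurableT_comp mpsi (measurable_fun_pair ma mr).
Qed.

Lemma measurable_source x t : measurable_fun setT (source x t).
Proof.
have := @measurable_fun_fubini_tonelli_F _ _ (measurableTypeR R) X R m
  (fun q => (p x q.2 (t - q.1) * psi q.2 q.1)%:E).
apply=> [|q]; last by rewrite lee_fin mulr_ge0.
apply/measurable_EFinP; apply: measurable_funM.
  by apply: measurable_kernel_comp => //; exact: measurable_funB.
exact: measurable_psi.
Qed.

Lemma measurable_linpart d' (Z : measurableType d') (a : Z -> X) (s : Z -> R) :
  measurable_fun setT a -> measurable_fun setT s ->
  measurable_fun setT (fun z => linpart (a z) (s z)).
Proof.
move=> ma ms.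
have := @measurable_fun_fubini_tonelli_F _ _ Z X R m
  (fun q => (p (a q.1) q.2 (s q.1) * mu q.2)%:E).
apply=> [|q]; last by rewrite lee_fin mulr_ge0.
apply/measurable_EFinP; apply: measurable_funM.
  by apply: measurable_kernel_comp => //; exact: measurableT_comp.
exact: measurableT_comp.
Qed.

Lemma measurable_source2 (s : R) :
  measurable_fun setT (fun q : X * measurableTypeR R => source q.1 s q.2).
Proof.
have := @measurable_fun_fubini_tonelli_F _ _ (X * measurableTypeR R)%type X R m
  (fun q => (p q.1.1 q.2 (s - q.1.2) * psi q.2 q.1.2)%:E).
apply=> [|q]; last by rewrite lee_fin mulr_ge0.
have m1 : measurable_fun setT (fun q : (X * measurableTypeR R) * X => q.1.1) by exact: measurableT_comp.
have m2 : measurable_fun setT (fun q : (X * measurableTypeR R) * X => q.1.2 : R) by exact: measurableT_comp.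
apply/measurable_EFinP; apply: measurable_funM.
  by apply: measurable_kernel_comp => //; exact: measurable_funB.
exact: measurable_psi.
Qed.

Lemma measurable_duhamel (s : R) : measurable_fun setT (fun y => duhamel y s).
Proof.
have := @measurable_fun_fubini_tonelli_F _ _ X (measurableTypeR R) R leb
  (fun q => source q.1 s q.2) (measurable_source2 s).
by apply=> q; exact: source_ge0.
Qed.

Lemma mild_superaction x t s : 0 < s < t ->
  (linpart x t + \int[leb]_(r in `]-oo, s[) source x t r <=
   \int[m]_y ((p x y (t - s))%:E * (linpart y s + duhamel y s)))%E.
Proof.
move=> /andP[s0 st]; have ts0 : 0 < t - s by rewrite subr_gt0.
have mk : measurable_fun setT (fun y => (p x y (t - s))%:E).
  by apply/measurable_EFinP; exact: measurable_kernel_comp.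
under [leRHS]eq_integral => y _ do rewrite ge0_muleDr ?linpart_ge0 ?duhamel_ge0//.
have I1 y : (0 <= (p x y (t - s))%:E * linpart y s)%E by rewrite mule_ge0 ?lee_fin ?linpart_ge0.
have I2 y : (0 <= (p x y (t - s))%:E * duhamel y s)%E by rewrite mule_ge0 ?lee_fin ?duhamel_ge0.
have J1 : measurable_fun setT (fun y => (p x y (t - s))%:E * linpart y s)%E.
  by apply: emeasurable_funM => //; exact: measurable_linpart.
have J2 : measurable_fun setT (fun y => (p x y (t - s))%:E * duhamel y s)%E.
  by apply: emeasurable_funM => //; exact: measurable_duhamel.
rewrite [leRHS](ge0_integralD m measurableT (fun y _ => I1 y) J1 (fun y _ => I2 y) J2).
apply: leeD.
  have := @kernel_superaction x (t - s) s mu ts0 s0 mmu mu_ge0.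
  by rewrite (_ : t - s + s = t)//; ring.
under [leRHS]eq_integral => y _.
  rewrite /duhamel -(ge0_integralZl leb measurableT (measurable_source y s)
    (fun r _ => source_ge0 y s r) (_ : 0 <= (p x y (t - s))%:E)%E) ?lee_fin//.
  over.
have mF : measurable_fun setT (fun q : X * measurableTypeR R => ((p x q.1 (t - s))%:E * source q.1 s q.2)%E).
  apply: emeasurable_funM; last exact: measurable_source2.
  by apply/measurable_EFinP; exact: measurable_kernel_comp.
have F0 (q : X * measurableTypeR R) : (0 <= (p x q.1 (t - s))%:E * source q.1 s q.2)%E.
  by rewrite mule_ge0 ?lee_fin ?source_ge0.
rewrite [leRHS](@fubini_tonelli _ _ _ _ _ m leb _ mF F0).
have mG := @measurable_fun_fubini_tonelli_G _ _ X (measurableTypeR R) R m _ mF F0.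
(* Only [r < s] is kept: there both steps [t - s] and [s - r] are positive, as Chapman-Kolmogorov
   requires. The rest is dropped by nonnegativity. *)
apply: (@le_trans _ _ (\int[leb]_(r in `]-oo, s[) \int[m]_y ((p x y (t - s))%:E * source y s r))%E); last first.
  apply: ge0_subset_integral => //.
  by move=> r _; apply: integral_ge0 => y _; exact: (F0 (y, r)).
apply: ge0_le_integral => //.
- by move=> r _; exact: source_ge0.
- by apply: measurable_funTS; exact: measurable_source.
- exact: measurable_funTS.
move=> r; rewrite /= in_itv/= => rs.
have sr0 : 0 < s - r by rewrite subr_gt0.
have := @kernel_superaction x (t - s) (s - r) (psi ^~ r) ts0 sr0 _ _.
rewrite (_ : t - s + (s - r) = t - r); last by ring.
by apply=> //; exact: measurable_psi.
Qed.

Hypothesis mv : measurable_fun setT (fun q : X * R => v q.1 q.2).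
Hypothesis v_ge0 : forall z r, 0 <= v z r.

(* Jensen's inequality for the subprobability [p x _ (t - s)], in the form of
   an affine minorant [q * u - c] of the nonlinearity: [c >= 0] makes mass at
   most one sufficient. *)
Lemma source_ge_affine x t s (q c M : R) : 0 <= q -> 0 <= c ->
  (forall z, q * v z s <= psi z s + c) ->
  (M%:E <= \int[m]_y (p x y (t - s) * v y s)%:E)%E ->
  ((q * M - c)%:E <= source x t s)%E.
Proof.
move=> q0 c0 hq hM.
have mvs : measurable_fun setT (v ^~ s).
  exact: (measurableT_comp mv (@measurable_pair2 _ _ X R s)).
have mps : measurable_fun setT (psi ^~ s) by exact: measurable_psi.
have mk : measurable_fun setT (fun y => p x y (t - s)) by exact: measurable_kernel_comp.
rewrite EFinB leeBlDr//.
apply: (@le_trans _ _ (q%:E * \int[m]_y (p x y (t - s) * v y s)%:E)%E).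
  by rewrite EFinM lee_wpmul2l.
have k0 y : (0 <= (p x y (t - s))%:E)%E by rewrite lee_fin.
have v0 y : (0 <= (p x y (t - s) * v y s)%:E)%E by rewrite lee_fin mulr_ge0.
have s0 y : (0 <= (p x y (t - s) * psi y s)%:E)%E by rewrite lee_fin mulr_ge0.
have ck0 y : (0 <= c%:E * (p x y (t - s))%:E)%E by rewrite mule_ge0.
have mkE : measurable_fun setT (fun y => (p x y (t - s))%:E) by exact/measurable_EFinP.
have mvE : measurable_fun setT (fun y => (p x y (t - s) * v y s)%:E).
  by apply/measurable_EFinP; exact: measurable_funM.
have msE : measurable_fun setT (fun y => (p x y (t - s) * psi y s)%:E).
  by apply/measurable_EFinP; exact: measurable_funM.
have mcE : measurable_fun setT (fun y => c%:E * (p x y (t - s))%:E)%E.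
  exact: measurable_funeM.
rewrite -(ge0_integralZl m measurableT mvE (fun y _ => v0 y) (_ : 0 <= q%:E)%E) ?lee_fin//.
apply: (@le_trans _ _ (\int[m]_y ((p x y (t - s) * psi y s)%:E + c%:E * (p x y (t - s))%:E))%E).
  apply: ge0_le_integral => //.
  - by move=> y _; apply: mule_ge0; [rewrite lee_fin|exact: v0].
  - exact: measurable_funeM.
  - exact: emeasurable_funD.
  - move=> y _; rewrite -!EFinM -EFinD lee_fin [c * _]mulrC -mulrDr mulrCA.
    by rewrite ler_wpM2l.
rewrite (ge0_integralD m measurableT (fun y _ => s0 y) msE (fun y _ => ck0 y) mcE).
rewrite leeD2l// (ge0_integralZl m measurableT mkE (fun y _ => k0 y) (_ : 0 <= c%:E)%E) ?lee_fin//.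
by rewrite -[leRHS]mule1 lee_wpmul2l.
Qed.

End duhamel.

(** * An Osgood-type lower bound *)

Section osgood.
Variable R : realType.
Local Notation leb := (@lebesgue_measure R).
Variable phi : R -> R.
Hypothesis nd_phi : {homo phi : x y / x <= y}.
Hypothesis mphi : measurable_fun setT (fun s => (phi s)^-1).

(** Since [1 / phi] is nonincreasing, the right-endpoint sum is a lower sum. *)
Lemma integral_inv_partition (h : nat -> R) k : 0 < phi (h 0%N) ->
  (forall i, (i < k)%N -> h i <= h i.+1) ->
  ((\sum_(i < k) (h i.+1 - h i) / phi (h i.+1))%:E <=
   \int[leb]_(s in `]h 0%N, h k]) ((phi s)^-1)%:E)%E /\ h 0%N <= h k.
Proof.
move=> h0; elim: k => [|k IH] hk.
  by split => //; rewrite big_ord0; apply: integral_ge0 => s; rewrite /= in_itv/= => /andP[s1 s2]; move: (lt_le_trans s1 s2); rewrite ltxx.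
have [IH1 IH2] := IH (fun i ik => hk i (ltnW ik)).
have hkk := hk k (ltnSn k).
split; last exact: le_trans hkk.
have pos s : h 0%N < s -> 0 < phi s.
  by move=> hs; apply: lt_le_trans h0 _; apply: nd_phi; exact: ltW.
have -> : `]h 0%N, h k.+1]%classic = `]h 0%N, h k] `|` `]h k, h k.+1].
  apply/seteqP; split => s /=; rewrite !in_itv/=.
    by move=> /andP[s1 s2]; case: (leP s (h k)) => s3; [left|right]; apply/andP.
  move=> [|] /andP[s1 s2]; apply/andP; split => //.
    exact: le_trans hkk.
  exact: le_lt_trans s1.
rewrite (@ge0_integral_setU _ _ _ leb); last 5 first.
- exact: measurable_itv.
- exact: measurable_itv.
- by apply: measurable_funTS; exact/measurable_EFinP.
- move=> s /= [|]; rewrite in_itv/= => /andP[s1 _]; rewrite lee_fin invr_ge0 ltW// pos//.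
  exact: le_lt_trans s1.
- apply/disj_setPS => s /=; rewrite !in_itv/= => -[/andP[_ s1] /andP[s2 _]].
  by move: (lt_le_trans s2 s1); rewrite ltxx.
rewrite big_ord_recr/= EFinD leeD//.
have E : ((h k.+1 - h k) / phi (h k.+1))%:E = (\int[leb]_(s in `]h k, h k.+1]) ((phi (h k.+1))^-1)%:E)%E.
  rewrite integral_cst//=.
  rewrite lebesgue_measure_itv/= lte_fin; case: ifPn => hh.
    by rewrite -EFinB -EFinM mulrC.
  have -> : h k.+1 = h k by apply/eqP; rewrite eq_le hkk leNgt hh.
  by rewrite subrr mul0r mule0.
rewrite E; apply: ge0_le_integral.
- exact: measurable_itv.
- move=> s; rewrite /= in_itv/= => /andP[s1 s2]; rewrite lee_fin invr_ge0 ltW// pos//.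
  by apply: le_lt_trans IH2 _; exact: lt_le_trans s1 s2.
- exact: measurable_cst.
- by apply: measurable_funTS; exact/measurable_EFinP.
- move=> s; rewrite /= in_itv/= => /andP[s1 s2].
  have ps : 0 < phi s by apply: pos; exact: le_lt_trans s1.
  have ps' : phi s <= phi (h k.+1) by exact: nd_phi.
  by rewrite lee_fin lef_pV2 ?posrE// (lt_le_trans ps).
Qed.

Lemma ln_le_sub1 (x : R) : 0 < x -> 1 + ln x <= x.
Proof. by move=> x0; rewrite -[leRHS](lnK x0); exact: expR_ge1Dx. Qed.

(* The ratios [r_i = phi (h i) / phi (h i.+1)] satisfy [1 + ln r_i <= r_i], and the
   sum of the [ln r_i] telescopes. *)
Lemma integral_inv_ge_of_increments (h : nat -> R) n (dl : R) : 0 <= dl -> 0 < phi (h 0%N) ->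
  (forall i, (i < n)%N -> h i + dl * phi (h i) <= h i.+1) ->
  ((dl * (n%:R + ln (phi (h 0%N)) - ln (phi (h n))))%:E <=
   \int[leb]_(s in `]h 0%N, +oo[) ((phi s)^-1)%:E)%E.
Proof.
move=> dl0 p0 hi.
have hp k : (k <= n)%N -> 0 < phi (h k).
  elim: k => // k IH kn; have pk := IH (ltnW kn).
  apply: lt_le_trans pk _; apply: nd_phi; apply: le_trans (hi k kn).
  by rewrite lerDl mulr_ge0// ltW// IH// ltnW.
have hmono i : (i < n)%N -> h i <= h i.+1.
  by move=> i1; apply: le_trans (hi i i1); rewrite lerDl mulr_ge0// ltW// hp// ltnW.
have [H1 H2] := integral_inv_partition p0 hmono.
apply: (@le_trans _ _ (\int[leb]_(s in `]h 0%N, h n]) ((phi s)^-1)%:E)%E); last first.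
  apply: (@ge0_subset_integral _ _ _ leb).
  - exact: measurable_itv.
  - exact: measurable_itv.
  - by apply: measurable_funTS; exact/measurable_EFinP.
  - move=> s; rewrite /= in_itv/= andbT => s1; rewrite lee_fin invr_ge0 ltW//.
    by apply: lt_le_trans p0 _; apply: nd_phi; exact: ltW.
  - by move=> s; rewrite /= !in_itv/= => /andP[-> _].
apply: le_trans H1; rewrite lee_fin.
have {}hi : forall i, (i < n)%N -> dl * (1 + (ln (phi (h i)) - ln (phi (h i.+1)))) <= (h i.+1 - h i) / phi (h i.+1).
  move=> i i1; have pi0 := hp i (ltnW i1); have pi1 := hp i.+1 i1.
  rewrite -ln_div ?posrE// (@le_trans _ _ (dl * (phi (h i) / phi (h i.+1))))//.
    by rewrite ler_wpM2l// ln_le_sub1// divr_gt0.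
  by rewrite mulrA ler_wpM2r ?invr_ge0 ?(ltW pi1)// lerBrDl hi.
have -> : dl * (n%:R + ln (phi (h 0%N)) - ln (phi (h n))) =
    \sum_(i < n) dl * (1 + (ln (phi (h i)) - ln (phi (h i.+1)))).
  rewrite -mulr_sumr big_split/= sumr_const card_ord -addrA; congr (_ * (_ + _)).
  elim: n {hp hmono H2 hi} => [|k IH]; first by rewrite big_ord0 subrr.
  by rewrite big_ord_recr/= -IH; ring.
by apply: ler_sum => i _; exact: hi.
Qed.

Variable A : R -> \bar R.
Hypothesis mA : measurable_fun setT A.
Hypothesis A0 : forall s, (0 <= A s)%E.
Variables (w0 b t : R) (N : set R).
Hypothesis t0 : 0 < t.
Hypothesis bw0 : b <= w0.
Hypothesis phib : 0 < phi b.

(** The function [H] of the overview. The linear part [w0] is taken at the final time [t] and does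
    not vary with [s]. *)
Definition level s : \bar R := (w0%:E + \int[leb]_(r in `]-oo, s[) A r)%E.

Hypothesis level_fin : (level t < +oo)%E.
Hypotheses (mN : measurable (N : set (measurableTypeR R))) (N0 : leb N = 0%E).
Hypothesis A_ge : forall s M, 0 < s < t -> ~ N s -> b <= M ->
  (M%:E <= level s)%E -> ((phi M / 2)%:E <= A s)%E.

Lemma level_ge s : (w0%:E <= level s)%E.
Proof. by rewrite leeDl// integral_ge0. Qed.

Lemma level_split s s' : s <= s' ->
  level s' = (level s + \int[leb]_(r in `[s, s'[) A r)%E.
Proof.
move=> ss; rewrite /level -addeA; congr (_ + _)%E.
have -> : `]-oo, s'[%classic = `]-oo, s[ `|` `[s, s'[.
  apply/seteqP; split => r /=; rewrite !in_itv/=.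
    by move=> rs; case: (ltP r s) => rs'; [left|right].
  by move=> [rs|/andP[]//]; exact: lt_le_trans ss.
rewrite (@ge0_integral_setU _ _ _ leb)//.
- exact: measurable_funTS.
- apply/disj_setPS => r /=; rewrite !in_itv/= => -[r1 /andP[r2 _]].
  by move: (lt_le_trans r1 r2); rewrite ltxx.
Qed.

Lemma level_fin_num s : s <= t -> level s \is a fin_num.
Proof.
move=> st; have sfin : (level s < +oo)%E.
  by apply: le_lt_trans level_fin; rewrite (level_split st) leeDl// integral_ge0.
rewrite fin_numElt sfin andbT.
by apply: lt_le_trans (level_ge s); rewrite ltNyr.
Qed.

(** An explicit Euler step: [level] is nondecreasing, so on [[s, s'[] the source is almost
    everywhere at least half of [phi] at the starting level. *)
Lemma level_increment s s' : 0 <= s -> s <= s' -> s' <= t ->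
  fine (level s) + (s' - s) / 2 * phi (fine (level s)) <= fine (level s').
Proof.
move=> s0 ss st.
have f1 := level_fin_num (le_trans ss st); have f2 := level_fin_num st.
rewrite -lee_fin fineK// EFinD fineK// (level_split ss) leeD2l//.
set M := fine (level s).
have bM : b <= M by rewrite (le_trans bw0)// -lee_fin fineK// level_ge.
have pM : 0 < phi M by apply: lt_le_trans phib _; exact: nd_phi.
have -> : ((s' - s) / 2 * phi M)%:E = (\int[leb]_(r in `[s, s'[) (phi M / 2)%:E)%E.
  rewrite integral_cst//=.
  rewrite lebesgue_measure_itv/= lte_fin; case: ifPn => hh.
    by rewrite -EFinB -EFinM; congr EFin; ring.
  have -> : s' = s by apply/eqP; rewrite eq_le ss leNgt hh.
  by rewrite subrr !mul0r mule0.
apply: ae_ge0_le_integral.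
- exact: measurable_itv.
- by move=> r _; rewrite lee_fin divr_ge0// ltW.
- exact: measurable_cst.
- by move=> r _.
- exact: measurable_funTS.
(* The time 0 joins the null set because [A_ge] speaks of positive times only. *)
exists (N `|` [set 0]); split.
- by apply: measurableU => //; exact: measurable_set1.
- have m0 : measurable ([set 0] : set (measurableTypeR R)) by exact: measurable_set1.
  apply/eqP; rewrite -measure_le0 (le_trans (measureU2 leb mN m0))//.
  by rewrite [X in (X + _)%E]N0 add0e [X in (X <= _)%E]lebesgue_measure_set1.
move=> r /= /not_implyP[]; rewrite in_itv/= => /andP[sr rs] hr.
have [->|r0] := eqVneq r 0; first by right.
left; apply: contra_notP hr => Nr.
apply: (A_ge _ Nr bM).
  by rewrite lt_neqAle eq_sym r0 (le_trans s0 sr) (lt_le_trans rs st).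
rewrite /M fineK//; rewrite (level_split sr) leeDl// integral_ge0//.
Qed.

(** The telescoped logarithm [L] does not depend on the mesh and is a real number because [level t]
    is finite. With [n >= 2 * L] steps it costs at most half of the ideal bound [t / 2]. *)
Lemma integral_inv_ge_quarter : ((t / 4)%:E <= \int[leb]_(s in `]w0, +oo[) ((phi s)^-1)%:E)%E.
Proof.
pose L := ln (phi (fine (level t))) - ln (phi (fine (level 0))).
pose n := (Num.truncn (2 * L)).+1.
have n0 : 0 < n%:R :> R by rewrite ltr0n.
have nL : 2 * L <= n%:R by rewrite ltW// truncnS_gt.
pose h i : R := fine (level (i%:R * (t / n%:R))).
have tn0 : 0 <= t / n%:R by rewrite divr_ge0// ltW.
have lw0 : w0 <= fine (level 0) by rewrite -lee_fin fineK ?level_ge// level_fin_num// ltW.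
have p0 : 0 < phi (h 0%N) by rewrite /h mul0r; apply: lt_le_trans phib _; apply: nd_phi; exact: le_trans bw0 lw0.
have hi i : (i < n)%N -> h i + (t / n%:R / 2) * phi (h i) <= h i.+1.
  move=> i1; rewrite /h.
  have := @level_increment (i%:R * (t / n%:R)) (i.+1%:R * (t / n%:R)).
  have -> : (i.+1%:R * (t / n%:R) - i%:R * (t / n%:R)) / 2 = t / n%:R / 2.
    by rewrite -mulrBl -natrB// subSnn mul1r.
  apply.
  - by rewrite mulr_ge0.
  - by rewrite ler_wpM2r// ler_nat.
  - by rewrite mulrA ler_pdivrMr// mulrC ler_wpM2l ?(ltW t0)// ler_nat.
have tn2 : 0 <= t / n%:R / 2 by rewrite divr_ge0.
have := integral_inv_ge_of_increments tn2 p0 hi.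
have -> : h n = fine (level t) by rewrite /h mulrC divfK// gt_eqF.
rewrite {1 2}/h mul0r => H.
apply: (@le_trans _ _ (\int[leb]_(s in `]fine (level 0%R), +oo[) ((phi s)^-1)%:E)%E).
  apply: le_trans H; rewrite lee_fin -addrA -opprB -/L.
  rewrite -ler_pdivrMl ?divr_gt0//.
  have -> : (t / n%:R / 2)^-1 * (t / 4) = n%:R / 2 by field; rewrite !gt_eqF.
  by lra.
apply: (@ge0_subset_integral _ _ _ leb).
- exact: measurable_itv.
- exact: measurable_itv.
- by apply: measurable_funTS; exact/measurable_EFinP.
- move=> s; rewrite /= in_itv/= andbT => s1; rewrite lee_fin invr_ge0 ltW//.
  by apply: lt_le_trans phib _; apply: nd_phi; exact: le_trans bw0 (ltW s1).
- by move=> s; rewrite /= !in_itv/= !andbT; exact: le_lt_trans.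
Qed.

End osgood.

(** * Affine minorants of the nonlinearity *)

Section nonlinearity.
Variable R : realType.
Local Notation leb := (@lebesgue_measure R).
Variable f : R -> R.
Hypotheses (fM : condM f) (fS : condS f) (fC : condC f).

(** The hypotheses do not control [f] at negative arguments; extending by [f 0] makes it monotone,
    hence measurable, on the whole line. *)
Definition fpos (u : R) : R := f (Num.max 0 u).

Lemma fposE u : 0 <= u -> fpos u = f u.
Proof. by move=> u0; rewrite /fpos max_r. Qed.

Lemma fpos_ge0 u : 0 <= fpos u.
Proof. by have [f0 _] := fM; apply: f0; rewrite le_max lexx. Qed.

Lemma nd_fpos : {homo fpos : x y / x <= y}.
Proof.
have [_ [_ [ndf _]]] := fM; move=> x y xy; apply: ndf; first by rewrite le_max lexx.
by rewrite ge_max !le_max lexx/= xy orbT.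
Qed.

Lemma fpos_gt0 u : 0 < u -> 0 < fpos u.
Proof. by have [_ [_ [_ f0]]] := fM; move=> u0; rewrite fposE ?ltW// f0. Qed.

Lemma measurable_fpos : measurable_fun setT fpos.
Proof. by apply: nondecreasing_measurable => //; exact: nd_fpos. Qed.

Lemma measurable_fposV : measurable_fun setT (fun u => (fpos u)^-1).
Proof.
rewrite (_ : (fun _ => _) = (@powR R) ^~ (-1) \o fpos).
  by apply: measurableT_comp; [exact: measurable_powR|exact: measurable_fpos].
by apply/funext => u /=; rewrite powR_inv1// fpos_ge0.
Qed.

(** If [fpos] stayed below [K] beyond [a], then [1 / f] would exceed [1 / K] on a half-line, against
    the integrability in (S). *)
Lemma fpos_unbounded (a K : R) : exists b, a < b /\ K <= fpos b.
Proof.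
have [tau0 [tau00 [_ [_ [_ fin]]]]] := fS.
apply: contrapT => H.
have fK b : a < b -> fpos b < K.
  by move=> ab; rewrite ltNge; apply/negP => h; apply: H; exists b.
pose c := Num.max a tau0.
have ac : a <= c by rewrite le_max lexx.
have tc : tau0 <= c by rewrite le_max lexx orbT.
have c0 : 0 < c by exact: lt_le_trans tc.
have K0 : 0 < K.
  apply: (@lt_trans _ _ (fpos (c + 1))); first by rewrite fpos_gt0// addr_gt0.
  by apply: fK; rewrite (le_lt_trans ac)// ltrDl.
have : (+oo <= \int[leb]_(s in `[tau0, +oo[) ((f s)^-1)%:E)%E.
  have E : (\int[leb]_(s in `[tau0, +oo[) ((f s)^-1)%:E = \int[leb]_(s in `[tau0, +oo[) ((fpos s)^-1)%:E)%E.
    apply: eq_integral => s; rewrite inE/= in_itv/= andbT => ts.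
    by rewrite fposE// (le_trans _ ts)// ltW.
  rewrite E.
  apply: (@le_trans _ _ (\int[leb]_(s in `]c, +oo[) ((fpos s)^-1)%:E)%E).
    apply: (@le_trans _ _ (\int[leb]_(s in `]c, +oo[) (K^-1)%:E)%E).
      rewrite integral_cst//= lebesgue_measure_itv/= ltry.
      by rewrite gt0_muley// lte_fin invr_gt0.
    apply: ge0_le_integral.
    - exact: measurable_itv.
    - by move=> s _; rewrite lee_fin invr_ge0 ltW.
    - exact: measurable_cst.
    - by apply: measurable_funTS; apply/measurable_EFinP; exact: measurable_fposV.
    - move=> s; rewrite /= in_itv/= andbT => cs; rewrite lee_fin lef_pV2 ?posrE//.
        by apply/ltW/fK; exact: le_lt_trans cs.
      by rewrite fpos_gt0// (lt_trans c0).
  apply: (@ge0_subset_integral _ _ _ leb).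
  - exact: measurable_itv.
  - exact: measurable_itv.
  - by apply: measurable_funTS; apply/measurable_EFinP; exact: measurable_fposV.
  - by move=> s _; rewrite lee_fin invr_ge0 fpos_ge0.
  - by move=> s; rewrite /= !in_itv/= !andbT => cs; rewrite (le_trans tc)// ltW.
by rewrite leye_eq => /eqP e; move: fin; rewrite e ltxx.
Qed.

Lemma convex_slopes (a u M w : R) : 0 <= a ->
  (forall x y (l : R), a <= x -> a <= y -> 0 <= l <= 1 ->
      f (l * x + (1 - l) * y) <= l * f x + (1 - l) * f y) ->
  a <= u -> u < M -> M < w -> (f M - f u) / (M - u) <= (f w - f M) / (w - M).
Proof.
move=> a0 cvx au uM Mw.
have h1 : 0 < M - u by rewrite subr_gt0.
have h2 : 0 < w - M by rewrite subr_gt0.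
have h3 : 0 < w - u by rewrite subr_gt0 (lt_trans uM).
have := @cvx u w ((w - M) / (w - u)) au (le_trans au (ltW (lt_trans uM Mw))).
have l01 : 0 <= (w - M) / (w - u) <= 1.
  by rewrite divr_ge0 ?(ltW h2) ?(ltW h3)//= ler_pdivrMr// mul1r lerD2l lerN2 ltW.
move=> /(_ l01).
have -> : (w - M) / (w - u) * u + (1 - (w - M) / (w - u)) * w = M by field; rewrite gt_eqF.
have -> : (w - M) / (w - u) * f u + (1 - (w - M) / (w - u)) * f w =
  ((w - M) * f u + (M - u) * f w) / (w - u) by field; rewrite gt_eqF.
rewrite ler_pdivlMr// => h; rewrite ler_pdivrMr// mulrAC ler_pdivlMr//.
by move: h; move: (f M) (f u) (f w) => x y z; nra.
Qed.

(** The tangent at [M] lies below [f] only on [[a, +oo[], where [f] is convex. To the left of [a] it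
    is at most its value at [a], hence at most [f a]; lowered by [f a] it is nonpositive there, so
    it is a minorant on the whole half-line. The loss [f a] is at most [f M / 2] because [b] is
    chosen with [fpos b >= 2 * f a]. *)
Lemma affine_minorant : exists2 b, 0 < b & forall M, b <= M ->
  exists q c, [/\ 0 <= q, 0 <= c, forall u, 0 <= u -> q * u <= fpos u + c &
                fpos M / 2 <= q * M - c].
Proof.
have [a [a0 cvx]] := fC; have [f0 [_ [ndf _]]] := fM.
have [b [ab fb]] := fpos_unbounded a (2 * f a).
have b0 : 0 < b by exact: le_lt_trans ab.
exists b => // M bM.
have aM : a < M by exact: lt_le_trans bM.
have M0 : 0 <= M by exact: le_trans (ltW aM).
(* The supremum of these chord slopes is the left derivative of [f] at [M]; chords to the right of
   [M] bound it from above. *)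
pose S := [set (f M - f u) / (M - u) | u in [set u | a <= u < M]].
have Sub (w : R) : M < w -> ubound S ((f w - f M) / (w - M)).
  by move=> Mw _ [u /andP[au uM] <-]; exact: (convex_slopes a0 cvx).
have MS : S !=set0 by exists ((f M - f a) / (M - a)), a => //=; rewrite lexx.
have bS : has_ubound S by exists ((f (M + 1) - f M) / (M + 1 - M)); apply: Sub; rewrite ltrDl.
pose q := sup S.
have q1 u : a <= u -> u < M -> f M - f u <= q * (M - u).
  move=> au uM; rewrite -ler_pdivrMr ?subr_gt0//; apply: ub_le_sup => //.
  by exists u => //=; rewrite au.
have q2 w : M < w -> q * (w - M) <= f w - f M.
  by move=> Mw; rewrite -ler_pdivlMr ?subr_gt0//; apply: ge_sup => //; exact: Sub.
have q0 : 0 <= q.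
  apply: (@le_trans _ _ ((f M - f a) / (M - a))).
    by rewrite divr_ge0// subr_ge0 ?ndf// ltW.
  by apply: ub_le_sup => //; exists a => //=; rewrite lexx.
have tang u : a <= u -> f M + q * (u - M) <= f u.
  move=> au; case: (ltgtP u M) => [uM|Mu|->].
  - by have := q1 u au uM; lra.
  - by have := q2 u Mu; lra.
  - by rewrite subrr mulr0 addr0.
have fa0 : 0 <= f a by exact: f0.
have ta := tang a (lexx a).
have qa0 : 0 <= q * a by exact: mulr_ge0.
exists q, (q * M - f M + f a); split => //.
- by move: ta; rewrite mulrBr; lra.
- move=> u u0; rewrite fposE//; have [au|ua] := leP a u.
    by have := tang u au; rewrite mulrBr; lra.
  have h1 : q * u <= q * a by rewrite ler_wpM2l// ltW.
  have h2 := f0 u u0.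
  by move: ta; rewrite mulrBr; lra.
- rewrite fposE//.
  have : 2 * f a <= f M by rewrite (le_trans fb)// fposE ?(ltW b0)// ndf// ltW.
  by lra.
Qed.

End nonlinearity.

(** * Passing to Borel representatives *)

Section null_sets.
Variable R : realType.
Local Notation leb := (@lebesgue_measure R).
Local Notation lam n := (lebN R n).

Lemma integralN_indic n (B : set (n.-tuple R)) : measurable B ->
  Defs.integralN (fun x => (\1_B x)%:E) = lam n B.
Proof.
move=> mB; rewrite ge0_integralNE; last 2 first.
- by apply/measurable_EFinP.
- by move=> x; rewrite lee_fin.
by rewrite integral_indic// setIT.
Qed.

Lemma nullNP n (A : set (n.-tuple R)) : nullN A ->
  exists B, [/\ measurable B, A `<=` B & lam n B = 0%E].
Proof. by move=> [B [mB [AB]]]; rewrite integralN_indic// => B0; exists B. Qed.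

(** [nullNT] integrates in space first, so slices at almost all times are null. Naming the
    exceptional times [N] allows work at each individual time outside it. *)
Lemma nullNT_slices n (A : set (n.-tuple R * R)) : nullNT A ->
  exists (B : set (n.-tuple R * R)) (N : set (measurableTypeR R)),
    [/\ measurable B, A `<=` B, measurable N, leb N = 0%E &
        forall t, ~ N t -> lam n (ysection B t) = 0%E].
Proof.
move=> [B [mB [AB B0]]].
have mB' : measurable (B : set (n.-tuple R * measurableTypeR R)) by [].
have mys := measurable_fun_ysection (lam n) mB'.
have : (\int[leb]_t lam n (ysection B t) = 0)%E.
  rewrite -[RHS]B0; apply: eq_integral => t _.
  rewrite -integralN_indic; last exact: measurable_ysection.
  by congr Defs.integralN; apply/funext => x; rewrite !indicE mem_ysection.
have E t : (`|lam n (ysection B t)| = lam n (ysection B t))%E by rewrite gee0_abs.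
under eq_integral do rewrite -E.
move/(ae_eq_integral_abs leb measurableT mys) => [N [mN N0 sN]].
exists B, N; split => // t; apply: contra_notP => h; apply: sN => /= h'.
by apply: h; exact: h'.
Qed.

Lemma nullNT_of_slices n (A B : set (n.-tuple R * R)) (N : set (measurableTypeR R)) :
  measurable B -> A `<=` B -> measurable N -> leb N = 0%E ->
  (forall t, ~ N t -> lam n (ysection B t) = 0%E) -> nullNT A.
Proof.
move=> mB AB mN N0 hN; exists B; split => //; split => //.
rewrite (ge0_integral_ae_nonmeasurable (h := fun=> 0%E) mN N0)//.
- by rewrite integral0.
- by move=> t; apply: integralN_ge0 => x; rewrite lee_fin.
- move=> t Nt; rewrite -(hN t Nt) -integralN_indic; last exact: measurable_ysection.
  by congr Defs.integralN; apply/funext => x; rewrite !indicE mem_ysection.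
Qed.

End null_sets.

(** * The mild formula for Borel representatives *)

Section theorem.
Variable R : realType.
Local Notation leb := (@lebesgue_measure R).
Variables (n : nat) (theta : R) (f : R -> R).
Hypothesis th : 0 < theta <= 2.
Hypothesis fM : condM f.
Local Notation X := (n.+1.-tuple R).
Local Notation lam := (lebN R n.+1).

Let th0 : 0 < theta. Proof. by case/andP: th. Qed.

(* The value [0] at nonpositive times lets the time integral of Duhamel's term
   range over the whole line. *)
Definition heatk (x y : X) t : R := if 0 < t then Gamma_theta theta (tsub x y) t else 0.

Lemma heatk_ge0 x y t : 0 <= heatk x y t.
Proof. by rewrite /heatk; case: ifPn => // t0; exact: Gamma_theta_ge0. Qed.

Lemma measurable_heatk : measurable_fun setT (fun q : X * X * R => heatk q.1.1 q.1.2 q.2).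
Proof.
have m1 : measurable_fun setT (fun q : X * X * R => q.1.1) by exact: measurableT_comp.
have m2 : measurable_fun setT (fun q : X * X * R => q.1.2) by exact: measurableT_comp.
by apply: (measurable_Gamma_theta th0) => //; exact: measurable_tsub.
Qed.

Lemma measurable_heatk1 x t : measurable_fun setT (fun y => heatk x y t).
Proof.
apply: (@measurable_kernel_comp _ _ _ _ measurable_heatk _ X (fun=> x) id (fun=> t)) => //.
Qed.

Lemma heatk_le1 x t : (\int[lam]_y (heatk x y t)%:E <= 1)%E.
Proof.
rewrite /heatk; have [t0|_] := boolP (0 < t).
  exact: integral_Gamma_theta_le1.
by rewrite integral0.
Qed.

Lemma heatk_ck x z a b : 0 < a -> 0 < b ->
  ((heatk x z (a + b))%:E <= \int[lam]_y (heatk x y a * heatk y z b)%:E)%E.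
Proof.
by move=> a0 b0; rewrite /heatk addr_gt0// a0 b0; exact: Gamma_theta_chapman_kolmogorov.
Qed.

Section solution.
Variables (mu : X -> R) (T : R) (u : X -> R -> \bar R).
Hypotheses (hmu : nonneg_loc_integrable mu) (hu : is_solution theta f mu T u).

(** The representative may be negative on a null set, hence the truncation at 0. A null change of
    the datum is invisible to the integral, so the equality holds at every point and positive
    time. *)
Lemma heat_sg_borel : exists mub : X -> R, [/\ measurable_fun setT mub, forall x, 0 <= mub x &
  forall x t, 0 < t -> heat_sg theta mu t x = linpart lam heatk mub x t].
Proof.
have [mu0 [[h [mh /nullNP [B [mB muB B0]]]] _]] := hmu.
exists (fun x => Num.max 0 (h x)); split => [|x|x t t0].
- by apply: measurable_maxr.
- by rewrite le_max lexx.
rewrite /heat_sg /linpart; apply: (ge0_integralN_ae mB B0).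
- by move=> y; rewrite lee_fin mulr_ge0// Gamma_theta_ge0.
- by move=> y; rewrite lee_fin mulr_ge0 ?heatk_ge0// le_max lexx.
- apply/measurable_EFinP; apply: measurable_funM; last exact: measurable_maxr.
  exact: measurable_heatk1.
move=> y yB; rewrite /heatk t0; congr ((_ * _)%:E).
have e : mu y = h y by apply: contrapT => hy; apply: yB; exact: muB.
by rewrite -e max_r.
Qed.

(** The three exceptional sets of [is_solution] are merged into [B]. At a time [s] outside [N] the
    slice of [B] is null, so [u] may be replaced by [v] inside the Duhamel integral for every
    [(x, t)], and the formula holds pointwise off [B]. *)
Lemma solution_borel (mub : X -> R) :
  (forall x t, 0 < t -> heat_sg theta mu t x = linpart lam heatk mub x t) ->
  exists (v : X -> R -> R) (B : set (X * R)) (N : set (measurableTypeR R)),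
  let psi z r := if 0 < r then fpos f (v z r) else 0 in
  [/\ measurable_fun setT (fun q : X * R => v q.1 q.2), forall z r, 0 <= v z r,
      measurable B /\ measurable N, leb N = 0%E /\ (forall t, ~ N t -> lam (ysection B t) = 0%E) &
      forall x t, 0 < t < T -> ~ B (x, t) ->
        (v x t)%:E = (linpart lam heatk mub x t + duhamel lam heatk psi x t)%E].
Proof.
move=> hmub.
have [u0 [[w [mw /nullNT_slices[B1 [N1 [mB1 sB1 mN1 N10 hN1]]]]]
  [/nullNT_slices[B2 [N2 [mB2 sB2 mN2 N20 hN2]]]
   /nullNT_slices[B3 [N3 [mB3 sB3 mN3 N30 hN3]]]]]] := hu.
(* For times in []0, T[], [fine] and the maximum alter [w] only inside [B]. *)
pose v z r := Num.max 0 (fine (w (z, r))).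
pose B := B1 `|` B2 `|` B3.
pose N := N1 `|` N2 `|` N3.
have mv : measurable_fun setT (fun q : X * R => v q.1 q.2).
  apply: measurable_maxr => //; apply: measurableT_comp => //.
  by rewrite (_ : (fun _ => _) = w)//; apply/funext => -[].
have v0 z r : 0 <= v z r by rewrite le_max lexx.
have mB : measurable B by apply: measurableU => //; exact: measurableU.
have mN : measurable N by apply: measurableU => //; exact: measurableU.
have N0 : leb N = 0%E.
  apply/eqP; rewrite -measure_le0.
  rewrite (le_trans (measureU2 leb (measurableU _ _ mN1 mN2) mN3))//.
  rewrite [X in (_ + X)%E]N30 adde0.
  by rewrite (le_trans (measureU2 leb mN1 mN2))// [X in (X + _)%E]N10 add0e [X in (X <= _)%E]N20.
have hN t : ~ N t -> lam (ysection B t) = 0%E.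
  move=> Nt.
  have n1 : ~ N1 t by move=> h; apply: Nt; left; left.
  have n2 : ~ N2 t by move=> h; apply: Nt; left; right.
  have n3 : ~ N3 t by move=> h; apply: Nt; right.
  have -> : ysection B t = ysection B1 t `|` ysection B2 t `|` ysection B3 t.
    by apply/seteqP; split => x; rewrite /B /ysection /= !inE.
  apply/eqP; rewrite -measure_le0.
  have my1 := measurable_ysection t mB1; have my2 := measurable_ysection t mB2.
  have my3 := measurable_ysection t mB3.
  rewrite (le_trans (measureU2 lam (measurableU _ _ my1 my2) my3))//.
  rewrite [X in (_ + X)%E](hN3 _ n3) adde0.
  by rewrite (le_trans (measureU2 lam my1 my2))// [X in (X + _)%E](hN1 _ n1) add0e [X in (X <= _)%E](hN2 _ n2).
have uv x t : 0 < t < T -> ~ B (x, t) -> u x t = (v x t)%:E.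
  move=> tT Bxt.
  have e : u x t = w (x, t) by apply: contrapT => h; apply: Bxt; left; left; apply: sB1.
  have uy : u x t <> +oo%E by move=> h; apply: Bxt; left; right; apply: sB2.
  have ux0 := u0 x t tT.
  rewrite /v -e; move: ux0 uy; case: (u x t) => //= r; rewrite lee_fin => r0 _.
  by rewrite max_r.
exists v, B, N => psi; split => // x t tT Bxt.
rewrite -uv//.
have -> : u x t = (heat_sg theta mu t x + \int[leb]_(s in [set s : R | (0 < s < t)%R])
    Defs.integralN (fun y => (Gamma_theta theta (tsub x y) (t - s)%R * f (fine (u y s)))%:E))%E.
  by apply: contrapT => h; apply: Bxt; right; apply: sB3.
have /andP[t0 tT'] := tT.
rewrite hmub//; congr (_ + _)%E.
have psi0 z r : 0 <= psi z r by rewrite /psi; case: ifPn => // _; exact: fpos_ge0.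
have mpsi : measurable_fun setT (fun q : X * R => psi q.1 q.2).
  apply: measurable_fun_ifT => //; first by apply: measurable_fun_ltr.
  exact: (measurableT_comp (measurable_fpos fM) mv).
have uf y s : 0 < s < t -> 0 <= f (fine (u y s)).
  move=> /andP[s0 st]; have [f0 _] := fM; apply: f0; apply: fine_ge0; apply: u0.
  by rewrite s0 (lt_trans st).
rewrite integral_mkcond /duhamel; apply: (ge0_integral_ae_nonmeasurable mN N0).
- move=> s; apply: erestrict_ge0 => r r0; apply: integralN_ge0 => y.
  have /andP[r1 r2] := r0.
  by rewrite lee_fin mulr_ge0 ?uf// Gamma_theta_ge0// subr_gt0.
- by move=> s; apply: source_ge0 => //; exact: heatk_ge0.
- by apply: measurable_source => //; [exact: heatk_ge0|exact: measurable_heatk].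
move=> s Ns; rewrite patchE; case: ifPn => [/set_mem st|/negP hst].
  have /andP[s1 s2] := st.
  have sT : 0 < s < T by rewrite s1 (lt_trans s2).
  apply: (ge0_integralN_ae (measurable_ysection s mB) (hN s Ns)).
  - by move=> y; rewrite lee_fin mulr_ge0 ?uf// Gamma_theta_ge0// subr_gt0.
  - by move=> y; rewrite lee_fin mulr_ge0// heatk_ge0.
  - apply/measurable_EFinP; apply: measurable_funM.
      exact: measurable_heatk1.
    by apply: (measurable_psi mpsi).
  move=> y yB; rewrite /heatk subr_gt0 s2 /psi s1 uv//=.
    by rewrite fposE.
  by move=> h; apply: yB; rewrite /ysection/= inE.
(* Outside []0, t[] one of the two cut-offs vanishes: that of [psi] for [s <= 0], that of [heatk]
   for [s >= t]. *)
rewrite /source integral0_eq// => z _.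
rewrite /heatk /psi; case: ifPn => s1; last by rewrite mul0r.
case: ifPn => s2; last by rewrite mulr0.
by exfalso; apply: hst; rewrite inE/= s2 -subr_gt0.
Qed.

End solution.
End theorem.

(** * The lower bound for [F] and the choice of constants *)

Section lifespan.
Variable R : realType.
Local Notation leb := (@lebesgue_measure R).
Variables (n : nat) (theta : R) (f : R -> R).
Hypothesis th : 0 < theta <= 2.
Hypothesis fM : condM f.
Local Notation X := (n.+1.-tuple R).
Local Notation lam := (lebN R n.+1).

Lemma bigF_fpos r : 0 <= r ->
  bigF f r%:E = (\int[leb]_(s in `]r, +oo[) ((fpos f s)^-1)%:E)%E.
Proof.
move=> r0; apply: eq_integral => s; rewrite inE/= in_itv/= andbT => rs.
by rewrite fposE// (le_trans r0)// ltW.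
Qed.

(** It suffices to integrate over []b, b + 1]], where [1 / f] is at least its value at the right
    end. *)
Lemma bigF_ge_inv (r b : R) : 0 <= r -> r <= b -> 0 < b -> (((fpos f (b + 1))^-1)%:E <= bigF f r%:E)%E.
Proof.
move=> r0 rb b0; rewrite bigF_fpos//.
have mV D : measurable D -> measurable_fun (D : set (measurableTypeR R)) (fun s => ((fpos f s)^-1)%:E).
  by move=> mD; apply: measurable_funTS; apply/measurable_EFinP; exact: measurable_fposV.
apply: (@le_trans _ _ (\int[leb]_(s in `]b, (b + 1)%R]) ((fpos f s)^-1)%:E)%E).
  have -> : ((fpos f (b + 1))^-1)%:E = (\int[leb]_(s in `]b, (b + 1)%R]) ((fpos f (b + 1)%R)^-1)%:E)%E.
    rewrite integral_cst//= lebesgue_measure_itv/= lte_fin ltrDl ltr01.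
    by rewrite -EFinB -EFinM; congr EFin; ring.
  apply: ge0_le_integral.
  - exact: measurable_itv.
  - by move=> s _; rewrite lee_fin invr_ge0 fpos_ge0.
  - exact: measurable_cst.
  - by apply: mV; exact: measurable_itv.
  - move=> s; rewrite /= in_itv/= => /andP[bs sb].
    have s0 : 0 < s by exact: lt_trans bs.
    by rewrite lee_fin lef_pV2 ?posrE ?fpos_gt0 ?addr_gt0// nd_fpos.
apply: (@ge0_subset_integral _ _ _ leb).
- exact: measurable_itv.
- exact: measurable_itv.
- by apply: mV; exact: measurable_itv.
- by move=> s _; rewrite lee_fin invr_ge0 fpos_ge0.
- move=> s; rewrite /= !in_itv/= andbT => /andP[bs _]; exact: le_lt_trans bs.
Qed.

Lemma heat_sg_lifespan (mu : X -> R) (T b Ts : R) (u : X -> R -> \bar R) :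
  nonneg_loc_integrable mu -> is_solution theta f mu T u ->
  0 < b ->
  (forall M, b <= M ->
    exists q c, [/\ 0 <= q, 0 <= c, forall u, 0 <= u -> q * u <= fpos f u + c &
                fpos f M / 2 <= q * M - c]) ->
  Ts < T -> Ts <= (fpos f (b + 1))^-1 ->
  nullNT [set p : X * R | 0 < p.2 < Ts /\
     ~ (bigF f (heat_sg theta mu p.2 p.1) >= (4^-1 * p.2)%:E)%E].
Proof.
move=> hmu hu b0 hb TsT Tsb.
have [mub [mmub mub0 hmub]] := heat_sg_borel th hmu.
have [v [B [N [mv v0 [mB mN] [N0 hN] hv]]]] := solution_borel th fM hu hmub.
apply: (nullNT_of_slices mB _ mN N0 hN) => -[x t] /= [/andP[t0 tTs]].
apply: contra_notP => Bxt.
have tT : 0 < t < T by rewrite t0 (lt_trans tTs).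
set psi := (fun z r => if 0 < r then fpos f (v z r) else 0) in hv.
have psi0 z r : 0 <= psi z r by rewrite /psi; case: ifPn => // _; exact: fpos_ge0.
have mpsi : measurable_fun setT (fun q : X * R => psi q.1 q.2).
  apply: measurable_fun_ifT => //; first by apply: measurable_fun_ltr.
  exact: (measurableT_comp (measurable_fpos fM) mv).
have k0 := heatk_ge0 (n := n) th.
have mk := measurable_heatk (n := n) th.
have S0 := @source_ge0 _ _ _ lam _ k0 psi psi0.
have L0 := @linpart_ge0 _ _ _ lam _ k0 mub mub0.
have D0 := @duhamel_ge0 _ _ _ lam _ k0 psi psi0.
rewrite hmub//.
have hvx := hv x t tT Bxt.
have Lfin : linpart lam (heatk theta) mub x t \is a fin_num.
  rewrite ge0_fin_numE//; apply: le_lt_trans (ltry (v x t)).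
  by rewrite hvx leeDl.
set w0 := fine (linpart lam (heatk theta) mub x t).
have w00 : 0 <= w0 by exact: fine_ge0.
rewrite -(fineK Lfin) -/w0 [(4^-1 * t)%R]mulrC.
have [bw|wb] := leP b w0; last first.
  apply: le_trans (bigF_ge_inv w00 (ltW wb) b0).
  rewrite lee_fin; apply: le_trans Tsb; apply: le_trans (ltW tTs).
  by rewrite ler_piMr ?(ltW t0)// invf_le1// ler1n.
rewrite bigF_fpos//.
have mS := @measurable_source _ _ _ lam _ k0 mk psi mpsi psi0 x t.
apply: (@integral_inv_ge_quarter R (fpos f) (nd_fpos fM) (measurable_fposV fM)
  (source lam (heatk theta) psi x t) mS _ w0 b t N t0 bw (fpos_gt0 fM b0)) => //.
(* Here the existence of a solution excludes blow-up: [level t] is at most [v x t], which is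
   finite. *)
- rewrite /level; apply: le_lt_trans (ltry (v x t)).
  rewrite hvx /w0 fineK// leeD2l//.
  by apply: (@ge0_subset_integral _ _ _ leb) => //; exact: measurable_itv.
move=> s M st Ns bM Mlev.
have /andP[s1 s2] := st.
have sT : 0 < s < T by rewrite s1 (lt_trans s2)//; case/andP: tT.
have [q [c [q0 c0 hq hM]]] := hb M bM.
apply: (@le_trans _ _ (q * M - c)%:E); first by rewrite lee_fin.
apply: (@source_ge_affine _ _ _ lam _ k0 mk _ psi v) => //.
- exact: heatk_le1.
- by move=> z; rewrite /psi s1 hq.
apply: (le_trans Mlev).
rewrite /level /w0 (fineK Lfin).
have ck y z a e := @heatk_ck R n theta th y z a e.
have H := mild_superaction k0 mk ck mmub mub0 mpsi psi0 x st.
apply: (le_trans H).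
(* As [s] is outside [N], the mild formula at time [s] holds for almost every [y], so the two
   integrals are equal. *)
rewrite le_eqVlt; apply/orP; left; apply/eqP.
apply: (ge0_integral_ae_nonmeasurable (measurable_ysection s mB) (hN s Ns)).
- by move=> y; apply: mule_ge0; [rewrite lee_fin; exact: k0|apply: adde_ge0; [exact: L0|exact: D0]].
- by move=> y; rewrite lee_fin; apply: mulr_ge0; [exact: k0|exact: v0].
- apply/measurable_EFinP; apply: measurable_funM; first exact: measurable_heatk1.
  exact: (measurableT_comp mv (@measurable_pair2 _ _ _ _ s)).
- move=> y yB; rewrite EFinM (hv y s sT)//.
  by move=> h; apply: yB; rewrite /ysection/= inE.
Qed.

End lifespan.

Theorem theorem2p1 (R : realType) (N : nat) (theta : R) (f : R -> R) :
  (1 <= N)%N -> 0 < theta <= 2 ->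
  condM f -> condS f -> condC f ->
  exists Cstar : R, 0 < Cstar < 1 /\
    forall (mu : N.-tuple R -> R) (T : R),
      nonneg_loc_integrable mu -> 0 < T ->
      exists Tstar : R, 0 < Tstar < T /\
        ((exists u, is_solution theta f mu T u) ->
         nullNT [set p : N.-tuple R * R | 0 < p.2 < Tstar /\
                   ~ (bigF f (heat_sg theta mu p.2 p.1) >= (Cstar * p.2)%:E)%E]).
Proof.
case: N => // n _ th fM fS fC.
(* The constant of [integral_inv_ge_quarter], the same for every [f]. *)
exists 4^-1; split; first by rewrite invr_gt0 ltr0n/= invf_lt1// ltr1n.
have [b b0 hb] := affine_minorant fM fS fC.
have pb : 0 < (fpos f (b + 1))^-1 by rewrite invr_gt0 fpos_gt0// addr_gt0.
(* [T / 2] keeps all times strictly below [T]; the other bound serves the points where S(t) mu (x)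
   is below [b]. *)
move=> mu T hmu T0; exists (Num.min (T / 2) (fpos f (b + 1))^-1).
split.
  by rewrite lt_min divr_gt0//= pb/= gt_min ltr_pdivrMr// ltr_pMr// ltr1n.
move=> [u hu]; apply: (heat_sg_lifespan th fM hmu hu b0 hb).
  by rewrite gt_min ltr_pdivrMr// ltr_pMr// ltr1n.
by rewrite ge_min lexx orbT.
Qed.
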